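(* There exists a numerical constant $c>0$ such that the following holds. Suppose the environment law $Q$ satisfies $\mathbb{E}_Q\big[\log\frac{1-\alpha_0}{\alpha_0}\big]=0$, $\sigma^2:=\mathrm{Var}_Q\big[\log\frac{1-\alpha_0}{\alpha_0}\big]>0$, and, for some $0<\eta_0<1/2$, $\sup\{x: Q[\alpha_0\ge x]=1\}=\sup\{x: Q[\alpha_0\le 1-x]=1\}\ge\eta_0$. Then for all $\gamma\ge11$ there exist $c_1=c_1(Q,\gamma)$ and $n_0$ such that for all $n>n_0$ there exists $G_n'\subset\Omega_1$ with $Q[G_n']\ge 1-cR_2(n)$ and $$\sup_{\alpha\in G_n'}\left\{\mathbb{P}^\alpha_0\left[\left|\frac{\mathcal{L}(m_n,n)}{n}-\frac{1}{\mathbb{E}^\alpha_{m_n}[\mathcal{L}(W_n,T_{m_n})]}\right|>\frac{1}{(\log_2n)^2}\right]\right\}\le\frac{c_1}{(\log_2n)^2}.$$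
   Context: Random walk in random environment. $\alpha=(\alpha_i)_{i\in\mathbb{Z}}$ is a sequence of i.i.d. $(0,1)$-valued random variables on a probability space $(\Omega_1,\mathcal{F}_1,Q)$ (the environment); $\beta_i=1-\alpha_i$. For a fixed environment $\alpha$, $(X_n)_{n\in\mathbb{N}}$ is the Markov chain on $\mathbb{Z}$ with $\mathbb{P}^\alpha[X_n=i+1\mid X_{n-1}=i]=\alpha_i$, $\mathbb{P}^\alpha[X_n=i-1\mid X_{n-1}=i]=\beta_i$; $\mathbb{P}^\alpha_a$, $\mathbb{E}^\alpha_a$ are its law and expectation given $X_0=a$. $\mathbb{E}_Q$ is expectation under $Q$. For $G\subset\Omega_1$, ''$\alpha\in G$'' means $\alpha=\alpha(\omega)$ with $\omega\in G$. $\log_p$ ($p\ge2$) is the $p$-times iterated logarithm, and $n$ is always taken large enough that the iterated logarithms used are positive. $n_0$ may depend on the fixed parameters and on $Q$. Local time: $\mathcal{L}(k,T)=\sum_{i=1}^T \mathbf{1}_{\{X_i=k\}}$ and, for $V\subset\mathbb{Z}$, $\mathcal{L}(V,T)=\sum_{j\in V}\mathcal{L}(j,T)$ ($k,T$ possibly random). $T_x=\inf\{k\ge1: X_k=x\}$ ($+\infty$ if no such $k$). Potential: $\epsilon_i=\log\frac{1-\alpha_i}{\alpha_i}$, $S_0=0$, $S_k-S_j=\sum_{j+1\le i\le k}\epsilon_i$ for all integers $k>j$. Valleys: a triplet $\{M',m,M''\}$ (with $M'\le m\le M''$) is a valley if $S_{M'}=\max_{M'\le t\le m}S_t$, $S_{M''}=\max_{m\le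 t\le M''}S_t$, $S_m=\min_{M'\le t\le M''}S_t$ (if $m$ is not unique take the one of smallest absolute value). Its depth is $d([M',M''])=\min(S_{M'}-S_m,S_{M''}-S_m)$. Right refinement: take $m\le M_1<m_1\le M''$ with $S_{M_1}-S_{m_1}=\max_{m\le t'\le t''\le M''}(S_{t'}-S_{t''})$ (smallest absolute values if not unique); it yields the valleys $\{M',m,M_1\}$ and $\{M_1,m_1,M''\}$. Left refinement is defined symmetrically. Let $\gamma>0$ be a parameter and $\Gamma_n=\log n+\gamma\log_2 n$, $n>3$. A valley $\{M',m,M''\}$ contains $0$ and is of depth larger than $\Gamma_n$ if (1) $0\in[M',M'']$; (2) $d([M',M''])\ge\Gamma_n$; (3) if $m<0$, $S_{M''}-\max_{m\le t\le0}S_t\ge\gamma\log_2 n$, and if $m>0$, $S_{M'}-\max_{0\le t\le m}S_t\ge\gamma\log_2 n$. Basic valley $\{M_n',m_n,M_n\}$: let $\{M',m_n,M''\}$ be the smallest valley containing $0$ and of depth larger than $\Gamma_n$ (smallest: no other valley constructed inside it by refinement satisfies (1)-(3)). Then: if $m_n>0$, $M_n'=\sup\{l\in\mathbb{Z}_-: l<m_n,\ S_l-S_{m_n}\ge\Gamma_n,\ S_l-\max_{0\le k\le m_n}S_k\ge\gamma\log_2n\}$ and $M_n=\inf\{l\in\mathbb{Z}_+: l>m_n,\ S_l-S_{m_n}\ge\Gamma_n\}$; if $m_n<0$, $M_n'=\sup\{l\in\mathbb{Z}_-: l<m_n,\ S_l-S_{m_n}\ge\Gamma_n\}$ and $M_n=\inf\{l\in\mathbb{Z}_+: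 l>m_n,\ S_l-S_{m_n}\ge\Gamma_n,\ S_l-\max_{m_n\le k\le0}S_k\ge\gamma\log_2n\}$; if $m_n=0$, $M_n'=\sup\{l\in\mathbb{Z}_-: l<0,\ S_l-S_{m_n}\ge\Gamma_n\}$ and $M_n=\inf\{l\in\mathbb{Z}_+: l>0,\ S_l-S_{m_n}\ge\Gamma_n\}$. These objects depend on $\gamma$ and are considered for environments for which the basic valley exists. $W_n=\{M_n',M_n'+1,\dots,m_n,\dots,M_n-1,M_n\}$. Further notation: $R_p(n)=(\log_{p+1}n)^{1/2}(\log_pn)^{-1/2}$. *)

(* Defs.v *)
From HB Require Import structures.
From mathcomp Require Import all_boot all_order all_algebra finmap.
From mathcomp Require Import all_classical all_reals all_analysis.
From Stdlib Require Import Relation_Operators.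

Set Implicit Arguments.
Unset Strict Implicit.
Unset Printing Implicit Defensive.

Import Order.TTheory GRing.Theory Num.Theory.
Import numFieldNormedType.Exports.

Local Open Scope classical_set_scope.
Local Open Scope ring_scope.

(* Iterated logarithms. [ln] is 0 on nonpositive reals, so these formulas are
   meaningful only once the logarithms involved are positive (large n). *)

Definition ilog {R : realType} (p n : nat) : R := iter p (@ln R) n%:R.

Definition Rrate {R : realType} (p n : nat) : R :=
  (ilog p.+1 n) `^ 2^-1 * (ilog p n) `^ (- 2^-1).

Definition Gamma {R : realType} (gamma : R) (n : nat) : R :=
  ilog 1 n + gamma * ilog 2 n.

Definition mutually_independent {R : realType} d (T : measurableType d)
    (Q : probability T R) (I : choiceType) (Y : I -> {RV Q >-> R}) : Prop :=
  forall (J : {fset I}) (A : I -> set R), (forall i, measurable (A i)) ->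
    Q (\bigcap_(i in [set` J]) (Y i @^-1` A i)) =
    (\prod_(i <- J) Q (Y i @^-1` A i))%E.

Definition identically_distributed {R : realType} d (T : measurableType d)
    (Q : probability T R) (I : Type) (Y : I -> {RV Q >-> R}) : Prop :=
  forall (i j : I) (A : set R), measurable A ->
    Q (Y i @^-1` A) = Q (Y j @^-1` A).

Definition iid {R : realType} d (T : measurableType d)
    (Q : probability T R) (I : choiceType) (Y : I -> {RV Q >-> R}) : Prop :=
  mutually_independent Y /\ identically_distributed Y.

Definition log_ratio {R : realType} (x : R) : R := ln ((1 - x) / x).

Definition environment_at {R : realType} d (T : measurableType d)
    (Q : probability T R) (alpha : int -> {RV Q >-> R}) (w : T) : int -> R :=
  fun i => alpha i w.

Definition transition {R : realType} (a : int -> R) (i j : int) : R :=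
  if j == i + 1 then a i else if j == i - 1 then 1 - a i else 0.

(* Under [P], [X] is the Markov chain with transition probabilities
   [transition a] started at [x]; the Markov property is stated in product
   form, to avoid conditioning on null events. *)
Definition walk_law {R : realType} d (T : measurableType d)
    (X : nat -> T -> int) (a : int -> R) (x : int)
    (P : probability T R) : Prop :=
  [/\ forall (n : nat) (k : int), measurable (X n @^-1` [set k]),
      P (X 0%N @^-1` [set x]) = 1%E
    & forall (n : nat) (p : nat -> int),
        P [set w | forall i, (i <= n.+1)%N -> X i w = p i] =
        (P [set w | forall i, (i <= n)%N -> X i w = p i] *
         (transition a (p n) (p n.+1))%:E)%E].

(* [x] is a trajectory; the time [t] may be +oo. *)
Definition local_time {R : realType} (x : nat -> int) (k : int)
    (t : \bar R) : \bar R :=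
  (\sum_(1 <= i <oo | (i%:R)%:E <= t) ((x i == k)%:R)%:E)%E.

Definition local_time_set {R : realType} (x : nat -> int) (V : set int)
    (t : \bar R) : \bar R :=
  (\esum_(j in V) local_time x j t)%E.

Definition hitting_time {R : realType} (x : nat -> int) (k : int) : \bar R :=
  ereal_inf [set (i%:R)%:E | i in [set i : nat | (1 <= i)%N /\ x i = k]].

(* [Negz k] is the integer - (k + 1). *)
Definition potential {R : realType} (a : int -> R) (k : int) : R :=
  match k with
  | Posz k => \sum_(1 <= i < k.+1) log_ratio (a i%:Z)
  | Negz k => - \sum_(0 <= i < k.+1) log_ratio (a (- i%:Z))
  end.

Section Valleys.
Context {R : realType}.
Variable S : int -> R.

Definition zint (a b : int) : set int := [set t | a <= t <= b].

Definition maxS (a b : int) : R := sup (S @` zint a b).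
Definition minS (a b : int) : R := inf (S @` zint a b).

Definition least_abs (A : set int) (m : int) : Prop :=
  A m /\ forall t, A t -> `|m| <= `|t|.

Record triplet := Triplet { left_top : int; bottom : int; right_top : int }.

Definition is_valley (V : triplet) : Prop :=
  let: Triplet M' m M'' := V in
  [/\ M' <= m <= M'', S M' = maxS M' m, S M'' = maxS m M''
    & least_abs [set t | zint M' M'' t /\ S t = minS M' M''] m].

Definition depth (V : triplet) : R :=
  let: Triplet M' m M'' := V in Num.min (S M' - S m) (S M'' - S m).

(* Pairs (M1, m1) with m <= M1 < m1 <= M'' realising the largest drop of S
   from left to right on [m, M'']. *)
Definition max_drop (m M'' M1 m1 : int) : Prop :=
  [/\ m <= M1, M1 < m1, m1 <= M''
    & S M1 - S m1 =
      sup [set r | exists t' t'' : int,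
             [/\ m <= t', t' <= t'', t'' <= M'' & r = S t' - S t'']]].

(* Pairs (m1, M1) with M' <= m1 < M1 <= m realising the largest rise of S
   from left to right on [M', m]. *)
Definition max_rise (M' m m1 M1 : int) : Prop :=
  [/\ M' <= m1, m1 < M1, M1 <= m
    & S M1 - S m1 =
      sup [set r | exists t' t'' : int,
             [/\ M' <= t', t' <= t'', t'' <= m & r = S t'' - S t']]].

(* Ties are broken by the smallest absolute value, for M1 first and then
   for m1: with this order the two pieces are again valleys. *)
Definition right_refinement (V V' : triplet) : Prop :=
  let: Triplet M' m M'' := V in
  exists M1 m1 : int,
    [/\ least_abs [set t | exists u, max_drop m M'' t u] M1,
        least_abs [set u | max_drop m M'' M1 u] m1
      & V' = Triplet M' m M1 \/ V' = Triplet M1 m1 M''].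

Definition left_refinement (V V' : triplet) : Prop :=
  let: Triplet M' m M'' := V in
  exists M1 m1 : int,
    [/\ least_abs [set t | exists u, max_rise M' m u t] M1,
        least_abs [set u | max_rise M' m u M1] m1
      & V' = Triplet M' m1 M1 \/ V' = Triplet M1 m M''].

Definition refinement (V V' : triplet) : Prop :=
  right_refinement V V' \/ left_refinement V V'.

Variables (gamma : R) (n : nat).

Definition deep_valley_around0 (V : triplet) : Prop :=
  let: Triplet M' m M'' := V in
  [/\ is_valley V,
      M' <= 0 <= M'',
      Gamma gamma n <= depth V,
      m < 0 -> gamma * ilog 2 n <= S M'' - maxS m 0
    & 0 < m -> gamma * ilog 2 n <= S M' - maxS 0 m].

(* [clos_trans]: refinements may be iterated. *)
Definition smallest_deep_valley (V : triplet) : Prop :=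
  deep_valley_around0 V /\
  forall V', clos_trans _ refinement V V' -> ~ deep_valley_around0 V'.

(* Supremum (infimum) of a set of integers; none exists when the set is empty
   or unbounded. *)
Definition is_int_sup (A : set int) (l : int) : Prop :=
  A l /\ forall k, A k -> k <= l.
Definition is_int_inf (A : set int) (l : int) : Prop :=
  A l /\ forall k, A k -> l <= k.

Definition basic_valley (V : triplet) : Prop :=
  let: Triplet M' m M := V in
  [/\ exists K' K : int, smallest_deep_valley (Triplet K' m K),
      is_int_sup [set l | [/\ l <= 0, l < m, Gamma gamma n <= S l - S m
        & 0 < m -> gamma * ilog 2 n <= S l - maxS 0 m]] M'
    & is_int_inf [set l | [/\ 0 <= l, m < l, Gamma gamma n <= S l - S m
        & m < 0 -> gamma * ilog 2 n <= S l - maxS m 0]] M].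

End Valleys.

(* E^a_m [L(W, T_m)] for the walk of law [P] (started at m). *)
Definition mean_excursion_time {R : realType} d (T : measurableType d)
    (X : nat -> T -> int) (P : probability T R) (W : set int) (m : int) :
    \bar R :=
  (\int[P]_w local_time_set (X^~ w) W (hitting_time (X^~ w) m))%E.

(* The event |L(m, n) / n - 1 / e| > 1 / (log_2 n)^2. With e the real part
   [fine E] of an expectation E in [0, +oo], the case E = +oo gives e = 0 and
   e^-1 = 0, in agreement with 1 / E = 0. *)
Definition deviation_event {R : realType} (T : Type)
    (X : nat -> T -> int) (m : int) (n : nat) (e : R) : set T :=
  [set w | `| fine (local_time (X^~ w) m (n%:R)%:E) / n%:R - e^-1 |
           > ((ilog 2 n) ^+ 2)^-1].

(* Main.v *)
(** Let L = log n and l = log L. Exploring one half-line of the potential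
    completely before the other and betting on the path at suitable stopping
    times shows that, with probability 1 - O(l / L), the walk S climbs by
    Gamma_n above its running minimum within distance L^5 of 0 on both sides,
    never making an intermediate rise or fall whose height is between
    L - 20 l and Gamma_n, and that no near tie between the two half-lines
    makes the choice of the valley ambiguous. The ellipticity bound makes the
    steps of S bounded, and an error O(l / L) is much smaller than R_2(n). In
    such an environment the basic valley exists, is unique, and is explicit.

    For a fixed good environment let W be the valley, m its bottom, and t x the
    mean hitting time of m from x. As t solves a Poisson equation for
    1_{X = m} - 1 / (1 + Pt(m)), the centered number of visits to m is a
    martingale up to a corrector bounded by max t, as long as the walk stays in
    W. The resistances of the valley give t = O(n L^-10), because inside the
    valley the adverse slopes are at most L - 20 l; hence the second moment of
    the centered visits is O(n^2 L^-10). The same resistances show that the walk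
    leaves W before time n with probability O(L^-6), and that the mean time
    spent in W during an excursion from m differs from 1 + Pt(m) by a negligible
    relative amount. Chebyshev's inequality concludes. *)
Require Import Defs.
From HB Require Import structures.
From mathcomp Require Import all_boot all_order all_algebra finmap.
From mathcomp Require Import all_classical all_reals all_analysis.
From mathcomp Require Import measurable_realfun.
From mathcomp Require Import ring lra zify.
From Stdlib Require Import Relation_Operators.

Set Implicit Arguments.
Unset Strict Implicit.
Unset Printing Implicit Defensive.

Import Order.TTheory GRing.Theory Num.Theory.
Import numFieldNormedType.Exports.

Local Open Scope classical_set_scope.
Local Open Scope ring_scope.

(** * Walks with bounded independent steps *)

(** The exponents are tied together. In time L^5 the potential along a half-line leaves (-L^2, L^2)
    up to probability O(1/L), and it falls to -L^2 before climbing to Gamma_n with probability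
    O(1/L); hence the width O(L^5). A mean hitting time is at most the squared width times exp(L -
    20 l) up to a constant: L^10 is paid out of L^20. A margin gamma l with gamma at least 11 gives
    a factor L^-11, of which the width consumes L^5.

    Locating the bottom compares the two half-lines, and a comparison becomes a bet only if one side
    is known when the other is revealed. The known side has to be the one with the higher barrier
    between 0 and its minimum, and this side depends on the environment; so both orders of
    exploration are used, and the good event excludes the failures of both.

    A good environment gives no control of the potential far outside the valley, where the walk may
    even be lost for good. The functions solving the Poisson and Laplace equations are therefore
    continued harmonically outside W, and the mean excursion time is bounded below only up to an
    error governed by the chance of leaving W. *)

Section BoundedVariables.
Context {R : realType} d (T : measurableType d) (Q : probability T R).

Definition bounded_rv (f : T -> R) : Prop :=
  measurable_fun setT f /\ exists C : R, forall w, `|f w| <= C.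

Definition mean (f : T -> R) : R := \int[Q]_(w in setT) f w.

Lemma bounded_rv_integrable f : bounded_rv f -> Q.-integrable setT (EFin \o f).
Proof.
move=> [mf [C Cf]]; apply: (@le_integrable _ _ _ Q setT _ _ (EFin \o cst C)) => //.
- exact/measurable_EFinP.
- move=> w _ /=; rewrite lee_fin (le_trans (Cf w))// ler_norm//.
- exact: finite_measure_integrable_cst.
Qed.

Lemma bounded_rv_cst c : bounded_rv (cst c).
Proof. by split=> //; exists `|c|. Qed.

Lemma bounded_rvD f g : bounded_rv f -> bounded_rv g ->
  bounded_rv (fun w => f w + g w).
Proof.
move=> [mf [C Cf]] [mg [D Dg]]; split; first exact: measurable_funD.
by exists (C + D) => w; rewrite (le_trans (ler_normD _ _))// lerD.
Qed.

Lemma bounded_rvM f g : bounded_rv f -> bounded_rv g ->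
  bounded_rv (fun w => f w * g w).
Proof.
move=> [mf [C Cf]] [mg [D Dg]]; split; first exact: measurable_funM.
by exists (C * D) => w; rewrite normrM ler_pM.
Qed.

Lemma bounded_rv_sum n (f : nat -> T -> R) :
  (forall i, bounded_rv (f i)) -> bounded_rv (fun w => \sum_(i < n) f i w).
Proof.
move=> bf; elim: n => [|n IH].
  by rewrite (_ : (fun _ => _) = cst 0); [exact: bounded_rv_cst|
    apply/funext => w; rewrite big_ord0].
rewrite (_ : (fun _ => _) = (fun w => \sum_(i < n) f i w + f n w)).
  exact: bounded_rvD.
by apply/funext => w; rewrite big_ord_recr.
Qed.

Lemma bounded_rv_indic A : measurable A -> bounded_rv (\1_A).
Proof.
move=> mA; split; first exact: measurable_indic.
by exists 1 => w; rewrite ger0_norm// /indic; case: (_ \in _).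
Qed.

Lemma mean_le f g : bounded_rv f -> bounded_rv g -> (forall w, f w <= g w) ->
  mean f <= mean g.
Proof. by move=> bf bg fg; apply: le_Rintegral => //; exact: bounded_rv_integrable. Qed.

Lemma meanD f g : bounded_rv f -> bounded_rv g ->
  mean (fun w => f w + g w) = mean f + mean g.
Proof. by move=> bf bg; apply: RintegralD => //; exact: bounded_rv_integrable. Qed.

Lemma meanZ c f : bounded_rv f -> mean (fun w => c * f w) = c * mean f.
Proof. by move=> bf; apply: RintegralZl => //; exact: bounded_rv_integrable. Qed.

Lemma mean_cst c : mean (cst c) = c.
Proof.
rewrite /mean Rintegral_cst//.
by transitivity (c * 1); [congr (c * _); exact: (congr1 fine (probability_setT Q))|rewrite mulr1].
Qed.

Lemma mean_sum n (f : nat -> T -> R) : (forall i, bounded_rv (f i)) ->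
  mean (fun w => \sum_(i < n) f i w) = \sum_(i < n) mean (f i).
Proof.
move=> bf; elim: n => [|n IH].
  rewrite big_ord0 (_ : (fun _ => _) = cst 0) ?mean_cst//.
  by apply/funext => w; rewrite big_ord0.
rewrite big_ord_recr/= -IH -meanD//; last exact: bounded_rv_sum.
by congr mean; apply/funext => w; rewrite big_ord_recr.
Qed.

Lemma mean_indic A : measurable A -> (mean (\1_A))%:E = Q A.
Proof.
move=> mA; rewrite /mean /Rintegral integral_indic// setIT fineK//.
exact: fin_num_measure.
Qed.

Definition independent_rv (X Y : T -> R) : Prop :=
  forall A B, measurable A -> measurable B ->
  Q (X @^-1` A `&` Y @^-1` B) = (Q (X @^-1` A) * Q (Y @^-1` B))%E.

(** Independence says that the joint law agrees with the product of the marginals on rectangles,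
    hence everywhere by uniqueness of the product measure; Fubini then separates the factors. *)
Lemma mean_mul_independent X Y : bounded_rv X -> bounded_rv Y ->
  independent_rv X Y -> mean (fun w => X w * Y w) = mean X * mean Y.
Proof.
move=> bX bY XY; have [mX [C CX]] := bX; have [mY [D DY]] := bY.
pose X' : {RV Q >-> R} := HB.pack X (isMeasurableFun.Build _ _ _ _ X mX).
pose Y' : {RV Q >-> R} := HB.pack Y (isMeasurableFun.Build _ _ _ _ Y mY).
have mXY : measurable_fun setT (fun w => (X w, Y w)).
  exact: measurable_fun_pair.
pose mx : probability _ R := distribution Q X'; pose my : probability _ R := distribution Q Y'.
pose Z : {RV Q >-> (R * R)%type} :=
  HB.pack (fun w => (X w, Y w)) (isMeasurableFun.Build _ _ _ _ _ mXY).
have E : forall S, measurable S -> S `<=` setT -> distribution Q Z S = (mx \x my)%E S.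
  move=> S mS _; exact/esym/product_measure_unique.
pose f (z : R * R) := (z.1 * z.2)%:E.
have mf : measurable_fun setT f.
  by apply/measurable_EFinP; apply: measurable_funM; [exact: measurable_fst|exact: measurable_snd].
have iXY := bounded_rv_integrable (bounded_rvM bX bY).
have iX := bounded_rv_integrable bX.
have iY := bounded_rv_integrable bY.
have iabs : (\int[Q]_w (abse \o f) (Z w) < +oo)%E.
  by have /integrableP[_] := iXY.
have intf : (mx \x my)%E.-integrable setT f.
  apply/integrableP; split=> //.
  rewrite -(eq_measure_integral _ E) ge0_integral_distribution//.
  exact: measurableT_comp.
have e1 : (\int[Q]_w (X w * Y w)%:E = \int[mx]_x \int[my]_y f (x, y))%E.
  rewrite (integral12_prod_meas1 intf) -(eq_measure_integral _ E).
  by rewrite integral_distribution.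
have eX : (\int[mx]_x x%:E = \int[Q]_w (X w)%:E)%E.
  by rewrite integral_distribution//; exact: EFin_measurable.
have eY : (\int[my]_x x%:E = \int[Q]_w (Y w)%:E)%E.
  by rewrite integral_distribution//; exact: EFin_measurable.
have iy : my.-integrable setT EFin.
  apply/integrableP; split; first exact: EFin_measurable.
  rewrite ge0_integral_distribution//; first by have /integrableP[] := iY.
  by apply: measurableT_comp => //; exact: EFin_measurable.
have ix : mx.-integrable setT EFin.
  apply/integrableP; split; first exact: EFin_measurable.
  rewrite ge0_integral_distribution//; first by have /integrableP[] := iX.
  by apply: measurableT_comp => //; exact: EFin_measurable.
have fX : (\int[Q]_w (X w)%:E)%E \is a fin_num by exact: integrable_fin_num.
have fY : (\int[Q]_w (Y w)%:E)%E \is a fin_num by exact: integrable_fin_num.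
rewrite /mean /Rintegral e1 -fineM//; congr fine.
transitivity (\int[mx]_x (x%:E * (\int[Q]_w (Y w)%:E)))%E.
  apply: eq_integral => x _.
  transitivity (\int[my]_y (x%:E * y%:E))%E.
    by apply: eq_integral => y _; rewrite /f EFinM.
  by rewrite integralZl// eY.
by rewrite -(fineK fY) integralZr//= eX.
Qed.
End BoundedVariables.

(** * The natural filtration of a sequence of independent variables *)

Section Filtration.
Context {R : realType} d (T : measurableType d) (Q : probability T R).
Variable Z : nat -> T -> R.
Hypothesis mZ : forall i, measurable_fun setT (Z i).

Definition cylinders (n : nat) : set_system T :=
  [set A | exists2 B : nat -> set R, (forall i, measurable (B i)) &
     A = \bigcap_(i in `I_n) Z i @^-1` B i].

(** Index n stands for the knowledge of the first n variables only, so that [Z n] is the next, still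
    independent, step. *)
Definition past (n : nat) : set_system T := <<s cylinders n >>.

Definition adapted (n : nat) (f : T -> R) : Prop :=
  @measurable_fun _ _ (g_sigma_algebraType (cylinders n)) R setT f.

Lemma past_measurable n A : past n A -> measurable A.
Proof.
apply: smallest_sub; first exact: sigma_algebra_measurable.
move=> _ [B mB ->]; apply: bigcap_measurableType => i _.
by rewrite -[X in measurable X]setTI; exact: mZ.
Qed.

Lemma pastW m n A : (m <= n)%N -> past m A -> past n A.
Proof.
move=> mn; apply: smallest_sub; first exact: smallest_sigma_algebra.
move=> _ [B mB ->]; apply: sub_gen_smallest.
exists (fun i => if (i < m)%N then B i else setT).
  by move=> i; case: ifP.
apply/seteqP; split=> w /= Bw i /= i_n.
  by case: ifP => // im; exact: Bw.
by have := Bw i (leq_trans i_n mn); rewrite i_n.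
Qed.

Lemma pastC n A : past n A -> past n (~` A).
Proof. exact: (@measurableC _ (g_sigma_algebraType (cylinders n))). Qed.

Lemma pastT n : past n setT.
Proof. exact: (@measurableT _ (g_sigma_algebraType (cylinders n))). Qed.

Lemma pastI n A B : past n A -> past n B -> past n (A `&` B).
Proof. exact: (@measurableI _ (g_sigma_algebraType (cylinders n))). Qed.

(** This and the following closure properties are stated for set-builder formulas, so that the
    measurability of an event follows the syntax of its definition. *)
Lemma past_exists n (P : nat -> T -> Prop) : (forall i, past n [set w | P i w]) ->
  past n [set w | exists i, P i w].
Proof.
move=> PP; have -> : [set w | exists i, P i w] = \bigcup_i [set w | P i w].
  by apply/seteqP; split=> w /=; [move=> [i Pi]; exists i|move=> [i _ Pi]; exists i].
by apply: (@bigcupT_measurable _ (g_sigma_algebraType (cylinders n))).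
Qed.

Lemma past_forall n (P : nat -> T -> Prop) : (forall i, past n [set w | P i w]) ->
  past n [set w | forall i, P i w].
Proof.
move=> PP; have -> : [set w | forall i, P i w] = \bigcap_i [set w | P i w].
  by apply/seteqP; split=> w /= Pw => [i _|i]; exact: Pw.
by apply: (@bigcapT_measurable _ (g_sigma_algebraType (cylinders n))).
Qed.

Lemma past_and n (P P' : T -> Prop) : past n [set w | P w] -> past n [set w | P' w] ->
  past n [set w | P w /\ P' w].
Proof. exact: pastI. Qed.

Lemma past_not n (P : T -> Prop) : past n [set w | P w] -> past n [set w | ~ P w].
Proof. exact: pastC. Qed.

Lemma past_const n (P : Prop) : past n [set w | P].
Proof.
case: (pselect P) => p.
  by rewrite (_ : [set _ | _] = setT); [exact: pastT|apply/seteqP; split].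
rewrite (_ : [set _ | _] = set0); last by apply/seteqP; split.
by rewrite -setCT; apply: pastC; exact: pastT.
Qed.

Lemma past_imp n (P : Prop) (P' : T -> Prop) : (P -> past n [set w | P' w]) ->
  past n [set w | P -> P' w].
Proof.
move=> h; case: (pselect P) => p.
  by rewrite (_ : [set _ | _] = [set w | P' w]); [exact: h|apply/seteqP; split=> w /=; auto].
rewrite (_ : [set _ | _] = setT); first exact: pastT.
by apply/seteqP; split=> w // _ /p.
Qed.

Lemma past_and_const n (P : Prop) (P' : T -> Prop) : (P -> past n [set w | P' w]) ->
  past n [set w | P /\ P' w].
Proof.
move=> h; case: (pselect P) => p; first by apply: past_and; [exact: past_const|exact: h].
rewrite (_ : [set _ | _] = [set _ | False]); first exact: past_const.
by apply/seteqP; split=> w //= -[].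
Qed.

Lemma adapted_past n f B : adapted n f -> measurable B -> past n (f @^-1` B).
Proof.
move=> af mB; rewrite -[X in past n X]setTI.
by apply: (af _ _ mB); exact: (@measurableT _ (g_sigma_algebraType (cylinders n))).
Qed.

Lemma adapted_step n i : (i < n)%N -> adapted n (Z i).
Proof.
move=> i_n _ B mB; rewrite setTI; apply: sub_gen_smallest.
exists (fun j => if j == i then B else setT) => [j|]; first by case: ifP.
apply/seteqP; split=> w /= Bw => [j _|]; first by case: eqVneq => // ->.
by have := Bw i i_n; rewrite eqxx.
Qed.

Lemma adapted_cst n c : adapted n (cst c).
Proof. exact: (@measurable_cst _ _ (g_sigma_algebraType (cylinders n))). Qed.

Lemma adaptedD n f g : adapted n f -> adapted n g -> adapted n (fun w => f w + g w).
Proof. exact: (@measurable_funD _ (g_sigma_algebraType (cylinders n))). Qed.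

Lemma adaptedM n f g : adapted n f -> adapted n g -> adapted n (fun w => f w * g w).
Proof. exact: (@measurable_funM _ (g_sigma_algebraType (cylinders n))). Qed.

Lemma adaptedB n f g : adapted n f -> adapted n g -> adapted n (fun w => f w - g w).
Proof. exact: (@measurable_funB _ (g_sigma_algebraType (cylinders n))). Qed.

Lemma adapted_indic n A : past n A -> adapted n (\1_A).
Proof. exact: (@measurable_indic _ (g_sigma_algebraType (cylinders n))). Qed.

Lemma adapted_sum n i k : (k <= n)%N -> adapted n (fun w => \sum_(i <= j < k) Z j w).
Proof.
elim: k => [|k IH] kn.
  rewrite (_ : (fun _ => _) = cst 0); first exact: adapted_cst.
  by apply/funext => w; rewrite big_geq.
case: (leqP i k) => ik.
  rewrite (_ : (fun _ => _) = (fun w => \sum_(i <= j < k) Z j w + Z k w)).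
    by apply: adaptedD; [apply: IH; lia|exact: adapted_step].
  by apply/funext => w; rewrite big_nat_recr.
rewrite (_ : (fun _ => _) = cst 0); first exact: adapted_cst.
by apply/funext => w; rewrite big_geq.
Qed.

Lemma adapted_le n f g : adapted n f -> adapted n g -> past n [set w | f w <= g w].
Proof.
move=> af ag; rewrite (_ : [set _ | _] = (fun w => g w - f w) @^-1` `[0, +oo[%classic).
  by apply: adapted_past; [exact: adaptedB|exact: measurable_itv].
by apply/seteqP; split=> w; rewrite /= in_itv/= andbT subr_ge0.
Qed.

Lemma adapted_lt n f g : adapted n f -> adapted n g -> past n [set w | f w < g w].
Proof.
move=> af ag; rewrite (_ : [set _ | _] = (fun w => g w - f w) @^-1` `]0, +oo[%classic).
  by apply: adapted_past; [exact: adaptedB|exact: measurable_itv].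
by apply/seteqP; split=> w; rewrite /= in_itv/= andbT subr_gt0.
Qed.

Hypothesis indepZ : forall n (B : nat -> set R), (forall i, measurable (B i)) ->
  Q (\bigcap_(i in `I_n) Z i @^-1` B i) = (\prod_(i < n) Q (Z i @^-1` B i))%E.

(** Dynkin's argument: the cylinders form a pi-system on which the identity is [indepZ] at [n] and
    [n.+1], and the identity is preserved by complements and countable disjoint unions. *)
Lemma past_independent n A B : past n A -> measurable B ->
  Q (A `&` Z n @^-1` B) = (Q A * Q (Z n @^-1` B))%E.
Proof.
move=> pA mB.
have mZB : measurable (Z n @^-1` B) by rewrite -[X in measurable X]setTI; exact: mZ.
pose P (A : set T) := Q (A `&` Z n @^-1` B) = (Q A * Q (Z n @^-1` B))%E.
have mg (S : set T) : past n S -> measurable S := @past_measurable n S.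
apply: (@dynkin_induction _ (g_sigma_algebraType (cylinders n)) (cylinders n) P) => //.
- move=> _ _ [B1 mB1 ->] [B2 mB2 ->].
  exists (fun i => B1 i `&` B2 i) => [i|]; first exact: measurableI.
  by rewrite -bigcapI.
- by rewrite /P setTI; have -> : Q setT = 1%E := probability_setT Q; rewrite mul1e.
- move=> _ [B' mB' ->]; rewrite /P.
  pose B2 i := if i == n then B else B' i.
  have mB2 i : measurable (B2 i) by rewrite /B2; case: ifP.
  have -> : \bigcap_(i in `I_n) Z i @^-1` B' i `&` Z n @^-1` B =
    \bigcap_(i in `I_n.+1) Z i @^-1` B2 i.
    rewrite /B2; apply/seteqP; split=> w /=.
      move=> [h hB] i /=; rewrite ltnS leq_eqVlt => /orP[/eqP ->|i_n].
        by rewrite eqxx.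
      by case: eqVneq => [->//|_]; exact: h.
    move=> h; split=> [i /= i_n|]; last by have := h n (ltnSn n); rewrite /= eqxx.
    by have := h i (ltnW i_n); rewrite /= (ltn_eqF i_n).
  rewrite indepZ// big_ord_recr/= indepZ//; congr (_ * _)%E.
    by apply: eq_bigr => i _; rewrite /B2 (ltn_eqF (ltn_ord i)).
  by rewrite /B2 eqxx.
- move=> S /mg mS; rewrite /P => PS.
  have -> : ~` S `&` Z n @^-1` B = Z n @^-1` B `\` (S `&` Z n @^-1` B).
    apply/seteqP; split=> w /=; first by move=> [Sw Bw]; split=> // -[].
    by move=> [Bw h]; split=> // Sw; exact: h.
  have mSB := @measurableI _ T S (Z n @^-1` B) mS mZB.
  have fS : Q S \is a fin_num by exact: fin_num_measure.
  have fB : Q (Z n @^-1` B) \is a fin_num by exact: fin_num_measure.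
  have -> : Q (Z n @^-1` B `\` (S `&` Z n @^-1` B)) =
      (Q (Z n @^-1` B) - Q (S `&` Z n @^-1` B))%E.
    have ltB : (Q (Z n @^-1` B) < +oo)%E by rewrite ltey_eq fB.
    rewrite measureD//.
    by congr (_ - Q _)%E; apply/seteqP; split=> w /= => [[? []]|[]].
  have -> : Q (~` S) = (1 - Q S)%E by exact: probability_setC.
  rewrite PS -(fineK fS) -(fineK fB); set x := fine _; set y := fine _.
  transitivity (x - y * x)%:E; first by [].
  transitivity ((1 - y) * x)%:E; last by [].
  congr (_%:E); ring.
- move=> F mF tF PF; rewrite /P setI_bigcupl.
  have mF' k : @measurable _ T (F k) by exact: mg (mF k).
  rewrite !measure_bigcup//.
  + rewrite (eq_eseriesr (g := fun k => (Q (Z n @^-1` B) * Q (F k))%E)).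
      have fB : Q (Z n @^-1` B) \is a fin_num by exact: fin_num_measure.
      by rewrite -(fineK fB) nneseriesZl// muleC.
    by move=> k _; apply: etrans (PF k) _; exact: muleC.
  + by move=> k _; exact: (@measurableI _ T (F k) _ (mF' k) mZB).
  + by move=> i j _ _ [w [[/= Fi _] [Fj _]]]; apply: tF => //; exists w.
Qed.

Lemma mean_adapted_step n f : bounded_rv f -> bounded_rv (Z n) -> adapted n f ->
  mean Q (fun w => f w * Z n w) = mean Q f * mean Q (Z n).
Proof.
move=> bf bZ af; apply: mean_mul_independent => // A B mA mB.
by apply: past_independent => //; exact: adapted_past.
Qed.

Lemma mean_adapted_step2 n f : bounded_rv f -> bounded_rv (Z n) -> adapted n f ->
  mean Q (fun w => f w * (Z n w) ^+ 2) = mean Q f * mean Q (fun w => (Z n w) ^+ 2).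
Proof.
move=> bf bZ af; have bZ2 : bounded_rv (fun w => Z n w ^+ 2) by exact: bounded_rvM.
apply: (mean_mul_independent bf bZ2) => // A B mA mB.
have -> : (fun w => Z n w ^+ 2) @^-1` B = Z n @^-1` ((fun x : R => x ^+ 2) @^-1` B) by [].
apply: past_independent; first exact: adapted_past.
rewrite -[X in measurable X]setTI.
have mX : measurable_fun setT (fun x : R => x ^+ 2) by exact: exprn_measurable.
exact: mX.
Qed.

End Filtration.

(** * Betting on a walk with bounded centered steps: ruin and exit time *)

Section Ruin.
Context {R : realType} d (T : measurableType d) (Q : probability T R).
Variables (Z : nat -> T -> R) (C : R).
Hypothesis mZ : forall i, measurable_fun setT (Z i).
Hypothesis indepZ : forall n (B : nat -> set R), (forall i, measurable (B i)) ->
  Q (\bigcap_(i in `I_n) Z i @^-1` B i) = (\prod_(i < n) Q (Z i @^-1` B i))%E.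
Hypothesis ZC : forall i w, `|Z i w| <= C.
Hypothesis Z0 : forall i, mean Q (Z i) = 0.

Definition increment (i k : nat) (w : T) : R := \sum_(i <= j < k) Z j w.

Lemma increment0 i w : increment i i w = 0.
Proof. by rewrite /increment big_geq. Qed.

Lemma incrementS i k w : (i <= k)%N -> increment i k.+1 w = increment i k w + Z k w.
Proof. by move=> ik; rewrite /increment big_nat_recr. Qed.

Lemma bounded_step i : bounded_rv (Z i).
Proof. by split=> //; exists C => w. Qed.

Lemma adapted_increment n i k : (k <= n)%N -> adapted Z n (increment i k).
Proof. exact: adapted_sum. Qed.

Lemma adapted_measurable n f : adapted Z n f -> measurable_fun setT f.
Proof.
move=> af _ B mB; rewrite setTI; apply: (@past_measurable _ _ _ Z mZ n).
exact: adapted_past.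
Qed.

Lemma bound_ge0 : 0 <= C.
Proof. exact: le_trans (normr_ge0 _) (ZC 0 point). Qed.

Section OneShot.
Variables (s u v : R) (A : nat -> set T).
Hypothesis s1 : `|s| = 1.
Hypotheses (u0 : 0 < u) (v0 : 0 < v).
Hypothesis pA : forall i, past Z i (A i).

(** [A i] is the signal that opens the bet at time i. Only its first occurrence counts, which makes
    the opening a stopping time. *)
Definition first_start (i : nat) (w : T) : Prop :=
  A i w /\ forall i', (i' < i)%N -> ~ A i' w.

Definition inside (i k : nat) (w : T) : Prop :=
  forall j, (i <= j)%N -> (j <= k)%N -> - v < s * increment i j w < u.

(** The bet bears on step [Z k] but is decided by the steps before k, as [past_stake] records; this
    is what makes [gain] a martingale. *)
Definition stake (k : nat) : set T :=
  [set w | exists i, (i <= k)%N /\ (first_start i w /\ inside i k w)].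

(** For s = -1 the ruin is a rise by v before a fall by u. Time k need not be the first passage
    below -v: an earlier passage only closes the bet sooner. *)
Definition ruined (n : nat) : set T :=
  [set w | exists i, (i <= n)%N /\ (first_start i w /\ exists k, (i <= k)%N /\
     ((k <= n)%N /\ (s * increment i k w <= - v /\
     forall j, (i <= j)%N -> (j < k)%N -> s * increment i j w < u)))].

Lemma past_first_start i n : (i <= n)%N -> past Z n [set w | first_start i w].
Proof.
move=> i_n; apply: past_and.
  exact: (pastW i_n (@pA i)).
apply: past_forall => i'; apply: past_imp => i'i; apply: past_not.
by apply: (@pastW _ _ _ Z i') => //; lia.
Qed.

Lemma past_stake k : past Z k (stake k).
Proof.
apply: past_exists => i; apply: past_and_const => ik.
apply: past_and; first exact: past_first_start.
apply: past_forall => j; apply: past_imp => ij; apply: past_imp => jk.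
rewrite (_ : [set w | _] =
  [set w | - v < s * increment i j w /\ s * increment i j w < u]); last first.
  by apply/seteqP; split=> w /=; [move/andP|move=> ?; apply/andP].
by apply: past_and; apply: adapted_lt; try exact: adapted_cst;
  apply: adaptedM; try exact: adapted_cst; exact: adapted_increment.
Qed.

Lemma past_ruined n : past Z n (ruined n).
Proof.
apply: past_exists => i; apply: past_and_const => i_n.
apply: past_and; first exact: past_first_start.
apply: past_exists => k; apply: past_and_const => ik; apply: past_and_const => kn.
apply: past_and.
  apply: adapted_le; last exact: adapted_cst.
  by apply: adaptedM; [exact: adapted_cst|exact: adapted_increment].
apply: past_forall => j; apply: past_imp => ij; apply: past_imp => jk.
apply: adapted_lt; last exact: adapted_cst.
by apply: adaptedM; [exact: adapted_cst|apply: adapted_increment; lia].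
Qed.

Definition gain (n : nat) (w : T) : R := \sum_(k < n) \1_(stake k) w * (s * Z k w).

Lemma stakeE i k w : first_start i w -> (i <= k)%N -> stake k w <-> inside i k w.
Proof.
move=> [Ai fi] ik; split; last by move=> h; exists i.
move=> [i' [i'k [[Ai' fi'] h]]].
by have [/fi'//|/fi//|->] := ltngtP i i'.
Qed.

Lemma stake_before i k w : first_start i w -> (k < i)%N -> ~ stake k w.
Proof. by move=> [Ai fi] ki [i' [i'k [[Ai' _] _]]]; apply: (fi i') => //; lia. Qed.

Lemma gainS n w : gain n.+1 w = gain n w + \1_(stake n) w * (s * Z n w).
Proof. by rewrite /gain big_ord_recr. Qed.

(** Optional stopping in pathwise form: the bet has collected the increment up to n, or up to the
    first exit from (-v, u) if this comes before. *)
Lemma gain_stopped i n w : first_start i w -> (i <= n)%N ->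
  ((forall j, (i <= j)%N -> (j < n)%N -> - v < s * increment i j w < u) /\
    gain n w = s * increment i n w) \/
  exists k, [/\ (i <= k)%N, (k < n)%N, ~~ (- v < s * increment i k w < u),
    (forall j, (i <= j)%N -> (j < k)%N -> - v < s * increment i j w < u) &
    gain n w = s * increment i k w].
Proof.
move=> fi; elim: n => [|n IH].
  rewrite leqn0 => /eqP ->; left; split=> [j|]; first by lia.
  by rewrite increment0 mulr0 /gain big_ord0.
rewrite leq_eqVlt => /orP[/eqP <-|].
  left; split=> [j|]; first by lia.
  rewrite increment0 mulr0 /gain big1// => k _.
  by rewrite indicE memNset ?mul0r//; apply: (stake_before fi).
rewrite ltnS => i_n; rewrite gainS; case: (IH i_n) => [[hin ->]|[k [ik kn ko hin ->]]].
  have [ok|nok] := boolP (- v < s * increment i n w < u).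
    left; split=> [j ij|].
      by rewrite ltnS leq_eqVlt => /orP[/eqP -> //|jn]; exact: hin.
    rewrite indicE mem_set ?mul1r; first by rewrite incrementS// mulrDr.
    apply/(stakeE fi i_n) => j ij; rewrite leq_eqVlt => /orP[/eqP -> //|jn].
    exact: hin.
  right; exists n; split=> //.
  rewrite indicE memNset ?mul0r ?addr0//.
  by move/(stakeE fi i_n)/(_ n i_n (leqnn n)); exact/negP.
right; exists k; split=> //; first by lia.
rewrite indicE memNset ?mul0r ?addr0// => /(stakeE fi i_n)/(_ k ik (ltnW kn)).
exact/negP.
Qed.

Lemma step_le i w : s * Z i w <= C.
Proof. by rewrite (le_trans (ler_norm _))// normrM s1 mul1r. Qed.

(** The bet closes at the step that leaves (-v, u), so u is overshot by at most one step. *)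
Lemma gain_le n w : gain n w <= u + C.
Proof.
have C0 := bound_ge0.
have [[i [i_n fi]]|nst] := pselect (exists i, (i <= n)%N /\ first_start i w).
  have key m : (i < m)%N ->
      (forall j, (i <= j)%N -> (j < m)%N -> - v < s * increment i j w < u) ->
      s * increment i m w <= u + C.
    case: m => // m; rewrite ltnS => im hin; rewrite incrementS// mulrDr.
    by rewrite lerD// ?step_le//; have /andP[_ /ltW] := hin m im (ltnSn m).
  case: (gain_stopped fi i_n) => [[hin ->]|[k [ik kn ko hin ->]]].
    move: i_n; rewrite leq_eqVlt => /orP[/eqP <-|/key]; last exact.
      rewrite increment0 mulr0. exact: addr_ge0 (ltW u0) C0.
  move: ik; rewrite leq_eqVlt => /orP[/eqP ik|/key]; last exact.
  by move: ko; rewrite -ik increment0 mulr0 u0 oppr_lt0 v0.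
rewrite /gain big1 ?addr_ge0// ?(ltW u0)// => k _.
rewrite indicE memNset ?mul0r// => -[i [ik [fi _]]]; apply: nst; exists i; split=> //.
by have := ltn_ord k; lia.
Qed.

(** The bet is closed no later than the ruin, and not at the upper level, which has not been reached
    by then; so it was closed below -v. *)
Lemma gain_ruined n w : ruined n w -> gain n w <= - v.
Proof.
move=> [i [i_n [fi [k [ik [kn [lek hk]]]]]]].
case: (gain_stopped fi i_n) => [[hin ->]|[l [il ln lo hin ->]]].
  have [k_n|kn'] := ltnP k n; last by have -> : n = k by lia.
  by have /andP[] := hin k ik k_n; rewrite ltNge lek.
have [lk|kl|->//] := ltngtP l k.
  by move: lo; rewrite (hk l il lk) andbT -leNgt.
by have /andP[] := hin k ik kl; rewrite ltNge lek.
Qed.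

Lemma bounded_gain_term k : bounded_rv (fun w => \1_(stake k) w * (s * Z k w)).
Proof.
apply: bounded_rvM; last by apply: bounded_rvM; [exact: bounded_rv_cst|exact: bounded_step].
by apply: bounded_rv_indic; apply: past_measurable; last exact: past_stake.
Qed.

Lemma mean_gain n : mean Q (gain n) = 0.
Proof.
rewrite (mean_sum Q n bounded_gain_term).
rewrite big1// => k _.
have -> : (fun w => \1_(stake k) w * (s * Z k w)) =
    (fun w => s * (\1_(stake k) w * Z k w)) by apply/funext => w; ring.
have bi : bounded_rv (\1_(stake k) : T -> R).
  by apply: bounded_rv_indic; apply: past_measurable; last exact: past_stake.
rewrite meanZ; last by apply: bounded_rvM => //; exact: bounded_step.
rewrite (mean_adapted_step mZ)// ?Z0 ?mulr0//; first exact: bounded_step.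
by apply: adapted_indic; exact: past_stake.
Qed.

(* Betting one unit while the walk stays inside costs nothing on average; the
   bet gains at most u + C, and loses v on the ruin event. *)
Lemma ruin_probability n : (Q (ruined n) <= ((u + C) / v)%:E)%E.
Proof.
have mB : measurable (ruined n) by apply: past_measurable; last exact: past_ruined.
have bi := bounded_rv_indic mB (R := R).
rewrite -mean_indic// lee_fin ler_pdivlMr//.
have : mean Q (gain n) <= mean Q (fun w => (u + C) + - v * \1_(ruined n) w).
  apply: mean_le.
  - exact: (bounded_rv_sum n bounded_gain_term).
  - apply: bounded_rvD; first exact: bounded_rv_cst.
    by apply: bounded_rvM => //; exact: bounded_rv_cst.
  - move=> w; have C0 := bound_ge0; have [r|nr] := pselect (ruined n w).
      rewrite indicE mem_set// mulr1; have := gain_ruined r; have := u0; lra.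
    by rewrite indicE memNset// mulr0 addr0; exact: gain_le.
rewrite mean_gain meanD; last 2 first.
- exact: bounded_rv_cst.
- by apply: bounded_rvM => //; exact: bounded_rv_cst.
rewrite meanZ// mean_cst; lra.
Qed.

End OneShot.

Section ExitTime.
Variables (N : nat) (b s2 : R).
Hypothesis b0 : 0 < b.
Hypothesis s20 : 0 < s2.
Hypothesis Zvar : forall i, mean Q (fun w => Z i w ^+ 2) = s2.

Definition confined (k : nat) : set T :=
  [set w | forall j, (N <= j)%N -> (j <= N + k)%N -> `|increment N j w| < b].

Lemma past_confined k : past Z (N + k) (confined k).
Proof.
apply: past_forall => j; apply: past_imp => Nj; apply: past_imp => jk.
rewrite (_ : [set w | _] =
  [set w | - b < increment N j w /\ increment N j w < b]); last first.
  apply/seteqP; split=> w /=; first by rewrite ltr_norml => /andP.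
  by move=> h; rewrite ltr_norml; apply/andP.
by apply: past_and; apply: adapted_lt; try exact: adapted_cst;
  exact: adapted_increment.
Qed.

(** The increments of the squared walk while it is confined, from (x + z)^2 - x^2 = 2 x z + z^2. The
    cross term has mean zero. *)
Definition square_gain (m : nat) (w : T) : R :=
  \sum_(k < m) (2 * (\1_(confined k) w * increment N (N + k) w) * Z (N + k) w +
                \1_(confined k) w * (Z (N + k) w) ^+ 2).

Lemma square_gain_stopped m w :
  ((forall j, (j < m)%N -> `|increment N (N + j) w| < b) /\
    square_gain m w = increment N (N + m) w ^+ 2) \/
  exists k, [/\ (k < m)%N, ~~ (`|increment N (N + k) w| < b),
    (forall j, (j < k)%N -> `|increment N (N + j) w| < b) &
    square_gain m w = increment N (N + k) w ^+ 2].
Proof.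
have cE k : confined k w <-> forall j, (j < k.+1)%N -> `|increment N (N + j) w| < b.
  split=> h j; first by move=> jk; apply: h; lia.
  by move=> Nj jk; rewrite -(subnKC Nj); apply: h; lia.
elim: m => [|m IH].
  by left; split=> //; rewrite addn0 increment0 expr0n /square_gain big_ord0.
rewrite /square_gain big_ord_recr/= -/(square_gain m w).
case: IH => [[hin ->]|[k [kn ko hin ->]]].
  have [ok|nok] := boolP (`|increment N (N + m) w| < b).
    have hin' j : (j < m.+1)%N -> `|increment N (N + j) w| < b.
      by rewrite ltnS leq_eqVlt => /orP[/eqP -> //|jn]; exact: hin.
    left; split=> //; rewrite indicE mem_set; last exact/cE.
    by rewrite addnS incrementS ?leq_addr//=; ring.
  right; exists m; split=> //.
  rewrite indicE memNset; first by rewrite /=; ring.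
  by move/cE/(_ m (ltnSn m)); exact/negP.
right; exists k; split=> //; first by lia.
rewrite indicE memNset; first by rewrite /=; ring.
by move/cE/(_ k (ltnW kn)); exact/negP.
Qed.

Lemma square_gain_le m w : square_gain m w <= (b + C) ^+ 2.
Proof.
have C0 := bound_ge0.
have key k : (forall j, (j < k)%N -> `|increment N (N + j) w| < b) ->
    increment N (N + k) w ^+ 2 <= (b + C) ^+ 2.
  move=> h; rewrite -real_normK ?num_real//.
  have bC : 0 <= b + C by rewrite addr_ge0// ltW.
  suff le : `|increment N (N + k) w| <= b + C by rewrite lerXn2r ?nnegrE.
  case: k h => [|k] h; first by rewrite addn0 increment0 normr0.
  rewrite addnS incrementS ?leq_addr// (le_trans (ler_normD _ _))//.
  by rewrite lerD// ltW// h.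
by case: (square_gain_stopped m w) => [[hin ->]|[k [kn ko hin ->]]]; exact: key.
Qed.

(** Wald's second identity: the stopped square is at most (b + C)^2, and its mean is s2 times the
    sum of Q ([confined k]) over k <= m. As [confined k] decreases with k, each of these [m.+1]
    terms is at least Q ([confined m]). *)
Lemma confined_probability m :
  (Q (confined m) <= ((b + C) ^+ 2 / (s2 * m.+1%:R))%:E)%E.
Proof.
have mc k : measurable (confined k).
  by apply: past_measurable; last exact: past_confined.
have bi k := bounded_rv_indic (mc k) (R := R).
have bf k : bounded_rv (fun w => \1_(confined k) w * increment N (N + k) w).
  split.
    apply: measurable_funM; first exact: measurable_indic.
    exact: (@adapted_measurable (N + k)%N) (adapted_increment _ _).
  exists b => w; have [h|h] := pselect (confined k w).
    by rewrite indicE mem_set// mul1r ltW// h// leq_addr.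
  by rewrite indicE memNset// mul0r normr0 ltW.
have bZ2 k : bounded_rv (fun w => Z k w ^+ 2).
  by apply: bounded_rvM; exact: bounded_step.
have b1 k : bounded_rv (fun w =>
    2 * (\1_(confined k) w * increment N (N + k) w) * Z (N + k) w).
  apply: bounded_rvM; last exact: bounded_step.
  by apply: bounded_rvM => //; exact: bounded_rv_cst.
have b2 k : bounded_rv (fun w => \1_(confined k) w * (Z (N + k) w) ^+ 2).
  exact: bounded_rvM.
rewrite -mean_indic// lee_fin ler_pdivlMr ?mulr_gt0//.
have aff k : adapted Z (N + k) (fun w => \1_(confined k) w * increment N (N + k) w).
  by apply: adaptedM; [apply: adapted_indic; exact: past_confined|exact: adapted_increment].
have : mean Q (square_gain m.+1) <= mean Q (cst ((b + C) ^+ 2)).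
  apply: mean_le; [|exact: bounded_rv_cst|exact: square_gain_le].
  exact: (bounded_rv_sum m.+1 (fun k => bounded_rvD (b1 k) (b2 k))).
rewrite mean_cst; apply: le_trans.
rewrite (mean_sum Q m.+1 (fun k => bounded_rvD (b1 k) (b2 k))).
have -> : mean Q \1_(confined m) * (s2 * m.+1%:R) =
    \sum_(k < m.+1) mean Q \1_(confined m) * s2.
  by rewrite sumr_const card_ord -[RHS]mulr_natr mulrA.
apply: ler_sum => k _.
rewrite meanD// (_ : (fun w => 2 * _ * _) = (fun w => 2 *
   ((\1_(confined k) w * increment N (N + k) w) * Z (N + k) w))); last first.
  by apply/funext => w; ring.
rewrite meanZ; last by apply: bounded_rvM => //; exact: bounded_step.
rewrite (mean_adapted_step mZ)//; last exact: bounded_step.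
rewrite Z0 !mulr0 add0r.
rewrite (mean_adapted_step2 mZ indepZ (bi _) (bounded_step _) (adapted_indic (@past_confined _))).
rewrite Zvar ler_wpM2r ?(ltW s20)//; apply: mean_le => // w.
rewrite !indicE; have [h|h] := pselect (confined m w); last by rewrite (memNset h) ler0n.
rewrite !mem_set// => j Nj jk; apply: h => //.
by have := ltn_ord k; lia.
Qed.

End ExitTime.
End Ruin.

(** * Finite trajectories of a Markov chain *)

Section PathMean.
Context {R : realType}.
Variable a : int -> R.

Definition step_mean (f : int -> R) (x : int) : R :=
  a x * f (x + 1) + (1 - a x) * f (x - 1).

(** The mean of F over the list of the first [n.+1] positions of the chain from x, by recursion on
    the first step. The estimates in a fixed environment are inductions on this finite sum;
    [trajectory_law] transfers them to the probability space of the walk. *)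
Fixpoint path_mean (n : nat) (x : int) (F : seq int -> R) : R :=
  if n is n'.+1 then
    step_mean (fun y => path_mean n' y (fun s => F (x :: s))) x
  else F [:: x].

Lemma eq_path_mean n x F G : (forall s, size s = n -> F (x :: s) = G (x :: s)) ->
  path_mean n x F = path_mean n x G.
Proof.
elim: n x F G => [|n IH] x F G FG /=; first exact: FG.
by congr (_ * _ + _ * _); apply: IH => s sn; apply: FG; rewrite /= sn.
Qed.

Lemma path_meanD n x F G :
  path_mean n x (fun s => F s + G s) = path_mean n x F + path_mean n x G.
Proof. by elim: n x F G => [|n IH] x F G //=; rewrite /step_mean !IH; ring. Qed.

Lemma path_meanZ n x c F : path_mean n x (fun s => c * F s) = c * path_mean n x F.
Proof. by elim: n x F => [|n IH] x F //=; rewrite /step_mean !IH; ring. Qed.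

Lemma path_mean_cst n x c : path_mean n x (fun=> c) = c.
Proof. by elim: n x => [|n IH] x //=; rewrite /step_mean !IH; ring. Qed.

Hypothesis a01 : forall i, 0 < a i < 1.

Lemma step_mean_le f g x : f (x + 1) <= g (x + 1) -> f (x - 1) <= g (x - 1) ->
  step_mean f x <= step_mean g x.
Proof.
move=> h1 h2; have /andP[/ltW a0 /ltW a1] := a01 x.
by rewrite lerD// ler_wpM2l// subr_ge0.
Qed.

Lemma path_mean_le n x F G : (forall s, size s = n -> F (x :: s) <= G (x :: s)) ->
  path_mean n x F <= path_mean n x G.
Proof.
elim: n x F G => [|n IH] x F G FG /=; first exact: FG.
by apply: step_mean_le; apply: IH => s sn; apply: FG; rewrite /= sn.
Qed.

End PathMean.

(** * From the law of the walk to means over finite trajectories *)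

Section Law.
Context {R : realType} d (T : measurableType d).
Variables (X : nat -> T -> int) (a : int -> R) (x : int) (P : probability T R).
Hypothesis XP : walk_law X a x P.

Definition trajectory (n : nat) (w : T) : seq int := mkseq (X^~ w) n.

Lemma measurable_trajectory n (q : pred (seq int)) :
  measurable [set w | q (trajectory n w)].
Proof.
have [mX _ _] := XP.
have cyl s : measurable [set w | trajectory n w = s].
  have [sn|sn] := eqVneq (size s) n; last first.
    rewrite (_ : [set _ | _] = set0)//; apply/seteqP; split=> w //= e.
    by move: sn; rewrite -e size_mkseq eqxx.
  rewrite (_ : [set _ | _] = \bigcap_(i in `I_n) (X i @^-1` [set nth 0 s i])).
    by apply: bigcap_measurableType => i _; exact: mX.
  apply/seteqP; split=> w /=; first by move=> <- i /= i_n; rewrite nth_mkseq.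
  move=> h; apply: (@eq_from_nth _ 0); first by rewrite size_mkseq.
  by move=> i; rewrite size_mkseq => i_n; rewrite nth_mkseq//; exact: h.
rewrite (_ : [set _ | _] = \bigcup_(s in [set s | q s]) [set w | trajectory n w = s]).
  rewrite bigcup_mkcond; apply: countable_bigcupT_measurable => [|s].
    exact: countableP.
  by case: ifP.
apply/seteqP; split=> w /=; first by move=> qw; exists (trajectory n w).
by move=> [s qs /= ->].
Qed.

Definition cylinder (s : seq int) : set T := [set w | trajectory (size s) w = s].

Lemma measurable_cylinder s : measurable (cylinder s).
Proof.
rewrite (_ : cylinder s = [set w | (fun t => t == s) (trajectory (size s) w)]).
  exact: (@measurable_trajectory (size s) (fun t => t == s)).
by apply/seteqP; split=> w /eqP.
Qed.

Lemma cylinder_rcons s y w :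
  cylinder (rcons s y) w <-> cylinder s w /\ X (size s) w = y.
Proof.
rewrite /cylinder /trajectory /= size_rcons mkseqS; split.
  by move/eqP; rewrite eqseq_rcons => /andP[/eqP-> /eqP ->].
by move=> [-> ->].
Qed.

Lemma cylinder_step s y z : P (cylinder (rcons (rcons s y) z)) =
  (P (cylinder (rcons s y)) * (transition a y z)%:E)%E.
Proof.
have [_ _ /(_ (size s) (nth 0 (rcons (rcons s y) z)))] := XP.
have e k (t : seq int) : size t = k.+1 ->
    [set w | forall i, (i <= k)%N -> X i w = nth 0 t i] = cylinder t.
  move=> tk; apply/seteqP; split=> w /=.
    move=> h; apply: (@eq_from_nth _ 0); rewrite size_mkseq// => i it.
    by rewrite nth_mkseq//; apply: h; rewrite -ltnS -tk.
  by rewrite /cylinder /= => <- i ik; rewrite nth_mkseq// tk ltnS.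
rewrite e ?size_rcons// => ->; congr (P _ * (transition _ _ _)%:E)%E.
- rewrite -(e (size s)) ?size_rcons//; apply/seteqP.
  have en i : (i <= size s)%N -> nth 0 (rcons (rcons s y) z) i = nth 0 (rcons s y) i.
    by move=> ik; rewrite [LHS]nth_rcons size_rcons ltnS ik.
  by split=> w /= h i ik; rewrite h// en.
- by rewrite nth_rcons size_rcons ltnSn nth_rcons ltnn eqxx.
- by rewrite nth_rcons size_rcons ltnn eqxx.
Qed.

Lemma path_law n s y (q : pred (seq int)) :
  P (cylinder (rcons s y) `&` [set w | q (trajectory ((size s).+1 + n) w)]) =
  (P (cylinder (rcons s y)) * (path_mean a n y (fun t => (q (s ++ t))%:R))%:E)%E.
Proof.
elim: n s y => [|n IH] s y.
  rewrite addn0 /= cats1; set B := [set _ | _].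
  have h w : cylinder (rcons s y) w -> trajectory (size s).+1 w = rcons s y.
    by rewrite /cylinder /= size_rcons.
  case: (boolP (q (rcons s y))) => qs.
    rewrite mule1; congr (P _); apply/seteqP; split=> w /=; first by case.
    by move=> cw; split=> //; rewrite /B /= (h w).
  rewrite mule0 (_ : _ `&` _ = set0) ?measure0//; apply/seteqP; split=> w //= -[cw].
  by rewrite /B /= h// (negbTE qs).
set E := cylinder (rcons s y); set B := [set _ | _].
have mB : measurable B by exact: measurable_trajectory.
have mE : measurable E by exact: measurable_cylinder.
have IH' z : P (cylinder (rcons (rcons s y) z) `&` B) =
   (P E * (transition a y z)%:E *
    (path_mean a n z (fun t => (q (s ++ y :: t))%:R))%:E)%E.
  have := IH (rcons s y) z; rewrite cylinder_step size_rcons addSnnS => ->.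
  by congr (_ * (path_mean _ _ _ _)%:E)%E; apply/funext => t; rewrite cat_rcons.
pose E1 := cylinder (rcons (rcons s y) (y + 1)).
pose E2 := cylinder (rcons (rcons s y) (y - 1)).
have mE1 : measurable E1 by exact: measurable_cylinder.
have mE2 : measurable E2 by exact: measurable_cylinder.
have sE1 : E1 `<=` E by move=> w /cylinder_rcons[].
have sE2 : E2 `<=` E by move=> w /cylinder_rcons[].
have E12 : E1 `&` E2 = set0.
  apply/seteqP; split=> w //= -[/cylinder_rcons[_ e1] /cylinder_rcons[_ e2]].
  by move: e1; rewrite e2; lia.
have PE1 : P E1 = (P E * (a y)%:E)%E by rewrite cylinder_step /transition eqxx.
have PE2 : P E2 = (P E * (1 - a y)%:E)%E.
  rewrite cylinder_step /transition eqxx; case: eqP => //; lia.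
have fE : P E \is a fin_num by exact: fin_num_measure.
(* The walk may make other jumps on a null set, so the cylinder splits into its two
   nearest-neighbour extensions only up to this event. *)
have P0 : P (E `\` (E1 `|` E2)) = 0%E.
  have mE3 : measurable (E1 `|` E2) by exact: measurableU.
  have ltE : (P E < +oo)%E by rewrite ltey_eq fE.
  have -> : P (E `\` (E1 `|` E2)) = (P E - P (E `&` (E1 `|` E2)))%E by exact: measureD.
  have -> : E `&` (E1 `|` E2) = E1 `|` E2.
    by apply/seteqP; split=> w /= => [[]//|[/[dup] /sE1|/[dup] /sE2]]; auto.
  have -> : P (E1 `|` E2) = (P E1 + P E2)%E by exact: measureU.
  rewrite PE1 PE2 -(fineK fE); set p := fine _.
  by transitivity (p - (p * a y + p * (1 - a y)))%:E => //; congr EFin; ring.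
have -> : P (E `&` B) = (P (E1 `&` B) + P (E2 `&` B))%E.
  have <- : P ((E1 `|` E2) `&` B) = (P (E1 `&` B) + P (E2 `&` B))%E.
    rewrite setIUl; apply: measureU; [exact: measurableI|exact: measurableI|].
    by rewrite setIACA E12 set0I.
  apply/eqP; rewrite eq_le; apply/andP; split; last first.
    apply: le_measure; rewrite ?inE; [|exact: measurableI|].
      by apply: measurableI => //; exact: measurableU.
    by apply: setSI => w [/sE1|/sE2].
  rewrite -[leRHS]adde0 -P0.
  have mE3 : measurable (E `\` (E1 `|` E2)) by apply: measurableD => //; exact: measurableU.
  have mE4 : measurable ((E1 `|` E2) `&` B) by apply: measurableI => //; exact: measurableU.
  have h : (P ((E1 `|` E2) `&` B `|` E `\` (E1 `|` E2)) <=
      P ((E1 `|` E2) `&` B) + P (E `\` (E1 `|` E2)))%E by exact: measureU2.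
  apply: le_trans h.
  apply: le_measure; rewrite ?inE; [exact: measurableI|exact: measurableU|].
  by move=> w [Ew Bw]; case: (pselect ((E1 `|` E2) w)) => h; [left|right].
rewrite !IH' /transition eqxx ifF; last by apply/eqP; lia.
rewrite eqxx -(fineK fE) /= /step_mean; set p := fine _; set u := path_mean _ _ _ _.
set v := path_mean _ _ _ _.
by transitivity (p * a y * u + p * (1 - a y) * v)%:E => //; congr EFin; ring.
Qed.

Lemma trajectory_law n (q : pred (seq int)) :
  P [set w | q (trajectory n.+1 w)] = (path_mean a n x (fun t => (q t)%:R))%:E.
Proof.
have [_ P1 _] := XP.
have := path_law n [::] x q; rewrite /= add1n.
have -> : cylinder [:: x] = X 0%N @^-1` [set x].
  by apply/seteqP; split=> w; rewrite /cylinder /trajectory /mkseq/=; [case|move=> ->].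
rewrite P1 mul1e => <-.
have mX : measurable (X 0%N @^-1` [set x]) by have [h _ _] := XP; exact: h.
have mB : measurable [set w | q (trajectory n.+1 w)] by exact: measurable_trajectory.
have P0 : P (~` (X 0%N @^-1` [set x])) = 0%E.
  by rewrite probability_setC// P1 subee.
apply/eqP; rewrite eq_le; apply/andP; split; last first.
  by apply: le_measure; rewrite ?inE//; exact: measurableI.
rewrite -[leRHS]adde0 -P0.
have h : (P (X 0%N @^-1` [set x] `&` [set w | q (trajectory n.+1 w)] `|`
    ~` (X 0%N @^-1` [set x])) <= P (X 0%N @^-1` [set x] `&` [set w | q (trajectory n.+1 w)]) +
    P (~` (X 0%N @^-1` [set x])))%E.
  by apply: measureU2; [exact: measurableI|exact: measurableC].
apply: le_trans h.
apply: le_measure; rewrite ?inE//.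
  by apply: measurableU; [exact: measurableI|exact: measurableC].
by move=> w Bw; case: (pselect ((X 0%N @^-1` [set x]) w)) => h; [left|right].
Qed.

End Law.

(** * Visits to a point and exit from a set through a Poisson equation *)

Section Poisson.
Context {R : realType}.
Variables (a : int -> R) (W : pred int) (m : int) (t u : int -> R) (b kappa : R).
Hypothesis a01 : forall i, 0 < a i < 1.
Hypothesis Wm : W m.
Hypotheses (t_m : t m = 0) (t_ge0 : forall x, 0 <= t x) (t_le : forall x, t x <= b).
Hypothesis t_in : forall x, W x -> x != m -> step_mean a t x = t x - 1.
Hypothesis t_out : forall x, ~~ W x -> step_mean a t x = t x.
Hypotheses (u_m : u m = 0) (u_ge0 : forall x, 0 <= u x).
Hypothesis u_out : forall x, ~~ W x -> 1 <= u x.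
Hypothesis u_harm : forall x, x != m -> step_mean a u x = u x.
Hypothesis u_kappa : step_mean a u m <= kappa.

Lemma kappa_ge0 : 0 <= kappa.
Proof.
apply: le_trans u_kappa; have /andP[a0 a1] := a01 m.
by rewrite addr_ge0// mulr_ge0 ?u_ge0 ?ltW// subr_gt0.
Qed.

(** The mean of u along the walk grows only at visits to m, by at most kappa each time, while u is
    at least 1 off W: a supermartingale bound with a drift of kappa per step. *)
Lemma exit_mean n x :
  path_mean a n x (fun s => (has (predC W) s)%:R) <= u x + n%:R * kappa.
Proof.
have k0 := kappa_ge0; elim: n x => [|n IH] x.
  rewrite /= orbF mul0r addr0; case: (boolP (W x)) => [_|/u_out//].
  exact: u_ge0.
rewrite /=; case: (boolP (W x)) => Wx /=; last first.
  rewrite (_ : step_mean _ _ _ = 1); last first.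
    by rewrite /step_mean !path_mean_cst; ring.
  by rewrite ler_wpDr ?mulr_ge0// u_out.
have : step_mean a (fun y => path_mean a n y (fun s => (has (predC W) s)%:R)) x <=
    step_mean a (fun y => u y + n%:R * kappa) x by apply: step_mean_le.
move=> /le_trans; apply.
have -> : step_mean a (fun y => u y + n%:R * kappa) x = step_mean a u x + n%:R * kappa.
  by rewrite /step_mean; ring.
rewrite -addn1 natrD mulrDl mul1r [_ * kappa + kappa]addrC addrA lerD2r.
have [->|xm] := eqVneq x m; last by rewrite u_harm// lerDl.
by rewrite u_m add0r.
Qed.

(* [1 + step_mean a t m] is the mean return time to m, so this is the
   stationary weight of m. *)
Definition weight : R := (1 + step_mean a t m)^-1.

Lemma step_t_ge0 : 0 <= step_mean a t m.
Proof.
have /andP[a0 a1] := a01 m.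
by rewrite addr_ge0// mulr_ge0 ?t_ge0 ?ltW// subr_gt0.
Qed.

Lemma weight_gt0 : 0 < weight.
Proof. by rewrite invr_gt0 ltr_pwDl// step_t_ge0. Qed.

Lemma weight_le1 : weight <= 1.
Proof. by rewrite invf_le1 ?lerDl ?ltr_pwDl// step_t_ge0. Qed.

Lemma b_ge0 : 0 <= b.
Proof. exact: le_trans (t_ge0 m) (t_le m). Qed.

Definition corrector (x : int) : R := - weight * t x - (x == m)%:R.

Definition centered_visits (s : seq int) : R :=
  \sum_(z <- s) ((z == m)%:R - weight).

(* y + corrector is a martingale; its squared increments telescope against
   (weight * t)^2, up to an error of at most 2 weight^2 b at each step. *)
Lemma corrector_mean n x y : W x ->
  path_mean a n x (fun s => if all W s then
     (y + centered_visits (behead s) + corrector (last x s)) ^+ 2 else 0) <=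
  (y + corrector x) ^+ 2 + (weight * b) ^+ 2 - (weight * t x) ^+ 2
    + n%:R * (2 * weight ^+ 2 * b).
Proof.
have th0 := weight_gt0; have th1 := weight_le1; have bb := b_ge0.
have gb z : (weight * t z) ^+ 2 <= (weight * b) ^+ 2.
  by rewrite lerXn2r ?nnegrE ?mulr_ge0 ?(ltW th0)// ler_wpM2l ?(ltW th0).
have e0 : 0 <= 2 * weight ^+ 2 * b by rewrite !mulr_ge0 ?(ltW th0).
elim: n x y => [|n IH] x y Wx.
  rewrite /= Wx /= /centered_visits big_nil mul0r !addr0 -addrA lerDl subr_ge0.
  exact: gb.
rewrite /= Wx /=.
pose g z := - weight * t z.
pose B z := (y - weight + g z) ^+ 2 + (weight * b) ^+ 2 - (weight * t z) ^+ 2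
    + n%:R * (2 * weight ^+ 2 * b).
have step1 z : path_mean a n z (fun s => if all W s then
    (y + centered_visits s + corrector (last x s)) ^+ 2 else 0) <= B z.
  case: (boolP (W z)) => Wz; last first.
    apply: (@le_trans _ _ 0).
      rewrite -[leRHS](path_mean_cst a n z); apply: path_mean_le => // s _.
      by rewrite /= (negbTE Wz).
    by rewrite /B addr_ge0 ?mulr_ge0 ?(ltW th0)// -addrA addr_ge0 ?sqr_ge0// subr_ge0 gb.
  have := IH z (y + ((z == m)%:R - weight)) Wz.
  (* The indicator in [corrector] cancels the visit just counted, so that only a multiple of t is
     left. *)
  rewrite (_ : (_ + _ + corrector z) = y - weight + g z); last first.
    by rewrite /corrector /g; ring.
  apply: le_trans; rewrite le_eqVlt; apply/orP; left; apply/eqP.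
  apply: eq_path_mean => s _; rewrite /= Wz; case: ifP => // _.
  by rewrite /centered_visits big_cons !addrA.
apply: (@le_trans _ _ (step_mean a B x)); first exact: step_mean_le.
(* The square of [g z] cancels the square of [weight * t z], so that B enters only through the mean
   of g, which the Poisson equation gives. *)
have -> : step_mean a B x = (y - weight) ^+ 2
    + 2 * (y - weight) * step_mean a g x + (weight * b) ^+ 2
    + n%:R * (2 * weight ^+ 2 * b).
  by rewrite /step_mean /B /g; ring.
have -> : step_mean a g x = - weight * step_mean a t x by rewrite /step_mean /g; ring.
rewrite -(natr1 n); have [->|xm] := eqVneq x m.
  have -> : - weight * step_mean a t m = weight - 1.
    have h : weight * (1 + step_mean a t m) = 1.
      by rewrite mulVf// gt_eqF// ltr_pwDl// step_t_ge0.
    by rewrite -[in RHS]h; ring.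
  rewrite /corrector eqxx t_m /=; move: e0 (sqr_ge0 (weight - 1)).
  by move: weight (n%:R : R) => w k; lra.
rewrite (t_in Wx xm) /corrector (negbTE xm) /=.
have tx : weight ^+ 2 * t x <= weight ^+ 2 * b.
  by rewrite ler_wpM2l ?sqr_ge0.
move: e0 tx (sqr_ge0 weight); move: weight (t x) (n%:R : R) => w v k; lra.
Qed.

Lemma corrector_bound x : corrector x ^+ 2 <= (b + 1) ^+ 2.
Proof.
have th0 := weight_gt0; have th1 := weight_le1; have bb := b_ge0.
rewrite /corrector mulNr -opprD sqrrN; set h := (X in X ^+ 2 <= _).
have h0 : 0 <= h by rewrite addr_ge0// mulr_ge0 ?(ltW th0).
have b1 : 0 <= b + 1 by rewrite addr_ge0.
suff hb : h <= b + 1 by rewrite lerXn2r ?nnegrE.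
rewrite lerD//; last by case: eqP.
by rewrite -[leRHS]mul1r ler_pM ?(ltW th0).
Qed.

Lemma centered_visits_mean n x : W x ->
  path_mean a n x (fun s => if all W s then
     centered_visits (behead s) ^+ 2 else 0) <= 6 * (b + 1) ^+ 2 + n%:R * (4 * b).
Proof.
move=> Wx; have th0 := weight_gt0; have th1 := weight_le1; have bb := b_ge0.
(* With c the corrector, v^2 <= 2 (v + c)^2 + 2 c^2. The constants of the conclusion are 6 = 2 (1 +
   1) + 2 and 4 = 2 * 2. *)
apply: (@le_trans _ _ (2 * path_mean a n x (fun s => if all W s then
     (0 + centered_visits (behead s) + corrector (last x s)) ^+ 2 else 0)
    + 2 * (b + 1) ^+ 2)).
  rewrite -path_meanZ -[2 * (b + 1) ^+ 2](path_mean_cst a n x) -path_meanD.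
  apply: path_mean_le => // s _; case: ifP => _; last first.
    by rewrite mulr0 add0r mulr_ge0// sqr_ge0.
  have := corrector_bound (last x (x :: s)); rewrite add0r.
  set c := corrector _; set v := centered_visits _ => cb.
  have := sqr_ge0 (v + 2 * c); nra.
have := @corrector_mean n x 0 Wx; rewrite add0r => cm.
have cb := corrector_bound x.
have wb : (weight * b) ^+ 2 <= (b + 1) ^+ 2.
  rewrite lerXn2r ?nnegrE ?mulr_ge0 ?addr_ge0 ?(ltW th0)//.
  rewrite (@le_trans _ _ b)// ?lerDl//.
  by rewrite -[leRHS]mul1r ler_wpM2r.
have w2 : weight ^+ 2 <= 1 by rewrite expr_le1 ?(ltW th0).
have nb : n%:R * (2 * weight ^+ 2 * b) <= n%:R * (2 * b).
  rewrite ler_wpM2l// ler_wpM2r// ler_piMr//.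
have := sqr_ge0 (weight * t x); nra.
Qed.

(* cnt k x is the mean number of times 1 <= i <= k at which the walk from x
   is in W, up to its first visit to m. *)
Fixpoint cnt (k : nat) (x : int) : R :=
  if k is k'.+1 then
    step_mean a (fun y => (W y)%:R + (y != m)%:R * cnt k' y) x
  else 0.

Lemma cnt_le k x : cnt k x <= 1 + step_mean a t x.
Proof.
have st x' : 0 <= step_mean a t x'.
  have /andP[a0 a1] := a01 x'.
  by rewrite addr_ge0// mulr_ge0 ?t_ge0 ?ltW// subr_gt0.
elim: k x => [|k IH] x; first by rewrite addr_ge0.
rewrite [cnt _ _]/=.
have -> : 1 + step_mean a t x = step_mean a (fun y => 1 + t y) x.
  by rewrite /step_mean; ring.
have key y : (W y)%:R + (y != m)%:R * cnt k y <= 1 + t y.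
  have [->|ym] := eqVneq y m; first by rewrite mul0r addr0 t_m addr0 Wm.
  rewrite mul1r; case: (boolP (W y)) => Wy; last first.
    by rewrite add0r -t_out.
  by rewrite lerD2l (le_trans (IH y))// t_in//; lra.
exact: step_mean_le.
Qed.

Lemma cnt_ge0 k x : 0 <= cnt k x.
Proof.
elim: k x => [//|k IH] x; have /andP[a0 a1] := a01 x.
have key y : 0 <= (W y)%:R + (y != m)%:R * cnt k y by rewrite addr_ge0// mulr_ge0.
by rewrite /= /step_mean addr_ge0// mulr_ge0 ?key ?(ltW a0)// subr_ge0 ltW.
Qed.

(** The fraction of the limiting count that is surely collected in k steps: as t <= b, each further
    step recovers at least the proportion 1 / (b + 1) of what is missing. *)
Definition lam (k : nat) : R := 1 - (1 - (b + 1)^-1) ^+ k.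

Lemma lamS k : lam k.+1 = lam k + (1 - lam k) / (b + 1).
Proof. by rewrite /lam exprS; ring. Qed.

Lemma binv : 0 <= (b + 1)^-1 <= 1.
Proof.
have bb := b_ge0; have b1 : 1 <= b + 1 by rewrite lerDr.
by rewrite invr_ge0 (le_trans ler01 b1)/= invf_le1// (lt_le_trans ltr01).
Qed.

Lemma lam_bounds k : 0 <= lam k <= 1.
Proof.
have /andP[b0 b1] := binv.
rewrite /lam subr_ge0 exprn_ile1 ?subr_ge0 ?lerBlDr ?lerDl//=.
by rewrite exprn_ge0// subr_ge0.
Qed.

(** A walk that leaves W may never return, so its later visits cannot be counted on. Subtracting b u
    from t makes the bound nonpositive off W, where t <= b and u >= 1, and harmonicity of u keeps
    the recursion intact inside. *)
Lemma cnt_ge k x : W x -> x != m -> lam k * (t x - b * u x) - u x <= cnt k x.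
Proof.
have bb := b_ge0.
elim: k x => [|k IH] x Wx xm; first by rewrite /lam subrr mul0r sub0r oppr_le0.
have /andP[l0 l1] := lam_bounds k; have /andP[i0 i1] := binv.
apply: (@le_trans _ _ (step_mean a (fun y => 1 + lam k * (t y - b * u y) - u y) x)).
  have -> : step_mean a (fun y => 1 + lam k * (t y - b * u y) - u y) x =
    1 + lam k * (step_mean a t x - b * step_mean a u x) - step_mean a u x.
    by rewrite /step_mean; ring.
  rewrite t_in// u_harm// lamS.
  set w := t x - b * u x; rewrite (_ : t x - 1 - b * u x = w - 1); last by rewrite /w; ring.
  have wb : w * (b + 1)^-1 <= 1.
    rewrite ler_pdivrMr ?mul1r ?ltr_wpDl// /w.
    by have := t_le x; have := mulr_ge0 bb (u_ge0 x); lra.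
  have : (1 - lam k) * (w * (b + 1)^-1) <= (1 - lam k) * 1.
    by rewrite ler_wpM2l// subr_ge0.
  lra.
have key y : 1 + lam k * (t y - b * u y) - u y <= (W y)%:R + (y != m)%:R * cnt k y.
  have [->|ym] := eqVneq y m; first by rewrite Wm t_m u_m !mulr0 !mul0r subrr mulr0 !addr0 subr0.
  rewrite mul1r; case: (boolP (W y)) => Wy.
    by have := IH y Wy ym; rewrite /=; lra.
  rewrite add0r (le_trans _ (cnt_ge0 k y))//.
  have uy := u_out Wy; have : t y - b * u y <= 0.
    have hb : b * 1 <= b * u y by rewrite ler_wpM2l.
    by move: hb (t_le y); move: (t y) (u y) => p q; lra.
  move=> h; have : lam k * (t y - b * u y) <= 0 by rewrite mulr_ge0_le0.
  by move: uy; move: (lam k * _) => p; lra.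
exact: step_mean_le.
Qed.

Lemma cnt_m_ge k :
  weight^-1 - (b + 1) * kappa - b * (1 - (b + 1)^-1) ^+ k <= cnt k.+1 m.
Proof.
have bb := b_ge0; have k0 := kappa_ge0.
have /andP[l0 l1] := lam_bounds k; have /andP[i0 i1] := binv.
apply: (@le_trans _ _ (step_mean a (fun y => 1 + lam k * (t y - b * u y) - u y) m)).
  have -> : step_mean a (fun y => 1 + lam k * (t y - b * u y) - u y) m =
    1 + lam k * (step_mean a t m - b * step_mean a u m) - step_mean a u m.
    by rewrite /step_mean; ring.
  rewrite invrK; have : step_mean a t m <= b.
    have /andP[/ltW a0 /ltW a1] := a01 m; rewrite /step_mean.
    have := t_le (m + 1); have := t_le (m - 1).
    move: (t (m + 1)) (t (m - 1)) => p q hq hp; nra.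
  have := step_t_ge0; have su : 0 <= step_mean a u m.
    have /andP[a0 a1] := a01 m.
    by rewrite addr_ge0// mulr_ge0 ?u_ge0 ?ltW// subr_gt0.
  move: u_kappa su; set p := step_mean a t m; set q := step_mean a u m => qk q0 p0 pb.
  have -> : (1 - (b + 1)^-1) ^+ k = 1 - lam k by rewrite /lam; ring.
  have : (1 - lam k) * p <= (1 - lam k) * b by rewrite ler_wpM2l// subr_ge0.
  have : lam k * (b * q) <= 1 * (b * kappa).
    by rewrite ler_pM// ?mulr_ge0// ler_wpM2l.
  lra.
have key y : 1 + lam k * (t y - b * u y) - u y <= (W y)%:R + (y != m)%:R * cnt k y.
  have [->|ym] := eqVneq y m; first by rewrite Wm t_m u_m !mulr0 !mul0r subrr mulr0 !addr0 subr0.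
  rewrite mul1r; case: (boolP (W y)) => Wy.
    by have := cnt_ge k Wy ym; rewrite /=; lra.
  rewrite add0r (le_trans _ (cnt_ge0 k y))//.
  have uy := u_out Wy; have : t y - b * u y <= 0.
    have hb : b * 1 <= b * u y by rewrite ler_wpM2l.
    by move: hb (t_le y); move: (t y) (u y) => p q; lra.
  move=> h; have : lam k * (t y - b * u y) <= 0 by rewrite mulr_ge0_le0.
  by move: uy; move: (lam k * _) => p; lra.
exact: step_mean_le.
Qed.

End Poisson.

(** * A valley as an electrical network *)

Lemma potential_step {R : realType} (a : int -> R) (k : int) :
  potential a k - potential a (k - 1) = log_ratio (a k).
Proof.
case: k => [[|k]|k].
- by rewrite sub0r /= big_geq// sub0r opprK big_nat1 oppr0.
- have -> : Posz k.+1 - 1 = Posz k by lia.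
  by rewrite /= big_nat_recr//=; ring.
- have -> : Negz k - 1 = Negz k.+1 by lia.
  by rewrite /= [X in _ - - X]big_nat_recr//= NegzE; ring.
Qed.

(** The walk is the electrical network in which the edge between k and k + 1 has resistance exp (S
    k). *)
Lemma transition_potential {R : realType} (a : int -> R) (k : int) : 0 < a k < 1 ->
  a k = expR (potential a (k - 1)) / (expR (potential a k) + expR (potential a (k - 1))).
Proof.
move=> /andP[a0 a1]; have := potential_step a k.
move/(congr1 (@expR R)); rewrite expRD expRN /log_ratio lnK; last first.
  by rewrite posrE divr_gt0// subr_gt0.
have := expR_gt0 (potential a k); have := expR_gt0 (potential a (k - 1)).
set p := expR (potential a (k - 1)); set q := expR (potential a k) => p0 q0 h.
have -> : q = (1 - a k) / a k * p by rewrite -h mulfVK ?gt_eqF.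
have ? : a k != 0 by rewrite gt_eqF.
have ? : p != 0 by rewrite gt_eqF.
have -> : (1 - a k) / a k * p + p = p / a k by field.
by field; apply/andP.
Qed.

(* One side of a valley as an electrical network: r i is the resistance of
   the edge between the points at distance i and i.+1 from the bottom. *)
Section Ray.
Context {R : realType}.
Variables (r : nat -> R) (K : nat).
Hypothesis r_gt0 : forall i, 0 < r i.

Definition conductance (k : nat) : R := (r k)^-1 + (r k.-1)^-1.
(** The increment of the mean hitting time across edge i: its resistance times the stationary mass
    of the vertices beyond it. The sum stops at K because only the time spent in the window is
    counted; beyond K the slope vanishes and the time stays constant. *)
Definition slope (i : nat) : R := r i * \sum_(i.+1 <= k < K.+1) conductance k.
Definition ray_time (j : nat) : R := \sum_(0 <= i < j) slope i.
(** Resistance from the bottom, normalised to 1 at the first vertex outside. It keeps growing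
    beyond, which preserves harmonicity everywhere except at the bottom. *)
Definition ray_escape (j : nat) : R :=
  (\sum_(0 <= i < j) r i) / (\sum_(0 <= i < K.+1) r i).
Definition outward (k : nat) : R := r k.-1 / (r k + r k.-1).

Lemma conductance_gt0 k : 0 < conductance k.
Proof. by rewrite addr_gt0 ?invr_gt0. Qed.

Lemma slope_ge0 i : 0 <= slope i.
Proof.
rewrite mulr_ge0 ?(ltW (r_gt0 i))// sumr_ge0// => k _.
exact/ltW/conductance_gt0.
Qed.

Lemma slope_out i : (K <= i)%N -> slope i = 0.
Proof. by move=> Ki; rewrite /slope big_geq ?mulr0. Qed.

Lemma ray_time_ge0 j : 0 <= ray_time j.
Proof. by apply: sumr_ge0 => i _; exact: slope_ge0. Qed.

Lemma ray_timeS j : ray_time j.+1 = ray_time j + slope j.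
Proof. by rewrite /ray_time big_nat_recr. Qed.

Lemma ray_time_in k : (0 < k)%N -> (k <= K)%N ->
  outward k * ray_time k.+1 + (1 - outward k) * ray_time k.-1 = ray_time k - 1.
Proof.
case: k => // k _ kK; rewrite /outward ray_timeS ray_timeS /= {2}/slope /slope.
rewrite [in X in _ + r k * X]big_ltn// /conductance /=.
set s := \sum_(_ <= _ < _) _; have := r_gt0 k; have := r_gt0 k.+1.
move: (ray_time k) (r k) (r k.+1) s => t p q s q0 p0.
have pq : q + p != 0 by rewrite gt_eqF// addr_gt0.
by field; rewrite pq !gt_eqF.
Qed.

Lemma ray_time_out k : (K < k)%N ->
  outward k * ray_time k.+1 + (1 - outward k) * ray_time k.-1 = ray_time k.
Proof.
case: k => // k Kk; rewrite /= !ray_timeS !slope_out//; last exact: ltnW.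
by rewrite !addr0; ring.
Qed.

Lemma ray_time_le B j : (forall i k, (i < k)%N -> (k <= K)%N -> r i * conductance k <= B) ->
  0 <= B -> ray_time j <= K%:R ^+ 2 * B.
Proof.
move=> rB B0.
have sB i : slope i <= K%:R * B.
  rewrite /slope big_distrr/= big_nat_cond.
  apply: (@le_trans _ _ (\sum_(i.+1 <= k < K.+1 | (i.+1 <= k < K.+1)%N && true) B)).
    by apply: ler_sum => k /andP[/andP[ik kK] _]; apply: rB; lia.
  rewrite -big_nat_cond sumr_const_nat -[leLHS]mulr_natl ler_wpM2r// ler_nat; lia.
have rm j' : ray_time (K + j') = ray_time K.
  elim: j' => [|j' IH]; first by rewrite addn0.
  by rewrite addnS ray_timeS IH slope_out ?addr0// leq_addr.
have h j' : (j' <= K)%N -> ray_time j' <= K%:R ^+ 2 * B.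
  move=> jK; rewrite /ray_time (le_trans (ler_sum_nat (fun i _ => sB i)))//.
  rewrite sumr_const_nat subn0 -[leLHS]mulr_natl expr2 -mulrA ler_wpM2r ?mulr_ge0//.
  by rewrite ler_nat.
by have [/ltnW/subnKC <-|] := ltnP K j; [rewrite rm; exact: h|exact: h].
Qed.

Lemma total_gt0 : 0 < \sum_(0 <= i < K.+1) r i.
Proof.
rewrite big_nat_recr//= ltr_wpDl// sumr_ge0// => i _; exact: ltW.
Qed.

Lemma ray_escape_ge0 j : 0 <= ray_escape j.
Proof.
rewrite divr_ge0 ?(ltW total_gt0)// sumr_ge0// => i _; exact: ltW.
Qed.

Lemma ray_escape0 : ray_escape 0 = 0.
Proof. by rewrite /ray_escape big_geq// mul0r. Qed.

Lemma ray_escape_out j : (K < j)%N -> 1 <= ray_escape j.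
Proof.
move=> Kj; rewrite ler_pdivlMr ?total_gt0// mul1r.
rewrite [leRHS](@big_cat_nat _ _ _ K.+1)//= lerDl sumr_ge0// => i _; exact: ltW.
Qed.

Lemma ray_escape_harm k : (0 < k)%N ->
  outward k * ray_escape k.+1 + (1 - outward k) * ray_escape k.-1 = ray_escape k.
Proof.
case: k => // k _; rewrite /outward /ray_escape /= !(big_nat_recr k.+1)//= !(big_nat_recr k)//=.
have := total_gt0; have := r_gt0 k; have := r_gt0 k.+1.
move: (\sum_(0 <= i < k) r i) (\sum_(0 <= i < K.+1) r i) (r k) (r k.+1) => s w p q q0 p0 w0.
have pq : q + p != 0 by rewrite gt_eqF// addr_gt0.
by field; rewrite pq !gt_eqF.
Qed.

Lemma edge_le_total k : (k <= K)%N -> r k <= \sum_(0 <= i < K.+1) r i.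
Proof.
move=> kK; rewrite (@big_cat_nat _ _ _ k.+1)//= big_nat_recr//=.
rewrite -[leLHS]add0r -[leLHS]addr0.
by rewrite lerD ?lerD2r// sumr_ge0// => i _; exact: ltW.
Qed.

Lemma ray_escape_le j k B : (k <= K)%N -> 0 <= B ->
  (forall i, (i < j)%N -> r i <= B * r k) -> ray_escape j <= j%:R * B.
Proof.
move=> kK B0 rB; rewrite ler_pdivrMr ?total_gt0//.
apply: (@le_trans _ _ (\sum_(0 <= i < j) B * r k)).
  by apply: ler_sum_nat => i /andP[_ ij]; exact: rB.
by rewrite sumr_const_nat subn0 -[leLHS]mulr_natl -mulrA ler_wpM2l// ler_wpM2l// edge_le_total.
Qed.

Lemma ray_escape1_le k : (k <= K)%N -> ray_escape 1 <= r 0 / r k.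
Proof.
move=> kK; rewrite /ray_escape big_nat1 ler_wpM2l ?(ltW (r_gt0 0))//.
by rewrite lef_pV2 ?posrE ?total_gt0// edge_le_total.
Qed.

End Ray.

Section ValleyNetwork.
Context {R : realType}.
Variables (a : int -> R) (l m rr : int).
Hypothesis a01 : forall i, 0 < a i < 1.
Hypotheses (lm : l < m) (mr : m < rr).
Let S := potential a.

Definition right_edge (i : nat) : R := expR (S (m + i%:Z)).
(** The edge between k - 1 and k has resistance exp (S (k - 1)), whence the shift by one with
    respect to the right side. *)
Definition left_edge (i : nat) : R := expR (S (m - i%:Z - 1)).

Definition glue (fl fr : nat -> R) (x : int) : R :=
  if m <= x then fr `|x - m|%N else fl `|m - x|%N.

Lemma glue_right fl fr (k : nat) : glue fl fr (m + k%:Z) = fr k.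
Proof. by rewrite /glue lerDl /= addrC addKr. Qed.

Lemma glue_left fl fr (k : nat) : fl 0%N = fr 0%N -> glue fl fr (m - k%:Z) = fl k.
Proof.
move=> f0; case: k => [|k]; first by rewrite subr0 -[m]addr0 glue_right.
rewrite /glue ifF; last by apply/negbTE; lia.
by congr fl; lia.
Qed.

Lemma outward_right (k : nat) : (0 < k)%N -> outward right_edge k = a (m + k%:Z).
Proof.
case: k => // k _; rewrite /outward [RHS]transition_potential// /right_edge /=.
by have -> : m + k.+1%:Z - 1 = m + k%:Z by lia.
Qed.

Lemma outward_left (k : nat) : (0 < k)%N -> outward left_edge k = 1 - a (m - k%:Z).
Proof.
case: k => // k _; rewrite /outward /left_edge /= [in RHS]transition_potential//.
have -> : m - k%:Z - 1 = m - k.+1%:Z by lia.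
have := expR_gt0 (S (m - k.+1%:Z)); have := expR_gt0 (S (m - k.+1%:Z - 1)).
rewrite -/S; move: (expR (S (m - k.+1%:Z - 1))) (expR (S (m - k.+1%:Z))) => p q p0 q0.
have pq : p + q != 0 by rewrite gt_eqF// addr_gt0.
have qp : q + p != 0 by rewrite addrC.
by field; rewrite ?pq ?qp.
Qed.

Lemma int_side (x : int) : exists k : nat, x = m + k%:Z \/ x = m - k%:Z.
Proof. exists `|x - m|%N; case: (lerP m x) => h; [left|right]; lia. Qed.

Lemma step_glue fl fr (k : nat) : fl 0%N = fr 0%N -> (0 < k)%N ->
  step_mean a (glue fl fr) (m + k%:Z) =
    outward right_edge k * fr k.+1 + (1 - outward right_edge k) * fr k.-1 /\
  step_mean a (glue fl fr) (m - k%:Z) =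
    outward left_edge k * fl k.+1 + (1 - outward left_edge k) * fl k.-1.
Proof.
move=> f0 k0; rewrite outward_right// outward_left// /step_mean.
have -> : m + k%:Z + 1 = m + k.+1%:Z by lia.
have -> : m + k%:Z - 1 = m + k.-1%:Z by lia.
have -> : m - k%:Z + 1 = m - k.-1%:Z by lia.
have -> : m - k%:Z - 1 = m - k.+1%:Z by lia.
by rewrite !glue_right !glue_left//; split=> //; ring.
Qed.

Definition KR : nat := `|rr - m|%N.
Definition KL : nat := `|m - l|%N.
Definition hit_time : int -> R := glue (ray_time left_edge KL) (ray_time right_edge KR).
Definition escape : int -> R := glue (ray_escape left_edge KL) (ray_escape right_edge KR).

Let right_gt0 i : 0 < right_edge i. Proof. exact: expR_gt0. Qed.
Let left_gt0 i : 0 < left_edge i. Proof. exact: expR_gt0. Qed.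

Let t0 : ray_time left_edge KL 0 = ray_time right_edge KR 0.
Proof. by rewrite /ray_time !big_geq. Qed.

Let e0 : ray_escape left_edge KL 0 = ray_escape right_edge KR 0.
Proof. by rewrite !ray_escape0. Qed.

Lemma hit_time_m : hit_time m = 0.
Proof. by rewrite -[m in LHS]addr0 /hit_time (glue_right _ _ 0) /ray_time big_geq. Qed.

Lemma hit_time_ge0 x : 0 <= hit_time x.
Proof. by rewrite /hit_time /glue; case: ifP => _; exact: ray_time_ge0. Qed.

Lemma hit_time_in x : l <= x <= rr -> x != m ->
  step_mean a hit_time x = hit_time x - 1.
Proof.
have [k [->|->]] := int_side x => xW xm; have k0 : (0 < k)%N by lia.
  rewrite (step_glue t0 k0).1 ray_time_in//; first by rewrite /hit_time glue_right.
  by rewrite /KR; lia.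
rewrite (step_glue t0 k0).2 ray_time_in//; first by rewrite /hit_time glue_left.
by rewrite /KL; lia.
Qed.

Lemma hit_time_out x : ~~ (l <= x <= rr) -> step_mean a hit_time x = hit_time x.
Proof.
have [k [->|->]] := int_side x => xW; have k0 : (0 < k)%N by lia.
  rewrite (step_glue t0 k0).1 ray_time_out//; first by rewrite /hit_time glue_right.
  by rewrite /KR; lia.
rewrite (step_glue t0 k0).2 ray_time_out//; first by rewrite /hit_time glue_left.
by rewrite /KL; lia.
Qed.

Lemma escape_m : escape m = 0.
Proof. by rewrite -[m in LHS]addr0 /escape (glue_right _ _ 0) ray_escape0. Qed.

Lemma escape_ge0 x : 0 <= escape x.
Proof. by rewrite /escape /glue; case: ifP => _; exact: ray_escape_ge0. Qed.

Lemma escape_out x : ~~ (l <= x <= rr) -> 1 <= escape x.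
Proof.
have [k [->|->]] := int_side x => xW.
  by rewrite /escape glue_right ray_escape_out// /KR; lia.
by rewrite /escape glue_left// ray_escape_out// /KL; lia.
Qed.

Lemma escape_harm x : x != m -> step_mean a escape x = escape x.
Proof.
have [k [->|->]] := int_side x => xm; have k0 : (0 < k)%N by lia.
  by rewrite (step_glue e0 k0).1 ray_escape_harm// /escape glue_right.
by rewrite (step_glue e0 k0).2 ray_escape_harm// /escape glue_left.
Qed.

Lemma escape_step_le h : h <= S l - S m -> h <= S rr - S m ->
  step_mean a escape m <= 2 * expR (- h).
Proof.
move=> hl hr; rewrite /step_mean /escape.
rewrite (glue_right _ _ 1) (glue_left 1 e0).
have /andP[a0 a1] := a01 m.
have er : ray_escape right_edge KR 1 <= expR (- h).
  apply: le_trans (ray_escape1_le right_gt0 (leqnn KR)) _.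
  rewrite -expRN -expRD ler_expR addr0.
  by have -> : m + KR%:Z = rr by [rewrite /KR; lia]; lra.
(* Detailed balance at m: it replaces the resistance exp (S (m - 1)) of the first edge on the left
   by exp (S m). *)
have am : (1 - a m) * expR (S (m - 1)) = a m * expR (S m).
  rewrite [in LHS]transition_potential// [in RHS]transition_potential// -/S.
  have : expR (S m) + expR (S (m - 1)) != 0 by rewrite gt_eqF// addr_gt0 ?expR_gt0.
  by move: (expR _) (expR _) => p q pq; field.
have el : (1 - a m) * ray_escape left_edge KL 1 <= a m * (expR (S m) / expR (S l)).
  rewrite mulrA -am -mulrA ler_wpM2l ?subr_ge0 ?(ltW a1)//.
  (* The edge of resistance exp (S l) joins l and l + 1, so it is the last but one on the left. *)
  have kl : (KL.-1 <= KL)%N by lia.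
  apply: le_trans (ray_escape1_le left_gt0 kl) _.
  rewrite /left_edge subr0.
  by have -> : m - KL.-1%:Z - 1 = l by rewrite /KL; lia.
have el2 : expR (S m) / expR (S l) <= expR (- h).
  by rewrite -expRN -expRD ler_expR; lra.
have : a m * ray_escape right_edge KR 1 <= a m * expR (- h) by rewrite ler_wpM2l ?(ltW a0).
have : a m * (expR (S m) / expR (S l)) <= a m * expR (- h) by rewrite ler_wpM2l ?(ltW a0).
have : 0 <= (1 - a m) * expR (- h) by rewrite mulr_ge0 ?expR_ge0// subr_ge0 ltW.
lra.
Qed.

(** Each product of a resistance with a farther conductance is a sum of two exponentials of
    potential differences, which are adverse slopes for a walk heading to m; [ray_time_le] counts at
    most the squared width of such products. *)
Lemma hit_time_le C D x :
  (forall i j, m <= i -> i <= j -> j <= rr -> S i - S j <= D) ->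
  (forall i j, l <= i -> i <= j -> j <= m -> S j - S i <= D) ->
  S l - S (l - 1) <= C -> 0 <= C -> 0 <= D ->
  hit_time x <= (`|rr - l|%N%:R) ^+ 2 * (2 * expR (D + C)).
Proof.
move=> hr hl hC C0 D0.
have B0 : 0 <= 2 * expR (D + C) by rewrite mulr_ge0 ?expR_ge0.
have key K r : (forall i k, (i < k)%N -> (k <= K)%N -> r i * conductance r k <= 2 * expR (D + C)) ->
    (K <= `|rr - l|)%N -> forall k, ray_time r K k <=
    (`|rr - l|%N%:R) ^+ 2 * (2 * expR (D + C)).
  move=> rc Kl k; apply: le_trans (ray_time_le k rc B0) _.
  by rewrite ler_wpM2r// lerXn2r ?nnegrE// ler_nat.
have two p q z : z - p <= D + C -> z - q <= D + C ->
    expR z * ((expR p)^-1 + (expR q)^-1) <= 2 * expR (D + C).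
  move=> hp hq; rewrite mulrDr [leRHS]mulr_natl mulr2n -!expRN -!expRD.
  by rewrite lerD// ler_expR.
rewrite /hit_time /glue; case: ifP => _; apply: key.
- move=> i k ik kK; have kr : m + k%:Z <= rr by move: kK; rewrite /KR; lia.
  by apply: two; (apply: le_trans (hr _ _ _ _ _) _; [lia|lia|lia|rewrite lerDl]).
- by rewrite /KR; lia.
- move=> i k ik kK; have kl : l <= m - k%:Z by move: kK; rewrite /KL; lia.
  apply: two; last by (apply: le_trans (hl _ _ _ _ _) _; [lia|lia|lia|rewrite lerDl]).
  (* The conductance at l involves the edge to l - 1, outside the window; this exception is paid by
     C. *)
  have [e|e] : l = m - k%:Z \/ l < m - k%:Z by lia.
    rewrite -e; have := hl l (m - i%:Z - 1); rewrite lexx => /(_ isT).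
    have h1 : l <= m - i%:Z - 1 by lia.
    have h2 : m - i%:Z - 1 <= m by lia.
    move=> /(_ h1 h2); lra.
  by (apply: le_trans (hl _ _ _ _ _) _; [lia|lia|lia|rewrite lerDl]).
- by rewrite /KL; lia.
Qed.

(* [escape 0] is the resistance between m and 0 divided by the one between m
   and the edge of the valley on the side of 0. *)
Lemma escape0_le B :
  (0 < m -> forall i, 0 <= i -> i <= m -> S i + B <= S l) ->
  (m < 0 -> forall i, m <= i -> i <= 0 -> S i + B <= S rr) ->
  l <= 0 -> 0 <= rr -> escape 0 <= (`|rr - l|%N%:R) * expR (- B).
Proof.
move=> hl hr l0 r0; have [m0|m0|m0] := ltgtP m 0; last first.
- by rewrite -[X in escape X]m0 escape_m mulr_ge0 ?expR_ge0.
- have -> : 0 = m - `|m|%N%:Z by lia.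
  rewrite /escape glue_left//.
  have kl : (KL.-1 <= KL)%N by lia.
  apply: le_trans (ray_escape_le left_gt0 kl (expR_ge0 (- B)) _) _.
    move=> i im; rewrite -expRD ler_expR.
    have -> : m - KL.-1%:Z - 1 = l by rewrite /KL; lia.
    have := hl m0 (m - i%:Z - 1).
    have h1 : 0 <= m - i%:Z - 1 by lia.
    have h2 : m - i%:Z - 1 <= m by lia.
    move=> /(_ h1 h2); lra.
  by rewrite ler_wpM2r ?expR_ge0// ler_nat; lia.
have -> : 0 = m + `|m|%N%:Z by lia.
rewrite /escape glue_right.
apply: le_trans (ray_escape_le right_gt0 (leqnn KR) (expR_ge0 (- B)) _) _.
  move=> i im; rewrite -expRD ler_expR.
  have -> : m + KR%:Z = rr by rewrite /KR; lia.
  have := hr m0 (m + i%:Z).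
  have h1 : m <= m + i%:Z by lia.
  have h2 : m + i%:Z <= 0 by lia.
  move=> /(_ h1 h2); lra.
by rewrite ler_wpM2r ?expR_ge0// ler_nat; lia.
Qed.

End ValleyNetwork.

(** * Local times and excursions as sums over finite trajectories *)

Section LocalTimes.
Context {R : realType}.

Lemma local_time_nat (x : nat -> int) (k : int) (n : nat) :
  local_time x k (n%:R)%:E = (\sum_(1 <= i < n.+1) (x i == k)%:R : R)%:E.
Proof.
rewrite /local_time eseries_cond eseries_mkcond.
rewrite (@nneseries_split _ _ 0%N n.+1); last first.
  by move=> i _; case: ifP => // _; rewrite lee_fin.
rewrite eseries0 ?adde0; last first.
  move=> i; rewrite add0n => ni _; case: ifP => // /andP[+ _].
  by rewrite lee_fin ler_nat; lia.
rewrite add0n big_ltn// andbF add0e -sumEFin; apply: eq_big_nat => i /andP[i1 i_n].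
by rewrite i1 lee_fin ler_nat -ltnS i_n.
Qed.

(** The hitting time itself is included, so time i counts as soon as m is avoided strictly between 0
    and i. *)
Lemma le_hitting_time (x : nat -> int) (m : int) (i : nat) :
  ((i%:R)%:E <= hitting_time x m :> \bar R)%E <->
  forall j, (0 < j)%N -> (j < i)%N -> x j != m.
Proof.
split=> [h j j0 ji|h].
  apply/negP => /eqP xj; move: h; apply/negP; rewrite -ltNge.
  apply: (@le_lt_trans _ _ (j%:R)%:E); last by rewrite lte_fin ltr_nat.
  by apply: ereal_inf_lbound; exists j.
apply: le_ereal_inf_tmp => _ [j [j1 xj] <-]; rewrite lee_fin ler_nat leqNgt.
by apply/negP => /(h _ j1); rewrite xj eqxx.
Qed.

Lemma local_time_setE (x : nat -> int) (V : pred int) (t : \bar R) :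
  finite_set [set` V] ->
  local_time_set x [set` V] t =
  (\sum_(i <oo) (((i.+1)%:R%:E <= t)%E && V (x i.+1))%:R%:E)%E.
Proof.
move=> fV; rewrite /local_time_set esum_fset//; last first.
  by move=> j _; apply: nneseries_ge0 => i _ _; rewrite lee_fin.
rewrite fsbig_finite//=.
pose f (j : int) (i : nat) : \bar R :=
  if ((i%:R)%:E <= t)%E then ((x i == j)%:R)%:E else 0%E.
transitivity (\sum_(j <- fset_set [set` V]) \sum_(1 <= i <oo) f j i)%E.
  by apply: eq_bigr => j _; rewrite /local_time eseries_mkcond.
transitivity (\sum_(1 <= i <oo) \sum_(j <- fset_set [set` V]) f j i)%E.
  apply/esym/nneseries_sum => j i _.
  by rewrite /f; case: ifP => // _; rewrite lee_fin.
transitivity (\sum_(i <oo) \sum_(j <- fset_set [set` V]) f j (i + 1)%N)%E.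
  apply/esym/(nneseries_addn (f := fun i => \sum_(j <- fset_set [set` V]) f j i)%E).
  by move=> i; apply: sume_ge0 => j _; rewrite /f; case: ifP => // _; rewrite lee_fin.
apply: eq_eseriesr => i _; rewrite addn1 /f.
case: (((i.+1)%:R)%:E <= t)%E => /=; last by rewrite big1.
rewrite sumEFin; congr EFin.
case: (boolP (V (x i.+1))) => Vx.
  have xin : x i.+1 \in fset_set [set` V] by rewrite in_fset_set// inE.
  rewrite (bigD1_seq (x i.+1))/= ?fset_uniq// eqxx big1 ?addr0// => j jx.
  by rewrite eq_sym (negbTE jx).
rewrite big_seq big1// => j; rewrite in_fset_set// inE /= => Vj.
by case: eqVneq => // e; case/negP: Vx; rewrite e; exact: Vj.
Qed.

End LocalTimes.

Section Excursion.
Context {R : realType}.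
Variables (a : int -> R) (W : pred int) (m : int).

(** For positions x_0, ..., x_k with k >= 1: x_k is in W and none of x_1, ..., x_(k-1) is m. Both
    ends may be m, since the excursion starts there and its local time includes the return. *)
Definition first_visits (s : seq int) : bool :=
  W (last 0 s) && all (fun y => y != m) (take (size s).-2 (behead s)).

Lemma cnt_path_mean k x :
  \sum_(i < k) path_mean a i.+1 x (fun s => (first_visits s)%:R) = cnt a W m k x.
Proof.
elim: k x => [|k IH] x; first by rewrite big_ord0.
rewrite big_ord_recl /=.
have -> : \sum_(i < k) step_mean a (fun y => step_mean a (fun y0 =>
    path_mean a i y0 (fun s => (first_visits (x :: y :: s))%:R)) y) x =
  \sum_(i < k) step_mean a (fun y => (y != m)%:R *
    path_mean a i.+1 y (fun s => (first_visits s)%:R)) x.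
  apply: eq_bigr => i _; congr step_mean; apply/funext => y.
  rewrite -path_meanZ.
  apply: (@eq_path_mean _ _ i.+1 y (fun s => (first_visits (x :: s))%:R)) => s si.
  by rewrite /first_visits; case: s si => // z s [si] /=; case: (y != m);
    rewrite ?mul1r ?mul0r ?andbF.
have -> : \sum_(i < k) step_mean a (fun y => (y != m)%:R *
    path_mean a i.+1 y (fun s => (first_visits s)%:R)) x =
  step_mean a (fun y => (y != m)%:R * cnt a W m k y) x.
  by rewrite /step_mean -!IH !mulr_sumr -big_split.
rewrite /step_mean /first_visits /= !andbT; ring.
Qed.

End Excursion.

Lemma trajectory_nth d (T : measurableType d) (X : nat -> T -> int) n w i : (i < n)%N ->
  nth 0 (trajectory X n w) i = X i w.
Proof. by move=> i_n; rewrite nth_mkseq. Qed.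

Lemma first_visits_trajectory d (T : measurableType d) (X : nat -> T -> int) (V : pred int) m i w :
  first_visits V m (trajectory X i.+2 w) <->
  V (X i.+1 w) /\ forall j, (0 < j)%N -> (j < i.+1)%N -> X j w != m.
Proof.
rewrite /first_visits -nth_last size_mkseq trajectory_nth// -[i.+2.-1]/(i.+1) -[i.+2.-2]/i.
have st : size (take i (behead (trajectory X i.+2 w))) = i.
  by rewrite size_takel// size_behead size_mkseq.
split=> [/andP[Vi /(all_nthP 0) h]|[-> h]].
  split=> // j j0 ji; have := h j.-1; rewrite st nth_take; last by lia.
  by rewrite nth_behead trajectory_nth; [case: j j0 ji => // j _ ji; apply|]; lia.
apply/(all_nthP 0) => j; rewrite st => ji.
by rewrite nth_take// nth_behead trajectory_nth; [apply: h|]; lia.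
Qed.

Lemma mean_excursionE {R : realType} d (T : measurableType d)
    (X : nat -> T -> int) (a : int -> R) (m : int) (P : probability T R) (V : pred int) :
  walk_law X a m P -> finite_set [set` V] ->
  mean_excursion_time X P [set` V] m =
  (\sum_(i <oo) (path_mean a i.+1 m (fun s => (first_visits V m s)%:R))%:E)%E.
Proof.
move=> XP fV; rewrite /mean_excursion_time.
pose E i : set T := [set w | first_visits V m (trajectory X i.+2 w)].
have mE i : measurable (E i) by exact: (measurable_trajectory XP).
transitivity (\int[P]_w (\sum_(i <oo) (\1_(E i) w)%:E))%E.
  apply: eq_integral => w _; rewrite local_time_setE//.
  apply: eq_eseriesr => i _; rewrite indicE; congr ((_ : bool)%:R%:E).
  apply/idP/idP => [/andP[/le_hitting_time h Vi]|].
    by rewrite inE; apply/first_visits_trajectory; split.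
  rewrite inE => /first_visits_trajectory[Vi h]; rewrite Vi andbT.
  exact/le_hitting_time.
rewrite integral_nneseries//.
  apply: eq_eseriesr => i _; rewrite integral_indic// setIT.
  exact: (trajectory_law XP).
by move=> i; exact/measurable_EFinP/measurable_indic.
Qed.

(** Passes to the limit in the bounds on [cnt]. The uniform upper bound makes the series finite, so
    that [fine] returns its true value. *)
Lemma partial_sums_bounds {R : realType} (f : nat -> R) (A c b q : R) :
  (forall i, 0 <= f i) -> (forall k, \sum_(i < k) f i <= A) ->
  (forall k, A - c - b * q ^+ k <= \sum_(i < k.+1) f i) -> 0 <= q < 1 ->
  A - c <= fine (\sum_(i <oo) (f i)%:E) <= A.
Proof.
move=> f0 fA fl /andP[q0 q1].
have f0E i : (0 <= (f i)%:E)%E by rewrite lee_fin.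
have uA : (\sum_(i <oo) (f i)%:E <= A%:E)%E.
  apply: lime_le; first exact: is_cvg_nneseries.
  by apply: nearW => k /=; rewrite sumEFin lee_fin big_mkord.
have fin : (\sum_(i <oo) (f i)%:E)%E \is a fin_num.
  rewrite ge0_fin_numE; first exact: le_lt_trans uA (ltry _).
  by apply: nneseries_ge0 => i _.
have -> : fine (\sum_(i <oo) (f i)%:E) <= A by rewrite -lee_fin fineK.
rewrite andbT.
apply/ler_addgt0Pr => e e0.
have : (b * q ^+ k) @[k --> \oo] --> (b * 0 : R).
  by apply: cvgMr; apply: cvg_expr; rewrite ger0_norm.
rewrite mulr0 => /cvgrPdist_lt /(_ e e0)[k _ /(_ k (leqnn k))]; rewrite /= sub0r normrN => hk.
have : \sum_(i < k.+1) f i <= fine (\sum_(i <oo) (f i)%:E).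
  rewrite -lee_fin fineK// -sumEFin -(big_mkord xpredT (fun i => (f i)%:E)).
  exact: nneseries_lim_ge.
have := fl k; have := ler_norm (b * q ^+ k); move: hk; lra.
Qed.

(** * Deviation of the local time in a fixed environment *)

Section Quenched.
Context {R : realType} d (T : measurableType d).
Variables (X : nat -> T -> int) (a : int -> R) (l m rr : int) (P0 Pm : probability T R).
Hypothesis a01 : forall i, 0 < a i < 1.
Hypotheses (XP0 : walk_law X a 0 P0) (XPm : walk_law X a m Pm).
Hypotheses (lm : l < m) (mr : m < rr).

Let W : pred int := fun x => l <= x <= rr.
Let t := hit_time a l m rr.
Let u := escape a l m rr.

Lemma finite_window : finite_set [set` W].
Proof.
have : finite_set [set m + k%:Z - `|m - l|%N%:Z | k in `I_(`|rr - l|%N.+1)].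
  exact/finite_image/finite_II.
apply: sub_finite_set => x /= /andP[lx xr].
by exists `|x - l|%N; lia.
Qed.

Variables (b kappa p : R).
Hypothesis tb : forall x, t x <= b.
Hypothesis uk : step_mean a u m <= kappa.
Hypothesis up : u 0 <= p.

Let Wm : W m. Proof. rewrite /W; lia. Qed.


Let wt : R := weight a m t.

Lemma excursion_bounds :
  wt^-1 - (b + 1) * kappa <= fine (mean_excursion_time X Pm (zint l rr) m) <= wt^-1.
Proof.
have -> : zint l rr = [set` W] by apply/seteqP; split.
have b0 : 0 <= b by exact: le_trans (hit_time_ge0 a l m rr m) (tb m).
rewrite (mean_excursionE XPm finite_window).
apply: (@partial_sums_bounds _ _ _ _ b (1 - (b + 1)^-1)).
- move=> i; rewrite -[leLHS](path_mean_cst a i.+1 m); apply: path_mean_le => // s _.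
- move=> k; rewrite cnt_path_mean invrK; apply: cnt_le => //.
  + exact: hit_time_m.
  + exact: hit_time_ge0.
  + by move=> x Wx xm; exact: hit_time_in.
  + by move=> x Wx; exact: hit_time_out.
- move=> k; rewrite cnt_path_mean.
  apply: (@cnt_m_ge _ _ W m t u b kappa) => //.
  + exact: hit_time_m.
  + exact: hit_time_ge0.
  + by move=> x Wx xm; exact: hit_time_in.
  + exact: escape_m.
  + exact: escape_ge0.
  + by move=> x Wx; exact: escape_out.
  + by move=> x xm; exact: escape_harm.
- have b1 : 0 < (b + 1)^-1 by rewrite invr_gt0 ltr_wpDl.
  have : (b + 1)^-1 <= 1 by rewrite invf_le1 ?lerDr// ltr_wpDl.
  by move: ((b + 1)^-1) b1 => z z0 z1; rewrite subr_ge0 z1/= ltrBlDr ltrDl.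
Qed.

Lemma visits_sum n w : \sum_(1 <= i < n.+1) (X i w == m)%:R - n%:R * wt =
  centered_visits a m t (behead (trajectory X n.+1 w)).
Proof.
rewrite /centered_visits /trajectory /mkseq /= big_map big_split/=.
rewrite [X in _ = _ + X](_ : _ = - (n%:R * wt)); last first.
  by rewrite big_const_seq count_predT size_iota iter_addr_0 -[LHS]mulr_natl mulrN.
by congr (_ + _); rewrite /index_iota subn1.
Qed.

Lemma visits_deviation n (e : R) : 0 < e -> (0 < n)%N -> l <= 0 <= rr ->
  (P0 [set w | (all W (trajectory X n.+1 w) &&
     (n%:R * e < `|centered_visits a m t (behead (trajectory X n.+1 w))|))%R]
   <= ((6 * (b + 1) ^+ 2 + n%:R * (4 * b)) / (n%:R * e) ^+ 2)%:E)%E.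
Proof.
move=> e0 n0 W0; have ne : 0 < n%:R * e by rewrite mulr_gt0// ltr0n.
rewrite (trajectory_law XP0 n (fun s => all W s && (n%:R * e < `|centered_visits a m t (behead s)|))).
rewrite lee_fin ler_pdivlMr ?exprn_gt0// mulrC -path_meanZ.
apply: (@le_trans _ _ (path_mean a n 0 (fun s => if all W s then
     centered_visits a m t (behead s) ^+ 2 else 0))).
  apply: path_mean_le => // s _; case: (all W _) => /=; last by rewrite mulr0.
  case: ltrP => h; last by rewrite mulr0 sqr_ge0.
  rewrite mulr1 -[leRHS]real_normK ?num_real// lerXn2r ?nnegrE ?(ltW ne)//.
  exact: ltW.
apply: (@centered_visits_mean _ _ W) => //.
- exact: hit_time_m.
- exact: hit_time_ge0.
- by move=> x Wx xm; exact: hit_time_in.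
Qed.

Lemma exit_probability n :
  (P0 [set w | has (predC W) (trajectory X n.+1 w)] <= (p + n%:R * kappa)%:E)%E.
Proof.
rewrite (trajectory_law XP0 n (has (predC W))) lee_fin.
apply: (@le_trans _ _ (u 0 + n%:R * kappa)); last by rewrite lerD2r.
apply: (@exit_mean _ a W m u kappa) => //.
- exact: escape_m.
- exact: escape_ge0.
- by move=> x Wx; exact: escape_out.
- by move=> x xm; exact: escape_harm.
Qed.

Lemma deviation_probability n (e : R) : 0 <= (b + 1) * kappa <= 1 / 2 ->
  e = (ilog 2 n ^+ 2)^-1 -> 4 * ((b + 1) * kappa) <= e -> 0 < e -> (0 < n)%N ->
  l <= 0 <= rr ->
  (P0 (deviation_event X m n (fine (mean_excursion_time X Pm (zint l rr) m)))
   <= (p + n%:R * kappa + (6 * (b + 1) ^+ 2 + n%:R * (4 * b)) / (n%:R * (e / 2)) ^+ 2)%:E)%E.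
Proof.
move=> /andP[k0 k1] eE ke e0 n0 W0.
have nR : 0 < n%:R :> R by rewrite ltr0n.
set D := deviation_event _ _ _ _.
pose A1 := [set w | has (predC W) (trajectory X n.+1 w)].
pose A2 := [set w | all W (trajectory X n.+1 w) &&
     (n%:R * (e / 2) < `|centered_visits a m t (behead (trajectory X n.+1 w))|)].
have mA1 : measurable A1 by exact: (measurable_trajectory XP0).
have mA2 : measurable A2.
  exact: (measurable_trajectory XP0 n.+1 (fun s => all W s &&
    (n%:R * (e / 2) < `|centered_visits a m t (behead s)|))).
have mD : measurable D.
  rewrite (_ : D = [set w | e < `|(centered_visits a m t (behead (trajectory X n.+1 w)) + n%:R * wt)
     / n%:R - (fine (mean_excursion_time X Pm (zint l rr) m))^-1|]).
    exact: (measurable_trajectory XP0 n.+1 (fun s =>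
      e < `|(centered_visits a m t (behead s) + n%:R * wt) / n%:R -
        (fine (mean_excursion_time X Pm (zint l rr) m))^-1|)).
  apply/seteqP; split=> w; rewrite /D /deviation_event /= -visits_sum subrK -eE local_time_nat;
  by [].
have DA : D `<=` A1 `|` A2.
  move=> w; rewrite /D /deviation_event /= -eE local_time_nat /=.
  set L := \sum_(_ <= _ < _) _; set E := fine _ => dev.
  case: (boolP (all W (trajectory X n.+1 w))) => Ww; last first.
    by left; rewrite /A1 /mkset has_predC.
  right; rewrite /A2 /mkset Ww andTb -visits_sum -/L.
  have /andP[E1 E2] := excursion_bounds; rewrite -/E in E1 E2.
  have th0 : 0 < wt by apply: weight_gt0 => //; exact: hit_time_ge0.
  have th1 : wt <= 1 by apply: weight_le1 => //; exact: hit_time_ge0.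
  have i1 : 1 <= wt^-1 by rewrite invf_ge1.
  have E0 : 1 / 2 <= E by lra.
  have Ep : 0 < E by apply: lt_le_trans E0; lra.
  (* Replacing 1 / E by the stationary weight uses half of the tolerance; the other half is left to
     the centered visits. *)
  have hE : `|E^-1 - wt| <= e / 2.
    have -> : E^-1 - wt = (wt^-1 - E) * (wt / E) by field; rewrite !gt_eqF.
    rewrite normrM ger0_norm ?subr_ge0//.
    have -> : e / 2 = (e / 4) * 2 by field.
    have q2 : `|wt / E| <= 2.
      rewrite ger0_norm ?divr_ge0 ?(ltW th0) ?(ltW Ep)// ler_pdivrMr//; lra.
    by rewrite ler_pM ?subr_ge0//; lra.
  have -> : L - n%:R * wt = n%:R * (L / n%:R - wt) by field; rewrite gt_eqF.
  rewrite normrM gtr0_norm// ltr_pM2l//.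
  have : `|L / n%:R - E^-1| <= `|L / n%:R - wt| + `|E^-1 - wt|.
    rewrite [X in _ <= _ + X]distrC; apply: le_trans (ler_normD _ _).
    by rewrite addrA subrK.
  lra.
apply: le_trans (_ : (P0 (A1 `|` A2) <= _)%E).
  by apply: le_measure; rewrite ?inE//; exact: measurableU.
apply: le_trans (_ : (P0 A1 + P0 A2 <= _)%E).
  exact: measureU2.
rewrite EFinD; apply: leeD; first exact: exit_probability.
by apply: visits_deviation => //; rewrite divr_gt0.
Qed.
End Quenched.

(** * Valleys of a potential *)

Section IntervalExtrema.
Context {R : realType}.
Variable S : int -> R.

Lemma finite_zint a b : finite_set (zint a b).
Proof.
have : finite_set [set a + k%:Z | k in `I_(`|b - a|%N.+1)].
  exact/finite_image/finite_II.
apply: sub_finite_set => x /= /andP[lx xr].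
by exists `|x - a|%N; lia.
Qed.

Lemma finite_argmax (I : choiceType) (A : set I) (f : I -> R) : finite_set A -> A !=set0 ->
  exists2 x, A x & forall y, A y -> f y <= f x.
Proof.
move=> fA [x0 Ax0].
have [s sA] := (finite_seqP A).1 fA.
have : x0 \in s by move: Ax0; rewrite sA.
rewrite sA => {sA Ax0}; elim: s x0 => // y s IH x0 _.
case: s IH => [|z s] IH.
  exists y => /=; first by rewrite inE.
  by move=> z /=; rewrite inE => /eqP ->.
have [x xs hx] := IH z (mem_head _ _).
have [yx|xy] := lerP (f y) (f x).
  exists x => /=; first by rewrite inE [X in _ || X]xs orbT.
  by move=> t /=; rewrite inE => /orP[/eqP -> //|ts]; exact: hx.
exists y => /=; first by rewrite inE eqxx.
move=> t /=; rewrite inE => /orP[/eqP -> //|ts].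
by rewrite (le_trans (hx t ts))// ltW.
Qed.

Lemma finite_has_ubound (A : set R) : finite_set A -> has_ubound A.
Proof.
move=> fA; have [->|/set0P A0] := eqVneq A set0; first by exists 0 => ? [].
by have [x _ h] := finite_argmax id fA A0; exists x.
Qed.

Lemma sup_eq_max (A : set R) x : A x -> (forall y, A y -> y <= x) -> sup A = x.
Proof.
move=> Ax h; apply/eqP; rewrite eq_le; apply/andP; split.
  by apply: ge_sup => //; exists x.
by apply: ub_le_sup => //; exists x.
Qed.

Lemma maxS_exists a b : a <= b -> exists2 t, a <= t <= b &
  maxS S a b = S t /\ forall s, a <= s <= b -> S s <= S t.
Proof.
move=> ab; have [|t tab ht] := @finite_argmax _ (zint a b) S (finite_zint a b).
  by exists a; rewrite /zint /= lexx.
exists t => //; split => //; apply: sup_eq_max; first by exists t.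
by move=> _ [s sab <-]; exact: ht.
Qed.

Lemma maxS_eq a b t : a <= t <= b ->
  S t = maxS S a b <-> forall s, a <= s <= b -> S s <= S t.
Proof.
move=> tab; have ab : a <= b by lia.
have [u uab [-> hu]] := maxS_exists ab.
split=> [-> //|h]; apply/eqP; rewrite eq_le hu// h//.
Qed.

Lemma maxS_le_iff a b x : a <= b ->
  maxS S a b <= x <-> forall s, a <= s <= b -> S s <= x.
Proof.
move=> ab; have [u uab [-> hu]] := maxS_exists ab.
by split=> [h s /hu /le_trans|]; [exact|exact].
Qed.

End IntervalExtrema.

Lemma minS_opp {R : realType} (S : int -> R) a b : minS S a b = - maxS (\- S) a b.
Proof.
rewrite /minS /maxS /inf; congr (- sup _); apply/seteqP; split=> x /=.
  by move=> [_ [t tab <-] <-]; exists t.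
by move=> [t tab <-]; exists (S t) => //; exists t.
Qed.

Lemma minS_eq {R : realType} (S : int -> R) a b t : a <= t <= b ->
  S t = minS S a b <-> forall s, a <= s <= b -> S t <= S s.
Proof.
move=> tab; rewrite minS_opp; have := maxS_eq (\- S) tab; rewrite /=.
by move=> [h1 h2]; split=> [e s sab|h]; [rewrite -lerN2; apply: h1 => //; rewrite e opprK
  |rewrite -h2 ?opprK// => s sab; rewrite lerN2; exact: h].
Qed.

Lemma least_abs_exists (A : set int) : A !=set0 -> exists m, least_abs A m.
Proof.
move=> [x Ax].
have ex : exists k : nat, `[< exists2 y, A y & `|y|%N = k >].
  by exists `|x|%N; apply/asboolP; exists x.
case: (ex_minnP ex) => k /asboolP[y Ay yk] hk.
exists y; split=> // t At; have := hk `|t|%N; rewrite -yk => h.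
suff : (`|y| <= `|t|)%N by lia.
by apply: h; apply/asboolP; exists t.
Qed.

(** * Valleys and their refinements *)

Section Refinement.
Context {R : realType}.
Variable S : int -> R.

Definition uvalley (l m r : int) : Prop :=
  [/\ l <= m <= r, forall t, l <= t <= m -> S t <= S l,
      forall t, m <= t <= r -> S t <= S r,
      forall t, l <= t <= r -> S m <= S t
    & forall t, l <= t <= r -> S t = S m -> `|m| <= `|t|].

Lemma is_valleyP l m r : is_valley S (Triplet l m r) <-> uvalley l m r.
Proof.
split=> [[lmr e1 e2 [[_ e3] e4]]|[lmr h1 h2 h3 h4]].
  have lm : l <= l <= m by lia. have mr : m <= r <= r by lia.
  have lmr' : l <= m <= r by [].
  split=> //; [exact/(maxS_eq S lm)|exact/(maxS_eq S mr)|exact/(minS_eq S lmr')|].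
  by move=> t tl et; apply: e4; rewrite /= -e3.
have lm : l <= l <= m by lia. have mr : m <= r <= r by lia.
have e3 : S m = minS S l r by apply/minS_eq.
split=> //; [exact/(maxS_eq S lm)|exact/(maxS_eq S mr)|].
by split=> // t [/= tl et]; apply: h4 => //; rewrite et e3.
Qed.

Lemma max_rise_iff a b m1 M1 : max_rise S a b m1 M1 <->
  [/\ a <= m1, m1 < M1, M1 <= b &
   forall i j, a <= i -> i <= j -> j <= b -> S j - S i <= S M1 - S m1].
Proof.
split=> [[h1 h2 h3 e]|[h1 h2 h3 h]]; split=> //.
  move=> i j ai ij jb; rewrite e; apply: ub_le_sup; last by exists i, j.
  apply: finite_has_ubound.
  have := finite_setX (finite_zint a b) (finite_zint a b).
  move=> /(finite_image (fun p => S p.2 - S p.1)); apply: sub_finite_set.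
  by move=> _ [i' [j' [ai' ij' jb' ->]]]; exists (i', j') => //=; split; rewrite /zint /=; lia.
apply/esym/sup_eq_max; first by exists m1, M1; split=> //; exact: ltW.
by move=> _ [i [j [ai ij jb ->]]]; exact: h.
Qed.

Lemma max_drop_iff a b M1 m1 : max_drop S a b M1 m1 <->
  [/\ a <= M1, M1 < m1, m1 <= b &
   forall i j, a <= i -> i <= j -> j <= b -> S i - S j <= S M1 - S m1].
Proof.
split=> [[h1 h2 h3 e]|[h1 h2 h3 h]]; split=> //.
  move=> i j ai ij jb; rewrite e; apply: ub_le_sup; last by exists i, j.
  apply: finite_has_ubound.
  have := finite_setX (finite_zint a b) (finite_zint a b).
  move=> /(finite_image (fun p => S p.1 - S p.2)); apply: sub_finite_set.
  by move=> _ [i' [j' [ai' ij' jb' ->]]]; exists (i', j') => //=; split; rewrite /zint /=; lia.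
apply/esym/sup_eq_max; first by exists M1, m1; split=> //; exact: ltW.
by move=> _ [i [j [ai ij jb ->]]]; exact: h.
Qed.

(** Maximality of the rise makes m1 a minimum and M1 a maximum of the pieces. A point t of the left
    piece with S t = S m1 also realises the largest rise to M1, so the choice of m1 with least
    absolute value among these is exactly the tie rule for the bottom of a valley. *)
Lemma left_refine l m r : uvalley l m r ->
  (exists i j, [/\ l <= i, i <= j, j <= m & 0 < S j - S i]) ->
  exists M1 m1, [/\ [/\ l <= m1, m1 < M1 & M1 <= m],
    (forall i j, l <= i -> i <= j -> j <= m -> S j - S i <= S M1 - S m1),
    refinement S (Triplet l m r) (Triplet l m1 M1),
    refinement S (Triplet l m r) (Triplet M1 m r) &
    uvalley l m1 M1 /\ uvalley M1 m r].
Proof.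
move=> [/andP[lm mr] h1 h2 h3 h4] [i0 [j0 [li0 ij0 jm0 pos0]]].
have fin : finite_set [set p : int * int | [/\ l <= p.1, p.1 <= p.2 & p.2 <= m]].
  have := finite_setX (finite_zint l m) (finite_zint l m).
  by apply: sub_finite_set => -[i j] /= [li ij jm]; split; rewrite /zint /=; lia.
have [|[i j] /= [li ij jm] hmax] := finite_argmax (fun p => S p.2 - S p.1) fin.
  by exists (i0, j0).
have pos : 0 < S j - S i by apply: lt_le_trans pos0 (hmax (i0, j0) _).
have ijlt : i < j.
  by rewrite lt_neqAle ij andbT; apply: contraTneq pos => ->; rewrite subrr ltxx.
have mr_ij : max_rise S l m i j.
  by apply/max_rise_iff; split=> // i' j' li' ij' jm'; exact: (hmax (i', j')).
have [|M1 [[u0 mr0] laM]] := @least_abs_exists [set t | exists u, max_rise S l m u t].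
  by exists j, i.
have [|m1 [mr1 lam]] := @least_abs_exists [set u | max_rise S l m u M1].
  by exists u0.
have /max_rise_iff[lm1 mM1 Mm hM] := mr1.
have posM : 0 < S M1 - S m1 by apply: lt_le_trans pos (hM i j _ _ _).
exists M1, m1; split=> //.
- by right; exists M1, m1; split; [split=> //; exists u0|split|left].
- by right; exists M1, m1; split; [split=> //; exists u0|split|right].
split; split.
- by rewrite lm1 ltW.
- by move=> t /andP[lt tm]; apply: h1; lia.
- move=> t /andP[mt tM]; have tm : t <= m by lia.
  by have := hM m1 t lm1 mt tm; rewrite lerD2r.
- move=> t /andP[lt tM]; have [tlt|] := ltP t M1.
    by have := hM t M1 lt (ltW tlt) Mm; rewrite lerD2l lerN2.
  move=> Mt; have -> : t = M1 by lia.
  by move: posM; rewrite subr_gt0 => /ltW.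
- move=> t /andP[lt tM] e; apply: lam => /=; apply/max_rise_iff; split=> //.
    rewrite lt_neqAle tM andbT; apply: contraTneq posM => tM'.
    by rewrite -tM' e subrr ltxx.
  by move=> i' j' *; rewrite e; exact: hM.
- by rewrite Mm.
- move=> t /andP[Mt tm]; have mt : m1 <= t by lia.
  by have := hM m1 t lm1 mt tm; rewrite lerD2r.
- exact: h2.
- by move=> t /andP[Mt tr]; apply: h3; lia.
- by move=> t /andP[Mt tr]; apply: h4; lia.
Qed.

Lemma right_refine l m r : uvalley l m r ->
  (exists i j, [/\ m <= i, i <= j, j <= r & 0 < S i - S j]) ->
  exists M1 m1, [/\ [/\ m <= M1, M1 < m1 & m1 <= r],
    (forall i j, m <= i -> i <= j -> j <= r -> S i - S j <= S M1 - S m1),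
    refinement S (Triplet l m r) (Triplet l m M1),
    refinement S (Triplet l m r) (Triplet M1 m1 r) &
    uvalley l m M1 /\ uvalley M1 m1 r].
Proof.
move=> [/andP[lm mr] h1 h2 h3 h4] [i0 [j0 [li0 ij0 jm0 pos0]]].
have fin : finite_set [set p : int * int | [/\ m <= p.1, p.1 <= p.2 & p.2 <= r]].
  have := finite_setX (finite_zint m r) (finite_zint m r).
  by apply: sub_finite_set => -[i j] /= [li ij jm]; split; rewrite /zint /=; lia.
have [|[i j] /= [li ij jm] hmax] := finite_argmax (fun p => S p.1 - S p.2) fin.
  by exists (i0, j0).
have pos : 0 < S i - S j by apply: lt_le_trans pos0 (hmax (i0, j0) _).
have ijlt : i < j.
  by rewrite lt_neqAle ij andbT; apply: contraTneq pos => ->; rewrite subrr ltxx.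
have mr_ij : max_drop S m r i j.
  by apply/max_drop_iff; split=> // i' j' li' ij' jm'; exact: (hmax (i', j')).
have [|M1 [[u0 mr0] laM]] := @least_abs_exists [set t | exists u, max_drop S m r t u].
  by exists i, j.
have [|m1 [mr1 lam]] := @least_abs_exists [set u | max_drop S m r M1 u].
  by exists u0.
have /max_drop_iff[mM1 Mm1 m1r hM] := mr1.
have posM : 0 < S M1 - S m1 by apply: lt_le_trans pos (hM i j _ _ _).
exists M1, m1; split=> //.
- by left; exists M1, m1; split; [split=> //; exists u0|split|left].
- by left; exists M1, m1; split; [split=> //; exists u0|split|right].
split; split.
- by rewrite lm.
- exact: h1.
- move=> t /andP[mt tM]; have tm : t <= m1 by lia.
  by have := hM t m1 mt tm m1r; rewrite lerD2r.
- by move=> t /andP[lt tM]; apply: h3; lia.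
- by move=> t /andP[lt tM]; apply: h4; lia.
- by rewrite m1r andbT ltW.
- move=> t /andP[Mt tm]; have mt : m <= t by lia.
  by have := hM t m1 mt tm m1r; rewrite lerD2r.
- by move=> t /andP[mt tr]; apply: h2; lia.
- move=> t /andP[Mt tr]; have [tlt|] := ltP M1 t.
    by have := hM M1 t mM1 (ltW tlt) tr; rewrite lerD2l lerN2.
  move=> tM; have -> : t = M1 by lia.
  by move: posM; rewrite subr_gt0 => /ltW.
- move=> t /andP[Mt tr] e; apply: lam => /=; apply/max_drop_iff; split=> //.
    rewrite lt_neqAle Mt andbT; apply: contraTneq posM => tM'.
    by rewrite tM' e subrr ltxx.
  by move=> i' j' *; rewrite e; exact: hM.
Qed.

End Refinement.

(* A candidate basic valley: D is the required depth and g the required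
   margin over the barrier between 0 and m. *)
Record window {R : realType} (S : int -> R) (D g : R) (l m r : int) : Prop := Window {
  window_l0 : l <= 0; window_0r : 0 <= r; window_lm : l < m; window_mr : m < r;
  window_Sl : S m + D <= S l; window_Sr : S m + D <= S r;
  window_min : forall t, l <= t -> t <= r -> t != m ->
     S m < S t \/ S m = S t /\ `|m| < `|t|;
  window_left_margin : 0 < m -> forall t, 0 <= t -> t <= m -> S t + g <= S l;
  window_right_margin : m < 0 -> forall t, m <= t -> t <= 0 -> S t + g <= S r;
  window_left_first : forall t, l < t -> t <= 0 -> t < m ->
     S t < S m + D \/ 0 < m /\ exists s, [/\ 0 <= s, s <= m & S t < S s + g];
  window_right_first : forall t, 0 <= t -> t < r -> m < t ->
     S t < S m + D \/ m < 0 /\ exists s, [/\ m <= s, s <= 0 & S t < S s + g];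
  window_rise : forall i j, l <= i -> i <= j -> j <= m -> S j - S i < D;
  window_drop : forall i j, m <= i -> i <= j -> j <= r -> S i - S j < D }.

Section Window.
Context {R : realType}.
Variables (D g : R).
Hypotheses (D0 : 0 < D) (g0 : 0 < g).

Lemma window_reflect (S : int -> R) l m r : window S D g l m r ->
  window (fun t => S (- t)) D g (- r) (- m) (- l).
Proof.
case=> h1 h2 h3 h4 h5 h6 h7 h8 h9 h10 h11 h12 h13.
have nz t : - t != - m -> t != m by apply: contraNneq => ->.
split; rewrite ?opprK ?oppr_le0 ?oppr_ge0 ?ltrN2//.
- move=> t lt tr tm; rewrite [ `|- m|]normrN -[ `|t|]normrN; apply: h7; lia.
- by move=> m0 t t0 tm; apply: h9; lia.
- by move=> m0 t t0 tm; apply: h8; lia.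
- move=> t lt t0 tm; case: (h11 (- t)); [lia|lia|lia|by left|].
  by move=> [m0 [s [ms s0 hs]]]; right; split; [lia|exists (- s); rewrite opprK; split; lia || exact: hs].
- move=> t lt t0 tm; case: (h10 (- t)); [lia|lia|lia|by left|].
  by move=> [m0 [s [ms s0 hs]]]; right; split; [lia|exists (- s); rewrite opprK; split; lia || exact: hs].
- by move=> i j *; apply: h13; lia.
- by move=> i j *; apply: h12; lia.
Qed.

Lemma window_lt_left S l m r t : window S D g l m r -> 0 <= m -> l < t -> t < r ->
  S t < S l.
Proof.
have D0' := D0; have g0' := g0.
move=> w m0 lt tr; have Sl := window_Sl w.
have [t0|t0] := ltP t 0.
  have [||h|[mp [s [s0 sm hs]]]] := window_left_first w lt; [lia|lia|lra|].
  by have := window_left_margin w mp s0 sm; lra.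
have [tm|mt] := leP t m.
  have [mp|m00] : 0 < m \/ m = 0 by lia.
    by have := window_left_margin w mp t0 tm; lra.
  by have -> : t = m by [lia]; lra.
by have [h|[]] := window_right_first w t0 tr mt; [lra|lia].
Qed.

Lemma window_lt_right S l m r t : window S D g l m r -> m <= 0 -> l < t -> t < r ->
  S t < S r.
Proof.
move=> /window_reflect w m0 lt tr.
have h := @window_lt_left _ _ _ _ (- t) w; rewrite /= !opprK in h; apply: h; lia.
Qed.

(** A refinement cuts at M1; a cut strictly inside the window would contradict either the minimality
    of its endpoints or the absence of large rises before m. Hence a valley containing the window is
    refined into pieces one of which still contains it. *)
Lemma top_of_rise S l m r m1 M1 v : window S D g l m r -> r < v ->
  m1 < M1 -> M1 <= v -> (forall t, m1 <= t -> t <= v -> S t <= S M1) ->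
  D <= S M1 - S m1 -> M1 <= l \/ r <= M1.
Proof.
move=> w rv mM Mv hM hD; have D0' := D0.
have [Ml|lM] := leP M1 l; first by left.
have [rM|Mr] := leP r M1; first by right.
exfalso; have rM1 : S r <= S M1 by apply: hM; lia.
have [m0|m0] := leP m 0; first by have := window_lt_right w m0 lM Mr; lra.
have [ml|lm1] := ltP m1 l.
  have : S l <= S M1 by apply: hM; lia.
  have : S M1 < S l by apply: (window_lt_left w) => //; exact: ltW.
  lra.
have [Mm|mM1] := leP M1 m.
  by have := window_rise w lm1 (ltW mM) Mm; lra.
have M10 : 0 <= M1 by lia.
have [h|[]] := window_right_first w M10 Mr mM1; last by lia.
by have := window_Sr w; lra.
Qed.

Lemma top_of_drop S l m r m1 M1 v : window S D g l m r -> v < l ->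
  M1 < m1 -> v <= M1 -> (forall t, v <= t -> t <= m1 -> S t <= S M1) ->
  D <= S M1 - S m1 -> M1 <= l \/ r <= M1.
Proof.
move=> /window_reflect w rv mM Mv hM hD.
have [||||||] := @top_of_rise _ _ _ _ (- m1) (- M1) (- v) w; rewrite ?opprK//; try lia.
move=> t h1 h2; apply: hM; lia.
Qed.

Definition deep_around0 (S : int -> R) (l m r : int) : Prop :=
  [/\ uvalley S l m r, l <= 0 <= r, S m + D <= S l /\ S m + D <= S r,
     m < 0 -> forall t, m <= t -> t <= 0 -> S t + g <= S r
   & 0 < m -> forall t, 0 <= t -> t <= m -> S t + g <= S l].

Lemma deep_reflect S l m r : deep_around0 S l m r ->
  deep_around0 (fun t => S (- t)) (- r) (- m) (- l).
Proof.
move=> [[lmr h1 h2 h3 h4] l0 [d1 d2] m1 m2]; split; rewrite ?opprK//.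
- split; first lia.
  + by rewrite opprK => t *; apply: h2; lia.
  + by rewrite opprK => t *; apply: h1; lia.
  + by rewrite opprK => t *; apply: h3; lia.
  + by rewrite opprK => t tl e; rewrite normrN -[ `|t|]normrN; apply: h4 => //; lia.
- by lia.
- by move=> m0 t *; apply: m2; lia.
- by move=> m0 t *; apply: m1; lia.
Qed.

(** A bottom inside the window must be m by the tie rule. A bottom outside forces the barrier
    towards 0 above the near end of the window by g, and the far end of the window is then the first
    place where the valley could stop. *)
Lemma deep_bottom_nonneg S l m r K' v K : window S D g l m r -> 0 <= m ->
  deep_around0 S K' v K -> v = m \/ K' <= l /\ r <= K.
Proof.
have D0' := D0; have g0' := g0.
move=> w m0 [[vK h1 h2 h3 h4] K0 [d1 d2] mg1 mg2].
have [Km|mK] := ltP K m.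
  exfalso; have [lv|vl] := leP l v.
    have vK' : v <= K by lia.
    by have := window_rise w lv vK' (ltW Km); lra.
  have mp : 0 < m by lia.
  have v0 : v < 0 by have := window_l0 w; lia.
  have K0' : 0 <= K by lia.
  have := window_left_margin w mp K0' (ltW Km).
  have := mg1 v0 l (ltW vl) (window_l0 w); lra.
have bottom : l <= v -> v <= r -> v = m.
  move=> lv vr; apply/eqP; apply/negP => /negP vm.
  have Sm : S v <= S m by apply: h3; have := window_l0 w; lia.
  case: (window_min w lv vr vm) => [|[e am]]; first by lra.
  by have := h4 m; rewrite e => /(_ _ erefl); lia.
have [lv|vl] := leP l v; last first.
  right; have v0 : v < 0 by have := window_l0 w; lia.
  have Sl := mg1 v0 l (ltW vl) (window_l0 w); have Sl' := window_Sl w.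
  split; first by lia.
  have [//|Kr] := leP r K; exfalso.
  have [Km|mK'] : K = m \/ m < K by lia.
    by move: Sl; rewrite Km; lra.
  have K0' : 0 <= K by lia.
  by have [h|[]] := window_right_first w K0' Kr mK'; [lra|lia].
have [vr|rv] := leP v r; first by left; apply: bottom.
right; split; last by lia.
have [//|lK] := leP K' l; exfalso.
have v0 : 0 < v by have := window_0r w; lia.
have Sr : S r + g <= S K' by apply: mg2 => //; [exact: window_0r w|exact: ltW].
have Sr' := window_Sr w; have K0' : K' <= 0 by lia.
have [Km|Km] : K' < m \/ K' = m by lia.
  have [h|[mp [s [s0 sm hs]]]] := window_left_first w lK K0' Km; first by lra.
  have : S s + g <= S K'; last by lra.
  by apply: mg2 => //; have := window_mr w; lia.
by move: Sr; rewrite Km; lra.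
Qed.

Lemma deep_bottom S l m r K' v K : window S D g l m r ->
  deep_around0 S K' v K -> v = m \/ K' <= l /\ r <= K.
Proof.
move=> w dV; have [m0|m0] := leP 0 m; first exact: deep_bottom_nonneg w m0 dV.
have m0' : 0 <= - m by lia.
have [] := deep_bottom_nonneg (window_reflect w) m0' (deep_reflect dV); [left|right]; lia.
Qed.

Lemma bottom_in_window S l m r K' v K : window S D g l m r -> uvalley S K' v K ->
  K' <= l -> r <= K -> l <= v -> v <= r -> v = m.
Proof.
move=> w [vK h1 h2 h3 h4] Kl rK lv vr; apply/eqP; apply/negP => /negP vm.
have mw : K' <= m <= K by have := window_lm w; have := window_mr w; lia.
have Sm : S v <= S m by apply: h3.
case: (window_min w lv vr vm) => [|[e am]]; first by lra.
by have := h4 m mw e; lia.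
Qed.

(** While the bottom v is outside the window, the slope between m and one end of the window is a
    drop or rise of height at least D on the way to v, so the largest one cuts outside the window;
    the piece that contains it is kept. Widths decrease, and a bottom that enters the window is
    m. *)
Lemma refine_to_window S l m r (k : nat) K' v K : window S D g l m r ->
  uvalley S K' v K -> K' <= l -> r <= K -> (`|K - K'| <= k)%N ->
  exists K1 K2, [/\ clos_refl_trans _ (refinement S) (Triplet K' v K) (Triplet K1 m K2),
     uvalley S K1 m K2, K1 <= l & r <= K2].
Proof.
have D0' := D0.
move=> w; have lm := window_lm w; have mr := window_mr w.
have Sl := window_Sl w; have Sr := window_Sr w.
elim: k K' v K => [|k IH] K' v K uv Kl rK len; first by lia.
have [lv|vl] := leP l v; last first.
  have [|M1 [m1 [[vM Mm mK] hM ref1 ref2 [u1 u2]]]] := right_refine uv.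
    by exists l, m; split; [lia|lia|lia|lra].
  have dD : D <= S M1 - S m1.
    have h1 : v <= l by lia. have h2 : l <= m by lia. have h3 : m <= K by lia.
    by have := hM l m h1 h2 h3; lra.
  have [vK _ _ vmin _] := uv.
  have vM' : v < M1.
    rewrite lt_neqAle vM andbT; apply: contraTneq dD => <-.
    by have : S v <= S m1 by [apply: vmin; lia]; rewrite -ltNge; lra.
  have [h|h] : M1 <= l \/ r <= M1.
    apply: (top_of_drop w vl Mm vM) => // t vt tm.
    by have := hM t m1 vt tm mK; lra.
    have [|K1 [K2 [c u Kl' rK']]] := IH _ _ _ u2 h rK; first by lia.
    exists K1, K2; split=> //; apply: rt_trans c; exact: rt_step.
  have [|K1 [K2 [c u Kl' rK']]] := IH _ _ _ u1 Kl h; first by lia.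
  exists K1, K2; split=> //; apply: rt_trans c; exact: rt_step.
have [vr|rv] := leP v r.
  have -> := bottom_in_window w uv Kl rK lv vr.
  have e := bottom_in_window w uv Kl rK lv vr; rewrite e in uv.
  by exists K', K; split=> //; exact: rt_refl.
have [|M1 [m1 [[Km mM Mv] hM ref1 ref2 [u1 u2]]]] := left_refine uv.
  by exists m, r; split; [lia|lia|lia|lra].
have dD : D <= S M1 - S m1.
  have h1 : K' <= m by lia. have h2 : m <= r by lia. have h3 : r <= v by lia.
  by have := hM m r h1 h2 h3; lra.
have [vK _ _ vmin _] := uv.
have vM' : M1 < v.
  rewrite lt_neqAle Mv andbT; apply: contraTneq dD => ->.
  by have : S v <= S m1 by [apply: vmin; lia]; rewrite -ltNge; lra.
have [h|h] : M1 <= l \/ r <= M1.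
  apply: (top_of_rise w rv mM Mv) => // t vt tm.
  by have := hM m1 t Km vt tm; lra.
  have [|K1 [K2 [c u Kl' rK']]] := IH _ _ _ u2 h rK; first by lia.
  exists K1, K2; split=> //; apply: rt_trans c; exact: rt_step.
have [|K1 [K2 [c u Kl' rK']]] := IH _ _ _ u1 Kl h; first by lia.
exists K1, K2; split=> //; apply: rt_trans c; exact: rt_step.
Qed.

Lemma window_valley_deep S l m r K1 K2 : window S D g l m r ->
  uvalley S K1 m K2 -> K1 <= l -> r <= K2 -> deep_around0 S K1 m K2.
Proof.
move=> w uv Kl rK; have [mK h1 h2 h3 h4] := uv.
have lm := window_lm w; have mr := window_mr w.
have hl : S l <= S K1 by apply: h1; lia.
have hr : S r <= S K2 by apply: h2; lia.
have Sl := window_Sl w; have Sr := window_Sr w.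
split=> //.
- by have := window_l0 w; have := window_0r w; lia.
- by split; lra.
- by move=> m0 t mt t0; have := window_right_margin w m0 mt t0; lra.
- by move=> m0 t mt t0; have := window_left_margin w m0 mt t0; lra.
Qed.

Lemma window_uvalley S l m r : window S D g l m r -> uvalley S l m r.
Proof.
have D0' := D0; have g0' := g0.
move=> w; have lm := window_lm w; have mr := window_mr w.
have Sl := window_Sl w; have Sr := window_Sr w.
split.
- by lia.
- move=> t /andP[]; rewrite le_eqVlt => /orP[/eqP <- //|lt] tm.
  have [m0|m0] := leP 0 m; first by apply/ltW/(window_lt_left w) => //; lia.
  have [->|tm'] : t = m \/ t < m by lia.
    by lra.
  have t0 : t <= 0 by lia.
  by have [h|[]] := window_left_first w lt t0 tm'; [lra|lia].
- move=> t /andP[mt]; rewrite le_eqVlt => /orP[/eqP -> //|tr].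
  have [m0|m0] := leP m 0; first by apply/ltW/(window_lt_right w) => //; lia.
  have [->|tm'] : t = m \/ m < t by lia.
    by lra.
  have t0 : 0 <= t by lia.
  by have [h|[]] := window_right_first w t0 tr tm'; [lra|lia].
- move=> t /andP[lt tr]; have [->//|tm] := eqVneq t m.
  by have [h|[->]] := window_min w lt tr tm; first exact: ltW.
- move=> t /andP[lt tr] e; have [->//|tm] := eqVneq t m.
  by have [h|[_ /ltW]] := window_min w lt tr tm; first by move: h; rewrite e ltxx.
Qed.

(** Otherwise the valley contains the window and refines to a valley with bottom m, which is still
    deep and around 0, against minimality. *)
Lemma smallest_bottom S l m r K' v K : window S D g l m r ->
  deep_around0 S K' v K ->
  (forall L v' L', clos_trans _ (refinement S) (Triplet K' v K) (Triplet L v' L') ->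
     ~ deep_around0 S L v' L') -> v = m.
Proof.
move=> w dV hV; have [//|[Kl rK]] := deep_bottom w dV.
have [uv _ _ _ _] := dV.
have [K1 [K2 [c u Kl' rK']]] := refine_to_window w uv Kl rK (leqnn _).
have dV' := window_valley_deep w u Kl' rK'.
suff : clos_trans _ (refinement S) (Triplet K' v K) (Triplet K1 m K2) \/ v = m.
  by move=> [/hV/(_ dV')|].
clear -c; move: c; set x := Triplet K' v K; set y := Triplet K1 m K2 => c.
have : x = y \/ clos_trans _ (refinement S) x y.
  elim: c => [p q pq|p|p q s _ [->|pq] _ [<-|qs]]; [right|left|left|right|right|right] => //.
  - exact: t_step.
  - exact: t_trans qs.
by move=> [[]|]; [right|left].
Qed.

Definition ordered (V : triplet) : Prop :=
  left_top V <= Defs.bottom V /\ Defs.bottom V <= right_top V.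

Definition span (V : triplet) : nat := `|right_top V - left_top V|%N.

Lemma refinement_span (S : int -> R) V V' : refinement S V V' -> ordered V ->
  ordered V' /\ (span V' <= span V)%N.
Proof.
case: V V' => l m r [l' m' r'] [] [M1 [m1 [[[u e1] _] [[h1 h2 h3 h4] _] [|] [-> -> ->]]]];
  rewrite /ordered /span /= => -[lm mr]; split; lia.
Qed.

(** When the bottom is an endpoint, a refinement may keep both ends of the valley and only move the
    bottom; with an interior bottom it shrinks. *)
Lemma refinement_span_lt (S : int -> R) V V' : refinement S V V' ->
  left_top V < Defs.bottom V -> Defs.bottom V < right_top V -> (span V' < span V)%N.
Proof.
case: V V' => l m r [l' m' r'] [] [M1 [m1 [[[u e1] _] [[h1 h2 h3 h4] _] [|] [-> -> ->]]]];
  rewrite /span /= => lm mr; lia.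
Qed.

Lemma clos_trans_span (S : int -> R) V V' : clos_trans _ (refinement S) V V' ->
  left_top V < Defs.bottom V -> Defs.bottom V < right_top V -> (span V' < span V)%N.
Proof.
have le x y : clos_trans _ (refinement S) x y -> ordered x ->
    ordered y /\ (span y <= span x)%N.
  elim=> [p q pq o|p q s _ IH1 _ IH2 o]; first exact: refinement_span pq o.
  by have [w1 h1] := IH1 o; have [w2 h2] := IH2 w1; split=> //; exact: leq_trans h1.
elim=> [p q h1 h2 h3|p q s pq IH1 qs IH2 h1 h2]; first exact: refinement_span_lt h1 h2 h3.
have [w h] := le _ _ pq (conj (ltW h1) (ltW h2)).
have [_ h3] := le _ _ qs w.
exact: leq_ltn_trans h3 (IH1 h1 h2).
Qed.

End Window.

(** * Existence and uniqueness of the basic valley *)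

Section BasicValley.
Context {R : realType}.
Variables (S : int -> R) (gamma : R) (n : nat).
Let D := Gamma gamma n.
Let g := gamma * ilog 2 n.
Hypotheses (D0 : 0 < D) (g0 : 0 < g).

Lemma deepP l m r :
  deep_valley_around0 S gamma n (Triplet l m r) <-> deep_around0 D g S l m r.
Proof.
rewrite /deep_valley_around0 /deep_around0.
split=> [[/is_valleyP uv l0 hd h1 h2]|[uv l0 [hd1 hd2] h1 h2]].
  have [/andP[lm mr] _ _ _ _] := uv.
  move: hd; rewrite le_min => /andP[hd1 hd2]; split=> //.
  - by rewrite -/D in hd1 hd2; split; lra.
  - move=> m0 t mt t0; have := h1 m0; rewrite -/g => h.
    have : maxS S m 0 <= S r - g by lra.
    move/(maxS_le_iff _ _ (ltW m0)) => /(_ t); rewrite mt t0 => /(_ isT); lra.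
  - move=> m0 t mt t0; have := h2 m0; rewrite -/g => h.
    have : maxS S 0 m <= S l - g by lra.
    move/(maxS_le_iff _ _ (ltW m0)) => /(_ t); rewrite mt t0 => /(_ isT); lra.
split=> //; first exact/is_valleyP.
- by rewrite le_min -/D; apply/andP; split; lra.
- move=> m0; rewrite -/g; suff : maxS S m 0 <= S r - g by lra.
  apply/(maxS_le_iff _ _ (ltW m0)) => t /andP[mt t0].
  by have := h1 m0 t mt t0; lra.
- move=> m0; rewrite -/g; suff : maxS S 0 m <= S l - g by lra.
  apply/(maxS_le_iff _ _ (ltW m0)) => t /andP[mt t0].
  by have := h2 m0 t mt t0; lra.
Qed.

Lemma window_is_sup l m r : window S D g l m r ->
  is_int_sup [set k | [/\ k <= 0, k < m, Gamma gamma n <= S k - S m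
        & 0 < m -> gamma * ilog 2 n <= S k - maxS S 0 m]] l.
Proof.
move=> w; split=> /=.
  split; [exact: window_l0 w|exact: window_lm w| |].
    by have := window_Sl w; rewrite -/D; lra.
  move=> m0; rewrite -/g; suff : maxS S 0 m <= S l - g by lra.
  apply/(maxS_le_iff _ _ (ltW m0)) => t /andP[t0 tm].
  by have := window_left_margin w m0 t0 tm; lra.
move=> k [k0 km hk hm]; rewrite leNgt; apply/negP => lk.
rewrite -/D -/g in hk hm.
have [h|[m0 [s [s0 sm hs]]]] := window_left_first w lk k0 km; first by (move: h hk; rewrite -/D; clear; lra).
have : maxS S 0 m <= S k - g by have := hm m0; lra.
move/(maxS_le_iff _ _ (ltW m0)) => /(_ s); rewrite s0 sm => /(_ isT); lra.
Qed.

Lemma window_is_inf l m r : window S D g l m r ->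
  is_int_inf [set k | [/\ 0 <= k, m < k, Gamma gamma n <= S k - S m
        & m < 0 -> gamma * ilog 2 n <= S k - maxS S m 0]] r.
Proof.
move=> w; split=> /=.
  split; [exact: window_0r w|exact: window_mr w| |].
    by have := window_Sr w; rewrite -/D; lra.
  move=> m0; rewrite -/g; suff : maxS S m 0 <= S r - g by lra.
  apply/(maxS_le_iff _ _ (ltW m0)) => t /andP[t0 tm].
  by have := window_right_margin w m0 t0 tm; lra.
move=> k [k0 km hk hm]; rewrite leNgt; apply/negP => lk.
rewrite -/D -/g in hk hm.
have [h|[m0 [s [s0 sm hs]]]] := window_right_first w k0 lk km; first by (move: h hk; rewrite -/D; clear; lra).
have : maxS S m 0 <= S k - g by have := hm m0; lra.
move/(maxS_le_iff _ _ (ltW m0)) => /(_ s); rewrite s0 sm => /(_ isT); lra.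
Qed.

(** The ends of the smallest deep valley are irrelevant: the basic valley depends on it only through
    its bottom, which [smallest_bottom] identifies. *)
Lemma basic_valley_window l m r K' v K : window S D g l m r ->
  basic_valley S gamma n (Triplet K' v K) -> [/\ K' = l, v = m & K = r].
Proof.
move=> w [[L [L' [/deepP dV hV]]] [s1 s2] [i1 i2]].
have vm : v = m.
  apply: (smallest_bottom D0 g0 w dV) => L1 v' L2 c /deepP; exact: hV c.
rewrite vm in s1 s2 i1 i2; have [s1' s2'] := window_is_sup w.
have [i1' i2'] := window_is_inf w.
split=> //; apply/eqP; rewrite eq_le.
  by rewrite s2'//= s2.
by rewrite i2//= i2'.
Qed.

(** The window is itself a deep valley around 0; passing to iterated refinements that are still deep
    must stop because widths strictly decrease. The smallest valley obtained need not be known, only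
    its bottom. *)
Lemma window_basic_valley l m r : window S D g l m r ->
  basic_valley S gamma n (Triplet l m r).
Proof.
move=> w; split; [|exact: (window_is_sup w)|exact: (window_is_inf w)].
have d0 : deep_around0 D g S l m r.
  exact: (window_valley_deep D0 g0 w (window_uvalley D0 g0 w) (lexx _) (lexx _)).
suff H k : forall L v L', deep_around0 D g S L v L' -> (`|L' - L| <= k)%N ->
    exists K' v' K, (deep_around0 D g S K' v' K /\
       forall V', clos_trans _ (refinement S) (Triplet K' v' K) V' ->
         ~ deep_valley_around0 S gamma n V').
  have [K' [v' [K [dK hK]]]] := H _ _ _ _ d0 (leqnn _).
  have vm : v' = m.
    by apply: (smallest_bottom D0 g0 w dK) => L1 v'' L2 c /deepP; exact: hK c.
  by exists K', K; rewrite -vm; split=> //; exact/deepP.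
elim: k => [|k IH] L v L' dL len.
  exfalso; have [[/andP[h1 h2] _ _ _ _] _ [h3 _] _ _] := dL.
  have D0' := D0; have e : L = v by lia.
  by move: h3; rewrite e; lra.
have [h|] := pselect (forall V', clos_trans _ (refinement S) (Triplet L v L') V' ->
         ~ deep_valley_around0 S gamma n V').
  by exists L, v, L'.
move/existsNP => [[L1 v1 L2] /not_implyP[c /contrapT/deepP d1]].
apply: (IH _ _ _ d1).
have D0' := D0; have [[/andP[h1 h2] _ _ _ _] _ [h3 h4] _ _] := dL.
have lt1 : L < v.
  by rewrite lt_neqAle h1 andbT; apply: contraTneq h3 => ->; rewrite -ltNge; lra.
have lt2 : v < L'.
  by rewrite lt_neqAle h2 andbT; apply: contraTneq h4 => ->; rewrite -ltNge; lra.
have := clos_trans_span D0 g0 c lt1 lt2; rewrite /span /=; lia.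
Qed.

End BasicValley.

(* r is the first time at which f has risen by D above its running minimum,
   and m is the time of that minimum. *)
Definition first_rise {R : realType} (f : nat -> R) (D : R) (m r : nat) : Prop :=
  [/\ (m <= r)%N, forall j, (j < m)%N -> f m < f j, forall j, (j <= r)%N -> f m <= f j,
      f m + D <= f r
    & forall i j, (i <= j)%N -> (j < r)%N -> f j - f i < D].

(** The two kinds of adverse slope for a walk heading to m: rises between 0 and m, falls between m
    and r. *)
Definition clean_rise {R : realType} (f : nat -> R) (D : R) (m r : nat) : Prop :=
  (forall i j, (i <= j)%N -> (j <= m)%N -> f j - f i < D) /\
  (forall i j, (m <= i)%N -> (i <= j)%N -> (j <= r)%N -> f i - f j < D).

Lemma first_rise_unique {R : realType} (f : nat -> R) (D : R) m r m' r' :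
  0 < D -> first_rise f D m r -> first_rise f D m' r' -> m = m' /\ r = r'.
Proof.
move=> D0 [mr h1 h2 h3 h4] [mr' h1' h2' h3' h4'].
have rr : r = r'.
  apply/eqP; rewrite eqn_leq; apply/andP; split; rewrite leqNgt; apply/negP => lt.
    by have := h4 _ _ mr' lt; lra.
  by have := h4' _ _ mr lt; lra.
split=> //; subst r'; have [lt|lt|//] := ltngtP m m'; exfalso.
  by have := h1' _ lt; have := h2 _ mr'; lra.
by have := h1 _ lt; have := h2' _ mr; lra.
Qed.

Lemma first_time (P : nat -> Prop) n : P n -> exists2 k, (k <= n)%N /\ P k &
  forall j, (j < k)%N -> ~ P j.
Proof.
move=> Pn; have ex : exists k, `[< P k >] by exists n; apply/asboolP.
case: (ex_minnP ex) => k /asboolP Pk hk; exists k.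
  by split=> //; apply: hk; apply/asboolP.
by move=> j jk /asboolP/hk; lia.
Qed.

Lemma int_split (t : int) : (exists k : nat, t = k%:Z) \/
  (exists k : nat, t = - k%:Z /\ (0 < k)%N).
Proof.
have [t0|t0] := leP 0 t; [left|right]; exists `|t|%N; lia.
Qed.

(** * Which half-line contains the bottom of the valley *)

Section TwoPaths.
Context {R : realType}.
Variables (D D' g : R).
Hypotheses (g0 : 0 < g) (D'0 : 0 < D') (D'D : D' + g <= D).

Definition clean_window (S : int -> R) (N : nat) : Prop :=
  exists l m r, [/\ window S D g l m r,
    forall i j, l <= i -> i <= j -> j <= m -> S j - S i < D',
    forall i j, m <= i -> i <= j -> j <= r -> S i - S j < D'
  & - N%:Z <= l /\ r <= N%:Z].

Lemma clean_window_reflect (S : int -> R) N : clean_window (fun t => S (- t)) N -> clean_window S N.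
Proof.
have D'0' := D'0; have D'D' := D'D; have g0' := g0.
have D0 : 0 < D by lra.
move=> [l [m [r [w h1 h2 [h3 h4]]]]].
exists (- r), (- m), (- l); split.
- have := window_reflect D0 g0' w; rewrite (_ : (fun t => S (- - t)) = S)//.
  by apply/funext => t; rewrite opprK.
- by move=> i j *; have := h2 (- j) (- i); rewrite !opprK; apply; lia.
- by move=> i j *; have := h1 (- j) (- i); rewrite !opprK; apply; lia.
- by lia.
Qed.

Section Paths.
Variables (S : int -> R) (fR fL : nat -> R) (mR rR mL rL N : nat) (a b : R).
Hypothesis SR : forall k : nat, S k%:Z = fR k.
Hypothesis SL : forall k : nat, S (- k%:Z) = fL k.
Hypotheses (pR : first_rise fR D mR rR) (cR : clean_rise fR D' mR rR).
Hypotheses (pL : first_rise fL D mL rL) (cL : clean_rise fL D' mL rL).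
Hypothesis aR : exists2 i, (i <= mR)%N & fR i = a.
Hypothesis aM : forall i, (i <= mR)%N -> fR i <= a.
Hypothesis bL : exists2 i, (i <= mL)%N & fL i = b.
Hypothesis bM : forall i, (i <= mL)%N -> fL i <= b.
Hypotheses (rRN : (rR <= N)%N) (rLN : (rL <= N)%N).

(** The window with its bottom on the right: its left end is the first point of the left path that
    is both D above the bottom and g above the barrier a between 0 and the bottom. *)
Lemma windowR k0 : (0 < k0)%N -> (k0 <= rL)%N ->
  fR mR + D <= fL k0 -> a + g <= fL k0 ->
  (forall k, (k < k0)%N -> fL k < fR mR + D \/ fL k < a + g) ->
  (forall k, (k <= k0)%N -> fR mR < fL k) ->
  (forall k' k, (k' <= k)%N -> (k <= k0)%N -> fL k' - fL k < D') ->
  (forall k, (k <= k0)%N -> a - fL k < D') ->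
  clean_window S N.
Proof.
have D'0' := D'0; have D'D' := D'D; have g0' := g0.
move=> k00 k0r h1 h2 h3 h4 h5 h6; have [mr p1 p2 p3 p4] := pR; have [c1 c2] := cR.
have mr' : (mR < rR)%N.
  by rewrite ltn_neqAle mr andbT; apply/eqP => e; move: p3; rewrite e; lra.
have rise i j : - k0%:Z <= i -> i <= j -> j <= mR%:Z -> S j - S i < D'.
  move=> li ij jm.
  have [[i' ei]|[i' [ei i0]]] := int_split i; have [[j' ej]|[j' [ej j0]]] := int_split j;
    rewrite {}ei {}ej ?SR ?SL in li ij jm *.
  - by apply: c1; lia.
  - by exfalso; lia.
  - have : fR j' <= a by [apply: aM; lia]. have : a - fL i' < D' by [apply: h6; lia]. lra.
  - by apply: h5; lia.
have drop i j : mR%:Z <= i -> i <= j -> j <= rR%:Z -> S i - S j < D'.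
  move=> mi ij jr.
  have [[i' ei]|[i' [ei i0]]] := int_split i; last by lia.
  have [[j' ej]|[j' [ej j0]]] := int_split j; last by lia.
  by rewrite {}ei {}ej !SR in mi ij jr *; apply: c2; lia.
exists (- k0%:Z), mR%:Z, rR%:Z; split=> //; last by lia.
split; rewrite ?SR ?SL//; try lia.
- move=> t lt tr tm; have [[k ek]|[k [ek kk]]] := int_split t;
    rewrite {}ek ?SR ?SL in lt tr tm *.
    have [km|km|km] := ltngtP k mR; last by move: tm; rewrite km eqxx.
      by left; exact: p1.
    have := p2 k _; rewrite le_eqVlt => /(_ ltac:(lia)) /orP[/eqP e|]; last by left.
    by right; split=> //; lia.
  by left; apply: h4; lia.
- move=> m0 t t0 tm; have [[k ek]|[k [ek kk]]] := int_split t; last by lia.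
  by rewrite {}ek SR in t0 tm *; have := aM (_ : (k <= mR)%N); move=> /(_ ltac:(lia)); lra.
- move=> t lt t0 tm; have [[k ek]|[k [ek kk]]] := int_split t.
    have k0' : k = 0%N by lia.
    have e0 : fR 0 = fL 0 by rewrite -SR -SL.
    rewrite {}ek k0' SR e0 in lt t0 tm *.
    case: (h3 0%N) => //; [by left|].
    move=> h; right; have [i im ei] := aR; split; first by lia.
    by exists i%:Z; rewrite SR ei; split; lia || exact: h.
  rewrite {}ek SL in lt t0 tm *.
  case: (h3 k); [lia|by left|] => h.
  have [m0|m0] : mR = 0%N \/ (0 < mR)%N by lia.
    left; have [i im ei] := aR; have i0 : i = 0%N by lia.
    by rewrite m0 -i0 ei; lra.
  right; have [i im ei] := aR; split; first by lia.
  by exists i%:Z; rewrite SR ei; split; lia || exact: h.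
- move=> t t0 tr mt; have [[k ek]|[k [ek kk]]] := int_split t; last by lia.
  rewrite {}ek SR in t0 tr mt *; left.
  by have := p4 mR k; move=> /(_ ltac:(lia) ltac:(lia)); lra.
- by move=> i j *; have := rise i j; move=> /(_ ltac:(lia) ltac:(lia) ltac:(lia)); lra.
- by move=> i j *; have := drop i j; move=> /(_ ltac:(lia) ltac:(lia) ltac:(lia)); lra.
Qed.

End Paths.

Section Choice.
Variables (S : int -> R) (fR fL : nat -> R) (mR rR mL rL N : nat) (a b : R).
Hypothesis SR : forall k : nat, S k%:Z = fR k.
Hypothesis SL : forall k : nat, S (- k%:Z) = fL k.
Hypotheses (pR : first_rise fR D mR rR) (cR : clean_rise fR D' mR rR).
Hypotheses (pL : first_rise fL D mL rL) (cL : clean_rise fL D' mL rL).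
Hypothesis aR : exists2 i, (i <= mR)%N & fR i = a.
Hypothesis aM : forall i, (i <= mR)%N -> fR i <= a.
Hypothesis bL : exists2 i, (i <= mL)%N & fL i = b.
Hypothesis bM : forall i, (i <= mL)%N -> fL i <= b.
Hypotheses (rRN : (rR <= N)%N) (rLN : (rL <= N)%N).
Hypothesis tie_max : D - g <= a - fR mR -> b < a + g -> a < b + g -> False.
Hypothesis tie_level : D' <= b - fR mR -> b - fR mR < D -> False.
Hypothesis tie_min : fR mR <> fL mL.

(** If the higher barrier b is at least D above the right minimum, the valley closes on the left
    before b and the bottom is on the right. If not, the two wells communicate below the required
    depth and the deeper one contains the bottom. The three ties are the configurations in which
    these alternatives lack the margins g and D - D'. *)
Lemma path_window : a <= b -> clean_window S N.
Proof.
have D'0' := D'0; have D'D' := D'D; have g0' := g0.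
move=> ab; have e0 : fR 0 = fL 0 by rewrite -SR -SL.
have [mr p1 p2 p3 p4] := pR; have [c1 c2] := cR.
have [mr' p1' p2' p3' p4'] := pL; have [c1' c2'] := cL.
have a0 : fR 0 <= a by exact: aM.
have b0 : fL 0 <= b by exact: bM.
have [hi|lo] := lerP (fR mR + D) b.
  (* Otherwise a is within g of b, hence more than D - g above the right minimum: this is the first
     tie. *)
  have abg : a + g <= b by rewrite leNgt; apply/negP => h; apply: tie_max; lra.
  have [i im ei] := bL.
  have [|k0 [k0i [hk1 hk2]] hk] := @first_time (fun k => fR mR + D <= fL k /\ a + g <= fL k) i.
    by rewrite ei.
  have lt k : (k < k0)%N -> fL k < fR mR + D \/ fL k < a + g.
    move=> /hk h; have [h1|] := lerP (fR mR + D) (fL k); last by left.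
    by have [h2|] := lerP (a + g) (fL k); [case: h|right].
  have lt0 k : (k < k0)%N -> fL k < fL k0 by move=> /lt []; lra.
  have rise k : (k <= k0)%N -> fL k0 - fL k < D' by move=> kk; exact: (c1' _ _ kk (leq_trans k0i im)).
  have k00 : (0 < k0)%N.
    by rewrite lt0n; apply/eqP => e; rewrite e in hk2; lra.
  apply: (windowR SR SL pR cR aR aM rRN rLN k00) => //.
  - exact: leq_trans k0i (leq_trans im mr').
  - by move=> k /rise; lra.
  - move=> k' k kk kk0; have [e|lt1] : k' = k \/ (k' < k0)%N.
      by move: kk; rewrite leq_eqVlt => /orP[/eqP|lt1]; [left|right; exact: leq_trans kk0].
      by rewrite e subrr.
    by have := lt0 _ lt1; have := rise _ kk0; lra.
  - by move=> k /rise; lra.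
have {lo}lo : b < fR mR + D'.
  by rewrite ltNge; apply/negP => h; apply: tie_level; lra.
have [lt|lt|//] := ltgtP (fR mR) (fL mL).
  (* Both conditions hold at rL: fL rL >= fL mL + D > fR mR + D, and a <= b < fR mR + D' leaves room
     for g. *)
  have [|k0 [k0i [hk1 hk2]] hk] := @first_time (fun k => fR mR + D <= fL k /\ a + g <= fL k) rL.
    by split; lra.
  have k00 : (0 < k0)%N.
    by rewrite lt0n; apply/eqP => e; rewrite e in hk2; lra.
  have low k : (k <= k0)%N -> fR mR < fL k.
    by move=> kk; have := p2' k (leq_trans kk k0i); lra.
  apply: (windowR SR SL pR cR aR aM rRN rLN k00) => //.
  - move=> k /hk h; have [h1|] := lerP (fR mR + D) (fL k); last by left.
    by have [h2|] := lerP (a + g) (fL k); [case: h|right].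
  - move=> k' k kk kk0; have [km|km] := leqP k' mL.
      by have := bM km; have := low _ kk0; lra.
    exact: (c2' _ _ (ltnW km) kk (leq_trans kk0 k0i)).
  - by move=> k /low; lra.
apply: clean_window_reflect.
have [|k0 [k0i [hk1 hk2]] hk] := @first_time (fun k => fL mL + D <= fR k /\ b + g <= fR k) rR.
  by split; lra.
have k00 : (0 < k0)%N.
  by rewrite lt0n; apply/eqP => e; rewrite e in hk2; lra.
have low k : (k <= k0)%N -> fR mR <= fR k.
  by move=> kk; have := p2 k (leq_trans kk k0i); lra.
have SR' (k : nat) : S (- - k%:Z) = fR k by rewrite opprK SR.
apply: (@windowR (fun t => S (- t)) fL fR mL rL rR N b SL SR' pL cL bL bM rLN rRN k0 k00) => //.
- move=> k /hk h; have [h1|] := lerP (fL mL + D) (fR k); last by left.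
  by have [h2|] := lerP (b + g) (fR k); [case: h|right].
- by move=> k /low; lra.
- move=> k' k kk kk0; have [km|km] := leqP k' mR.
    by have := aM km; have := low _ kk0; lra.
  exact: (c2 _ _ (ltnW km) kk (leq_trans kk0 k0i)).
- by move=> k /low; lra.
Qed.

End Choice.

End TwoPaths.

(** * The potential on the two half-lines *)

Ltac nat_lia :=
  repeat match goal with
  | H : ?P |- _ =>
    lazymatch P with
    | is_true (leq _ _) => fail
    | nat => fail
    | @eq nat _ _ => fail
    | _ => clear H
    end
  end; lia.

(** * Bets on one half-line when the other is known *)

Section TwoSidedExploration.
Context {R : realType} d (T : measurableType d) (Q : probability T R).
Variables (Z : nat -> T -> R) (C s2 : R) (N : nat).
Hypothesis mZ : forall i, measurable_fun setT (Z i).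
Hypothesis indepZ : forall n (B : nat -> set R), (forall i, measurable (B i)) ->
  Q (\bigcap_(i in `I_n) Z i @^-1` B i) = (\prod_(i < n) Q (Z i @^-1` B i))%E.
Hypothesis ZC : forall i w, `|Z i w| <= C.
Hypothesis Z0 : forall i, mean Q (Z i) = 0.
Hypothesis s20 : 0 < s2.
Hypothesis Zvar : forall i, mean Q (fun w => Z i w ^+ 2) = s2.

Variables (L D D' g b0 : R).
Hypotheses (g0 : 0 < g) (L0 : 0 < L) (D'D : D' < D) (LD' : L / 2 <= D')
  (DD' : D - D' + L / 2 <= D') (gD : 3 * g < D) (D2 : 2 < D) (Db : D <= b0).

(* U and V are the potential on the two half-lines. As U is explored first, it
   is known when the bets on V are placed. *)
Definition pathU (w : T) (k : nat) : R := increment Z 0 k w.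
Definition pathV (w : T) (k : nat) : R := increment Z N (N + k) w.

Lemma pathV_diff w i k : (i <= k)%N ->
  increment Z (N + i) (N + k) w = pathV w k - pathV w i.
Proof.
move=> ik; rewrite /pathV /increment (@big_cat_nat _ _ _ (N + i)%N N (N + k)%N)/=; try nat_lia.
by rewrite addrC addrK.
Qed.

(** V starts at index N. A signal at its time k opens the bet at index N + k, when all of U up to N
    is known. *)
Definition late (P : T -> nat -> Prop) (i : nat) : set T :=
  [set w | (N <= i)%N /\ P w (i - N)%N].

Definition rises_from_min (w : T) (k : nat) : Prop :=
  exists i, (i <= k)%N /\ D' <= pathV w k - pathV w i.

Definition profileU (w : T) (m r : nat) : Prop :=
  (r <= N)%N /\ first_rise (pathU w) D m r.

Definition near_top (w : T) (k : nat) : Prop :=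
  exists m r, profileU w m r /\ forall j, (j <= m)%N -> pathU w j - g <= pathV w k.

Definition under_top (w : T) (k : nat) : Prop :=
  exists m r, profileU w m r /\ exists j, (j <= m)%N /\ pathV w k <= pathU w j - D'.

Definition near_bottom (w : T) (k : nat) : Prop :=
  exists m r, profileU w m r /\ pathV w k <= pathU w m + 1.

(* The first four bets are placed at the first time of a near tie; each is
   ruined when V then makes a move of order D in one direction before a much
   shorter move in the other direction, which would resolve the tie. *)
Definition bad_fall := ruined Z 1 (D - D') (L / 2) (late rises_from_min) (N + N).
Definition bad_top := ruined Z 1 (2 * g) (D - 3 * g) (late near_top) (N + N).
Definition bad_level := ruined Z (-1) (D - D') D' (late under_top) (N + N).
Definition bad_bottom := ruined Z (-1) 2 (D - 1) (late near_bottom) (N + N).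
Definition bad_descent := ruined Z 1 D b0 (late (fun _ _ => True)) (N + N).
Definition bad_slow := confined Z N b0 N.

Definition bad : set T := bad_fall `|` bad_top `|` bad_level `|` bad_bottom
  `|` bad_descent `|` bad_slow.

Lemma adapted_pathV n k : (N + k <= n)%N -> adapted Z n (pathV^~ k).
Proof. exact: adapted_increment. Qed.

Lemma adapted_pathU n k : (k <= n)%N -> adapted Z n (pathU^~ k).
Proof. exact: adapted_increment. Qed.

Lemma past_late P : (forall i, (N <= i)%N -> past Z i [set w | P w (i - N)%N]) ->
  forall i, past Z i (late P i).
Proof. by move=> h i; apply: past_and_const; exact: h. Qed.

Lemma past_profileU n m r : (N <= n)%N -> past Z n [set w | profileU w m r].
Proof.
move=> Nn; apply: past_and_const => rN.
rewrite (_ : [set w | _] = [set w | (m <= r)%N /\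
  ((forall j, (j < m)%N -> pathU w m < pathU w j) /\
  ((forall j, (j <= r)%N -> pathU w m <= pathU w j) /\
   (pathU w m + D <= pathU w r /\
    forall i, forall j, (i <= j)%N -> (j < r)%N -> pathU w j - pathU w i < D)))]);
  last first.
  by apply/seteqP; split=> w /= => [[]|[? [? [? [? ?]]]]].
apply: past_and_const => mr; apply: past_and.
  apply: past_forall => j; apply: past_imp => jm.
  by apply: adapted_lt; apply: adapted_pathU; nat_lia.
apply: past_and.
  apply: past_forall => j; apply: past_imp => jm.
  by apply: adapted_le; apply: adapted_pathU; nat_lia.
apply: past_and.
  apply: adapted_le; last by apply: adapted_pathU; nat_lia.
  by apply: adaptedD; [apply: adapted_pathU; nat_lia|exact: adapted_cst].
apply: past_forall => i; apply: past_forall => j.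
apply: past_imp => ij; apply: past_imp => jr.
apply: adapted_lt; last exact: adapted_cst.
by apply: adaptedB; apply: adapted_pathU; nat_lia.
Qed.

Lemma past_rises i : past Z i (late rises_from_min i).
Proof.
apply: past_late => {}i Ni; apply: past_exists => j; apply: past_and_const => ji.
apply: adapted_le; first exact: adapted_cst.
by apply: adaptedB; apply: adapted_pathV; nat_lia.
Qed.

Lemma past_near_top i : past Z i (late near_top i).
Proof.
apply: past_late => {}i Ni; apply: past_exists => m; apply: past_exists => r.
rewrite (_ : [set w | _] = [set w | (m <= N)%N /\ (profileU w m r /\
    forall j, (j <= m)%N -> pathU w j - g <= pathV w (i - N)%N)]); last first.
  apply/seteqP; split=> w /= => [[p h]|[_ [p h]]]; split=> //.
  by case: p => rN [mr _ _ _ _]; nat_lia.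
apply: past_and_const => mN; apply: past_and; first exact: past_profileU.
apply: past_forall => j; apply: past_imp => jm.
apply: adapted_le; last by apply: adapted_pathV; nat_lia.
by apply: adaptedB; [apply: adapted_pathU; nat_lia|exact: adapted_cst].
Qed.

Lemma past_under_top i : past Z i (late under_top i).
Proof.
apply: past_late => {}i Ni; apply: past_exists => m; apply: past_exists => r.
rewrite (_ : [set w | _] = [set w | (m <= N)%N /\ (profileU w m r /\
    exists j, (j <= m)%N /\ pathV w (i - N)%N <= pathU w j - D')]); last first.
  apply/seteqP; split=> w /= => [[p h]|[_ [p h]]]; split=> //.
  by case: p => rN [mr _ _ _ _]; nat_lia.
apply: past_and_const => mN; apply: past_and; first exact: past_profileU.
apply: past_exists => j; apply: past_and_const => jm.
apply: adapted_le; first by apply: adapted_pathV; nat_lia.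
by apply: adaptedB; [apply: adapted_pathU; nat_lia|exact: adapted_cst].
Qed.

Lemma past_near_bottom i : past Z i (late near_bottom i).
Proof.
apply: past_late => {}i Ni; apply: past_exists => m; apply: past_exists => r.
rewrite (_ : [set w | _] = [set w | (m <= N)%N /\ (profileU w m r /\
    pathV w (i - N)%N <= pathU w m + 1)]); last first.
  apply/seteqP; split=> w /= => [[p h]|[_ [p h]]]; split=> //.
  by case: p => rN [mr _ _ _ _]; nat_lia.
apply: past_and_const => mN; apply: past_and; first exact: past_profileU.
apply: adapted_le; first by apply: adapted_pathV; nat_lia.
by apply: adaptedD; [apply: adapted_pathU; nat_lia|exact: adapted_cst].
Qed.

Lemma past_true i : past Z i (late (fun _ _ => True) i).
Proof. by apply: past_late => {}i _; exact: past_const. Qed.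

Lemma measurable_ruined s u v A : 0 < u -> 0 < v -> (forall i, past Z i (A i)) ->
  measurable (ruined Z s u v A (N + N)).
Proof.
move=> u0 v0 pA; apply: (@past_measurable _ _ _ Z mZ (N + N)).
exact: (past_ruined s u0 v0 pA).
Qed.

Lemma measurable_bads : [/\ measurable bad_fall, measurable bad_top,
  measurable bad_level, measurable bad_bottom & measurable bad_descent] /\
  measurable bad_slow.
Proof.
have D'D0 := D'D; have L00 := L0; have LD0 := LD'; have g00 := g0; have gD0 := gD.
have D20 := D2; have Db0 := Db.
split; last by apply: (@past_measurable _ _ _ Z mZ (N + N)); exact: past_confined.
by split; apply: measurable_ruined; try lra; [exact: past_rises|exact: past_near_top|
  exact: past_under_top|exact: past_near_bottom|exact: past_true].
Qed.

Lemma measurable_bad : measurable bad.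
Proof.
have [[m1 m2 m3 m4 m5] m6] := measurable_bads.
by rewrite /bad; do 5! apply: measurableU => //.
Qed.

Lemma bad_probability :
  (Q bad <= ((D - D' + C) / (L / 2) + (2 * g + C) / (D - 3 * g) + (D - D' + C) / D'
    + (2 + C) / (D - 1) + (D + C) / b0 + (b0 + C) ^+ 2 / (s2 * N.+1%:R))%:E)%E.
Proof.
have D'D0 := D'D; have L00 := L0; have LD0 := LD'; have g00 := g0; have gD0 := gD.
have D20 := D2; have Db0 := Db.
have [[m1 m2 m3 m4 m5] m6] := measurable_bads.
have n1 : `|1 : R| = 1 by rewrite normr1.
have n2 : `|-1 : R| = 1 by rewrite normrN1.
have U A B x y : measurable A -> measurable B -> (Q A <= x%:E)%E -> (Q B <= y%:E)%E ->
    (Q (A `|` B) <= (x + y)%:E)%E.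
  move=> mA mB hA hB; apply: (@le_trans _ _ (Q A + Q B)%E); first exact: measureU2.
  by rewrite EFinD leeD.
have h1 : (Q bad_fall <= ((D - D' + C) / (L / 2))%:E)%E.
  by apply: (ruin_probability mZ indepZ ZC Z0) => //; [lra|lra|exact: past_rises].
have h2 : (Q bad_top <= ((2 * g + C) / (D - 3 * g))%:E)%E.
  by apply: (ruin_probability mZ indepZ ZC Z0) => //; [lra|lra|exact: past_near_top].
have h3 : (Q bad_level <= ((D - D' + C) / D')%:E)%E.
  by apply: (ruin_probability mZ indepZ ZC Z0) => //; [lra|lra|exact: past_under_top].
have h4 : (Q bad_bottom <= ((2 + C) / (D - 1))%:E)%E.
  by apply: (ruin_probability mZ indepZ ZC Z0) => //; [lra|exact: past_near_bottom].
have h5 : (Q bad_descent <= ((D + C) / b0)%:E)%E.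
  by apply: (ruin_probability mZ indepZ ZC Z0) => //; [lra|lra|exact: past_true].
have h6 : (Q bad_slow <= ((b0 + C) ^+ 2 / (s2 * N.+1%:R))%:E)%E.
  by apply: (confined_probability mZ indepZ ZC Z0) => //; lra.
have m12 := measurableU _ _ m1 m2; have m123 := measurableU _ _ m12 m3.
have m1234 := measurableU _ _ m123 m4; have m12345 := measurableU _ _ m1234 m5.
exact: (U _ _ _ _ m12345 m6 (U _ _ _ _ m1234 m5 (U _ _ _ _ m123 m4
  (U _ _ _ _ m12 m3 (U _ _ _ _ m1 m2 h1 h2) h3) h4) h5) h6).
Qed.

Section Good.
Variable w : T.
Hypothesis good : ~ bad w.
Let fV := pathV w.

Lemma not_bad : [/\ ~ bad_fall w, ~ bad_top w, ~ bad_level w, ~ bad_bottom w &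
  ~ bad_descent w] /\ ~ bad_slow w.
Proof.
by split; [split|] => h; apply: good; rewrite /bad /=; do ?[by right|left].
Qed.

Lemma pathV0 : fV 0 = 0. Proof. by rewrite /fV /pathV addn0 increment0. Qed.

(** The form in which an avoided ruin is used: the signal has a first time t, and after t no stretch
    of V up to N moves by v in the losing direction before moving by u in the other. *)
Lemma ruin_of_start s u v P k0 : P w k0 ->
  ~ ruined Z s u v (late P) (N + N) w ->
  exists2 t, (t <= k0)%N /\ P w t & (forall j, (j < t)%N -> ~ P w j) /\
   forall k, (t <= k)%N -> (k <= N)%N -> s * (fV k - fV t) <= - v ->
   (forall j, (t <= j)%N -> (j < k)%N -> s * (fV j - fV t) < u) -> False.
Proof.
move=> Pk nr; have [t [tk Pt] ht] := first_time Pk.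
exists t => //; split=> // k tk' kN hk hj; apply: nr; exists (N + t)%N; split; first by nat_lia.
split.
  split; first by split; [nat_lia|rewrite addKn].
  move=> i it [Ni]; apply: ht; nat_lia.
exists (N + k)%N; split; first by nat_lia.
split; first by nat_lia.
rewrite pathV_diff//; split=> // j tj jk.
have -> : j = (N + (j - N))%N by nat_lia.
by rewrite pathV_diff; [apply: hj|]; nat_lia.
Qed.

(** Since V is not confined it leaves (-b0, b0) by time N; if it stayed below D it would have left
    through -b0, which is [bad_descent]. *)
Lemma reaches_D : exists2 k, (k <= N)%N & D <= fV k.
Proof.
have D20 := D2; have Db0 := Db.
have [[_ _ _ _ nd] ns] := not_bad.
apply: contrapT => nex.
have lt k : (k <= N)%N -> fV k < D.
  by move=> kN; rewrite ltNge; apply/negP => h; apply: nex; exists k.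
apply: ns => j Nj jN; rewrite ltNge; apply/negP => hj.
have [t [t0 _] [_ ht]] := @ruin_of_start 1 D b0 (fun _ _ => True) 0%N I nd.
have {t0}t0 : t = 0%N by nat_lia.
rewrite t0 pathV0 in ht.
have ej : increment Z N j w = fV (j - N)%N by rewrite /fV /pathV subnKC.
have jN' : (j - N <= N)%N by nat_lia.
have := lt _ jN'; move: hj; rewrite ej => hj ltj.
refine (ht _ (leq0n _) jN' _ _).
  by move: hj; rewrite subr0 mul1r; case: (ger0P (fV _)); lra.
by move=> i _ ij; rewrite subr0 mul1r; apply: lt; nat_lia.
Qed.

Lemma first_argmin (f : nat -> R) r : exists m, [/\ (m <= r)%N,
  forall j, (j < m)%N -> f m < f j & forall j, (j <= r)%N -> f m <= f j].
Proof.
elim: r => [|r [m [mr h1 h2]]].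
  by exists 0%N; split=> // j; rewrite leqn0 => /eqP ->.
have [lt|le] := ltP (f r.+1) (f m).
  exists r.+1; split=> // j; first by rewrite ltnS => /h2; exact: lt_le_trans.
  by rewrite leq_eqVlt => /orP[/eqP -> //|/h2 /(le_trans (ltW lt))].
exists m; split=> //; first exact: leqW.
by move=> j; rewrite leq_eqVlt => /orP[/eqP -> //|/h2].
Qed.

(** Let t be the first time of a rise of height D'. From t until the first rise of height D, V stays
    within D - D' above V t, so avoiding [bad_fall] forbids a fall by L / 2: the minimum precedes t,
    and all adverse slopes remain small. *)
Lemma exists_profile : exists m r, [/\ (r <= N)%N, first_rise fV D m r & clean_rise fV D' m r].
Proof.
have D'D0 := D'D; have L00 := L0; have LD0 := LD'; have LD1 := DD'.
have [[nf _ _ _ _] _] := not_bad.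
have [k kN Dk] := reaches_D.
have [r [rk [i [ir hi]]] hr] :
    exists2 r, (r <= k)%N /\ (exists i, (i <= r)%N /\ D <= fV r - fV i) &
      forall j, (j < r)%N -> ~ (exists i, (i <= j)%N /\ D <= fV j - fV i).
  by apply: first_time; exists 0%N; rewrite pathV0 subr0.
have noD i' j : (i' <= j)%N -> (j < r)%N -> fV j - fV i' < D.
  by move=> ij jr; rewrite ltNge; apply/negP => h; apply: (hr j jr); exists i'.
have [m [mr h1 h2]] := first_argmin fV r.
have Dm : fV m + D <= fV r by have := h2 i ir; lra.
have Pr : rises_from_min w r by exists m; split=> //; rewrite -/fV; lra.
have [t [tr [i0 [i0t hi0]]] [tfirst ht]] := ruin_of_start Pr nf.
have low k' : (t <= k')%N -> (k' <= r)%N -> fV t - L / 2 < fV k'.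
  move=> tk kr; rewrite ltNge; apply/negP => h.
  refine (ht k' tk _ _ _); [by nat_lia|by lra|] => j tj jk.
  rewrite mul1r; have i0j : (i0 <= j)%N by nat_lia. have jr : (j < r)%N by nat_lia.
  by have := noD _ _ i0j jr; move: hi0; rewrite -/fV; lra.
have mt : (m < t)%N.
  rewrite ltnNge; apply/negP => tm; have := low m tm mr.
  have i0r : (i0 <= r)%N by nat_lia.
  by have := h2 _ i0r; move: hi0; rewrite -/fV; lra.
have small i' j : (i' <= j)%N -> (j < t)%N -> fV j - fV i' < D'.
  move=> ij jt; rewrite ltNge; apply/negP => h.
  by apply: (tfirst j jt); exists i'.
exists m, r; split; first by nat_lia.
  by split.
split=> [i' j ij jm|i' j mi ij jr]; first by apply: small => //; nat_lia.
have [it|ti] := ltnP i' t.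
  by have := small _ _ mi it; have := h2 _ jr; lra.
have [->|ijlt] : i' = j \/ (i' < j)%N by nat_lia.
  by rewrite subrr; lra.
have ir' : (i' < r)%N by nat_lia.
have tj : (t <= j)%N by nat_lia.
have i0r : (i0 <= r)%N by nat_lia.
(* Here V i' < V m + D and V j > V t - L / 2 >= V m + D' - L / 2, so the fall is less than D - D' +
   L / 2, which is at most D'. *)
have := noD _ _ mi ir'; have := low _ tj jr; have := h2 _ i0r.
by move: hi0; rewrite -/fV; lra.
Qed.

Section Ties.
Variables (mV rV mU rU : nat) (a b : R).
Let fU := pathU w.
Hypotheses (rVN : (rV <= N)%N) (rUN : (rU <= N)%N).
Hypotheses (pV : first_rise fV D mV rV) (pU : first_rise fU D mU rU).
Hypothesis aV : exists2 i, (i <= mV)%N & fV i = a.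
Hypothesis aM : forall i, (i <= mV)%N -> fV i <= a.
Hypothesis bU : exists2 i, (i <= mU)%N & fU i = b.
Hypothesis bM : forall i, (i <= mU)%N -> fU i <= b.

(** At the first time when V is above b - g, V can climb to at most a < b + g, that is by less than
    2 g, before its minimum; the descent to this minimum exceeds b - g - (a - D + g) > D - 3 g. This
    would be [bad_top]. *)
Lemma no_tie_max : D - g <= a - fV mV -> b < a + g -> a < b + g -> False.
Proof.
have g00 := g0; have D20 := D2.
have [[_ nt _ _ _] _] := not_bad; have [mr p1 p2 p3 p4] := pV.
move=> h1 h2 h3; have [ia im ea] := aV.
have Pk : near_top w ia.
  exists mU, rU; split=> [//|j jm]; rewrite -/fU -/fV ea.
  by have := bM jm; lra.
have [t [tk [m' [r' [[rN' p'] ht']]]] [_ ht]] := ruin_of_start Pk nt.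
have D0 : 0 < D by lra.
have [em _] := first_rise_unique D0 p' pU; rewrite em in ht'.
have [ib ibm eb] := bU.
have ft : b - g <= fV t by have := ht' _ ibm; rewrite -/fU -/fV eb.
apply: (ht mV); [by nat_lia|by nat_lia|by lra|] => j tj jm.
by have jm' : (j <= mV)%N by [nat_lia]; have := aM jm'; lra.
Qed.

(** At the first time when V is below b - D', its minimum is less than D - D' lower, while V later
    climbs to at least its minimum plus D, above b: a rise of more than D'. This would be
    [bad_level]. *)
Lemma no_tie_level : D' <= b - fV mV -> b - fV mV < D -> False.
Proof.
have g00 := g0; have D20 := D2; have D'D0 := D'D.
have [[_ _ nt _ _] _] := not_bad; have [mr p1 p2 p3 p4] := pV.
move=> h1 h2; have [ib ibm eb] := bU.
have Pk : under_top w mV.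
  exists mU, rU; split=> [//|]; exists ib; split=> //; rewrite -/fU -/fV eb; lra.
have [t [tk [m' [r' [[rN' p'] [j0 [jm hj0]]]]]] [_ ht]] := ruin_of_start Pk nt.
have D0 : 0 < D by lra.
have [em _] := first_rise_unique D0 p' pU; rewrite em in jm.
have ft : fV t <= b - D' by have := bM jm; move: hj0; rewrite -/fU -/fV; lra.
apply: (ht rV); [by nat_lia|by nat_lia|by lra|] => j tj jr.
by have jr' : (j <= rV)%N by [nat_lia]; have := p2 _ jr'; lra.
Qed.

(** If the minima agree, V is at most 1 above its own minimum when the bet opens, so it cannot fall
    by 2 before it rises by D - 1. This would be [bad_bottom]. *)
Lemma no_tie_min : fV mV <> fU mU.
Proof.
have D20 := D2.
have [[_ _ _ nt _] _] := not_bad; have [mr p1 p2 p3 p4] := pV.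
move=> e.
have Pk : near_bottom w mV.
  by exists mU, rU; split=> [//|]; rewrite -/fU -/fV e; lra.
have [t [tk [m' [r' [[rN' p'] ht']]]] [_ ht]] := ruin_of_start Pk nt.
have D0 : 0 < D by lra.
have [em _] := first_rise_unique D0 p' pU; rewrite em -/fU -/fV in ht'.
apply: (ht rV); [by nat_lia|by nat_lia|by lra|] => j tj jr.
by have jr' : (j <= rV)%N by [nat_lia]; have := p2 _ jr'; lra.
Qed.

End Ties.

End Good.

End TwoSidedExploration.

(** * From the environment to bounded independent steps *)

Section IID.
Context {R : realType} d (T : measurableType d) (Q : probability T R).
Variable alpha : int -> {RV Q >-> R}.
Hypothesis iid_alpha : iid alpha.
Variable phi : R -> R.
Hypothesis mphi : measurable_fun setT phi.

Lemma measurable_phi_alpha i : measurable_fun setT (fun w => phi (alpha i w)).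
Proof. exact: measurableT_comp. Qed.

Lemma mean_identically_distributed i : bounded_rv (fun w => phi (alpha i w)) ->
  bounded_rv (fun w => phi (alpha 0 w)) ->
  mean Q (fun w => phi (alpha i w)) = mean Q (fun w => phi (alpha 0 w)).
Proof.
move=> bi b0; have [_ id] := iid_alpha.
have e j : bounded_rv (fun w => phi (alpha j w)) ->
    (\int[Q]_w (phi (alpha j w))%:E = \int[distribution Q (alpha j)]_x (phi x)%:E)%E.
  move=> bj; rewrite integral_distribution; [by []|exact/measurable_EFinP|].
  exact: (bounded_rv_integrable Q bj).
rewrite /mean /Rintegral e// e//; congr fine.
by apply: eq_measure_integral => A mA _; exact: id.
Qed.

Lemma independent_steps (e : nat -> int) (c : nat -> R) : injective e ->
  forall n (B : nat -> set R), (forall i, measurable (B i)) ->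
  Q (\bigcap_(i in `I_n) (fun w => c i * phi (alpha (e i) w)) @^-1` B i) =
  (\prod_(i < n) Q ((fun w => (c i * phi (alpha (e i) w))%R) @^-1` B i))%E.
Proof.
move=> inj_e n B mB; have [ind _] := iid_alpha.
(* Independence is given over finite sets of sites while cylinders are indexed by exploration times;
   a left inverse of the enumeration translates one into the other. *)
have [e' ee'] : exists e' : int -> nat, cancel e e'.
  have ex z : exists k : nat, (exists j, e j = z) -> e k = z.
    by have [[j ej]|nj] := pselect (exists j, e j = z); [exists j|exists 0%N].
  have [e' he'] := choice ex; exists e' => j; apply: inj_e; apply: he'; by exists j.
pose A z := (fun x => c (e' z) * phi x) @^-1` B (e' z).
have mA z : measurable (A z).
  rewrite -[A z]setTI.
  have : measurable_fun setT (fun x => c (e' z) * phi x) by exact: measurable_funM.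
  exact.
pose s := [seq e i | i <- iota 0 n].
have us : uniq s by rewrite map_inj_uniq ?iota_uniq.
pose J : {fset int} := [fset x | x in s]%fset.
have inJ z : (z \in J) = (z \in s) by rewrite !inE.
have := ind J A mA.
have -> : \bigcap_(i in [set` J]) (alpha i @^-1` A i) =
    \bigcap_(i in `I_n) (fun w => c i * phi (alpha (e i) w)) @^-1` B i.
  apply/seteqP; split=> w /= h.
    move=> i i_n; have := h (e i); rewrite /A /= ee'; apply.
    by rewrite inJ map_f// mem_iota.
  move=> z; rewrite /= inJ => /mapP[i]; rewrite mem_iota => i_n ->.
  by rewrite /A /= ee'; exact: h.
move=> ->.
transitivity (\prod_(i <- s) Q (alpha i @^-1` A i))%E.
  apply: perm_big; apply: uniq_perm => //; exact: fset_uniq.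
rewrite big_map -[in iota 0 n](subn0 n) -/(index_iota 0 n) big_mkord.
by apply: eq_bigr => i _; rewrite /A ee'.
Qed.

End IID.

Section ClippedLogRatio.
Context {R : realType}.
Variable eta : R.
Hypothesis eta01 : 0 < eta < 1 / 2.

Definition elliptic (x : R) : bool := eta <= x <= 1 - eta.

(** Equal to the log ratio almost surely under ellipticity, but bounded at every point, as the
    pathwise bounds on the bets require. *)
Definition clipped (x : R) : R := if elliptic x then ln (1 - x) - ln x else 0.

Lemma clipped_log_ratio x : elliptic x -> clipped x = log_ratio x.
Proof.
move=> ex; rewrite /clipped ex /log_ratio lnM// ?posrE ?invr_gt0; move: ex eta01 => /andP[h1 h2] /andP[h3 h4].
- by rewrite lnV ?posrE//; lra.
- lra.
- lra.
Qed.

Lemma measurable_clipped : measurable_fun setT clipped.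
Proof.
apply: measurable_fun_ifT.
- apply: measurable_and; apply: measurable_fun_ler => //.
- apply: measurable_funB; last exact: measurable_ln.
  by apply: measurableT_comp => //; apply: measurable_funB.
- exact: measurable_cst.
Qed.

Lemma clipped_bound x : `|clipped x| <= - 2 * ln eta.
Proof.
move: eta01 => /andP[h3 h4].
have l0 : ln eta <= 0 by apply: ln_le0; lra.
rewrite /clipped; case: ifP; last by rewrite normr0; lra.
move=> /andP[h1 h2].
have b y : eta <= y -> y <= 1 -> `|ln y| <= - ln eta.
  move=> hy y1; rewrite ler0_norm ?ln_le0// lerN2 ler_ln ?posrE//; lra.
apply: le_trans (ler_normB _ _) _.
have := b x; have := b (1 - x); move=> h h'.
have : `|ln (1 - x)| <= - ln eta by apply: h; lra.
have : `|ln x| <= - ln eta by apply: h'; lra.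
lra.
Qed.

End ClippedLogRatio.

Section Orders.
Context {R : realType} (N : nat).

(** The potential reads site 1 first on the right, and site 0 first, with the opposite sign, on the
    left. [order_left] lists N sites of the left half-line and then the right one; [order_right]
    exchanges the roles. *)
Definition order_left (j : nat) : int := if (j < N)%N then - j%:Z else (j - N).+1%:Z.
Definition order_right (j : nat) : int := if (j < N)%N then j.+1%:Z else - (j - N)%N%:Z.
Definition sign_left (j : nat) : R := if (j < N)%N then -1 else 1.
Definition sign_right (j : nat) : R := if (j < N)%N then 1 else -1.

Lemma order_left_inj : injective order_left.
Proof. by move=> i j; rewrite /order_left; case: ifP; case: ifP; lia. Qed.

Lemma order_right_inj : injective order_right.
Proof. by move=> i j; rewrite /order_right; case: ifP; case: ifP; lia. Qed.

Lemma sign_left1 j : `|sign_left j| = 1.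
Proof. by rewrite /sign_left; case: ifP; rewrite ?normrN1 ?normr1. Qed.

Lemma sign_right1 j : `|sign_right j| = 1.
Proof. by rewrite /sign_right; case: ifP; rewrite ?normrN1 ?normr1. Qed.

End Orders.

Section GoodEnvironment.
Context {R : realType} d (T : measurableType d) (Q : probability T R).
Variable alpha : int -> {RV Q >-> R}.
Hypothesis alpha01 : forall i w, 0 < alpha i w < 1.
Hypothesis iid_alpha : iid alpha.

Lemma elliptic_as (eta0 : R) : 0 < eta0 < 1 / 2 ->
  sup [set x : R | Q [set w | x <= alpha 0 w] = 1%E] =
     sup [set x : R | Q [set w | alpha 0 w <= 1 - x] = 1%E] ->
  eta0 <= sup [set x : R | Q [set w | x <= alpha 0 w] = 1%E] ->
  forall i, Q [set w | elliptic (eta0 / 2) (alpha i w)] = 1%E.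
Proof.
move=> /andP[e0 e1] eqs les i.
have half : eta0 / 2 < eta0 by lra.
(* The supremum of the empty set is 0, so the lower bound [eta0] also shows that A is nonempty;
   halving [eta0] yields an actual element above it. *)
have big (A : set R) : eta0 <= sup A -> exists2 x, A x & eta0 / 2 < x.
  move=> h; apply: sup_gt; last exact: lt_le_trans h.
  by apply/set0P/negP => /eqP A0; move: h; rewrite A0 sup0; lra.
have mle (x : R) : measurable [set w | x <= alpha 0 w].
  rewrite (_ : [set w | _] = alpha 0 @^-1` `[x, +oo[%classic).
    by rewrite -[X in measurable X]setTI; exact: measurable_funPT.
  by apply/seteqP; split=> w /=; rewrite in_itv/= andbT.
have mge (x : R) : measurable [set w | alpha 0 w <= x].
  rewrite (_ : [set w | _] = alpha 0 @^-1` `]-oo, x]%classic).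
    by rewrite -[X in measurable X]setTI; exact: measurable_funPT.
  by apply/seteqP; split=> w /=; rewrite in_itv.
have [x1 /= q1 h1] := big _ les.
have [x2 /= q2 h2] := big _ (eq_ind _ (fun s => eta0 <= s) les _ eqs).
have [_ /(_ i 0 [set x | elliptic (eta0 / 2) x])] := iid_alpha.
have mell : measurable [set x : R | elliptic (eta0 / 2) x].
  rewrite (_ : [set x | _] = `[eta0 / 2, 1 - eta0 / 2]%classic); first exact: measurable_itv.
  by apply/seteqP; split=> w /=; rewrite in_itv.
move=> /(_ mell) ->.
have mE : measurable (alpha 0 @^-1` [set x : R | elliptic (eta0 / 2) x]).
  by rewrite -[X in measurable X]setTI; exact: measurable_funPT.
apply/eqP; rewrite eq_le probability_le1//=.
have n1 : Q (~` [set w | x1 <= alpha 0 w]) = 0%E by rewrite probability_setC// q1 subee.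
have n2 : Q (~` [set w | alpha 0 w <= 1 - x2]) = 0%E by rewrite probability_setC// q2 subee.
pose B1 := ~` [set w | x1 <= alpha 0 w]; pose B2 := ~` [set w | alpha 0 w <= 1 - x2].
have mB1 : measurable B1 by exact: measurableC.
have mB2 : measurable B2 by exact: measurableC.
have : (Q (~` (alpha 0 @^-1` [set x : R | elliptic (eta0 / 2) x])) <= 0)%E.
  apply: (@le_trans _ _ (Q (B1 `|` B2))).
    apply: le_measure; rewrite ?inE; [exact: measurableC|exact: measurableU|].
    move=> w /= h; apply: contrapT => /not_orP[/contrapT a1 /contrapT a2]; apply: h.
    by rewrite /elliptic; apply/andP; split; rewrite /= in a1 a2; lra.
  apply: (@le_trans _ _ (Q B1 + Q B2)%E); first exact: measureU2.
  by rewrite /B1 /B2 n1 n2 adde0.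
rewrite probability_setC// => h.
have fQ : Q (alpha 0 @^-1` [set x : R | elliptic (eta0 / 2) x]) \is a fin_num.
  exact: fin_num_measure.
by move: h; rewrite -(fineK fQ); set q := fine _ => h; rewrite lee_fin;
  move: h; rewrite -[(1 - _)%E]/((1 - q)%:E) lee_fin; lra.
Qed.

Variable eta : R.
Hypothesis eta01 : 0 < eta < 1 / 2.
Hypothesis ell : forall i, Q [set w | elliptic eta (alpha i w)] = 1%E.
Hypothesis mean0 : ('E_Q[fun w => log_ratio (alpha 0%R w)] = 0)%E.
Hypothesis var0 : (0 < 'V_Q[fun w => log_ratio (alpha 0%R w)])%E.

Let C : R := - 2 * ln eta.
Let cl (i : int) (w : T) : R := clipped eta (alpha i w).

Lemma measurable_cl i : measurable_fun setT (cl i).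
Proof. exact: measurable_phi_alpha (@measurable_clipped _ _) i. Qed.

Lemma bounded_cl i : bounded_rv (cl i).
Proof. by split; [exact: measurable_cl|exists C => w; exact: clipped_bound]. Qed.

Lemma measurable_elliptic i : measurable [set w | elliptic eta (alpha i w)].
Proof.
rewrite (_ : [set w | _] = alpha i @^-1` `[eta, 1 - eta]%classic).
  by rewrite -[X in measurable X]setTI; exact: measurable_funPT.
by apply/seteqP; split=> w /=; rewrite in_itv.
Qed.

Lemma log_ratio_ae i (F : R -> R) :
  {ae Q, forall w, setT w -> (F (cl i w))%:E = (F (log_ratio (alpha i w)))%:E}.
Proof.
exists (~` [set w | elliptic eta (alpha i w)]); split.
- exact/measurableC/measurable_elliptic.
- by rewrite probability_setC ?ell ?subee//; exact: measurable_elliptic.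
- by move=> w /= h e; apply: h => _; rewrite /cl clipped_log_ratio.
Qed.

Lemma measurable_log_ratio_alpha i : measurable_fun setT (fun w => log_ratio (alpha i w)).
Proof.
rewrite (_ : (fun w => _) = (fun w => ln (1 - alpha i w) - ln (alpha i w))).
  apply: measurable_funB; apply: measurableT_comp => //.
  by apply: measurable_funB.
apply/funext => w; have /andP[a0 a1] := alpha01 i w.
by rewrite /log_ratio lnM ?posrE ?invr_gt0 ?subr_gt0// lnV ?posrE.
Qed.

Lemma mean_cl i : mean Q (cl i) = 0.
Proof.
rewrite /cl (mean_identically_distributed iid_alpha (@measurable_clipped _ eta)
  (bounded_cl i) (bounded_cl 0)).
rewrite /mean /Rintegral.
have -> : (\int[Q]_w (clipped eta (alpha 0 w))%:E = \int[Q]_w (log_ratio (alpha 0 w))%:E)%E.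
  apply: ae_eq_integral => //.
  - exact/measurable_EFinP/measurable_cl.
  - exact/measurable_EFinP/measurable_log_ratio_alpha.
  - exact: (log_ratio_ae 0 id).
by move: mean0; rewrite expectation.unlock => ->.
Qed.

Definition variance_cl : R := mean Q (fun w => cl 0 w ^+ 2).

Lemma variance_cl_gt0 : 0 < variance_cl.
Proof.
rewrite -lte_fin; suff <- : ('V_Q[fun w => log_ratio (alpha 0%R w)] = variance_cl%:E)%E by [].
rewrite /variance covariance.unlock mean0 expectation.unlock /=.
have b2 : bounded_rv (fun w => cl 0 w ^+ 2) by apply: bounded_rvM; exact: bounded_cl.
rewrite /variance_cl /mean /Rintegral fineK; last first.
  exact: integrable_fin_num (bounded_rv_integrable Q b2).
apply/esym; transitivity (\int[Q]_w ((log_ratio (alpha 0 w)) ^+ 2)%:E)%E.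
  apply: ae_eq_integral => //.
  - by apply/measurable_EFinP; case: b2.
  - apply/measurable_EFinP; apply: measurable_funM; exact: measurable_log_ratio_alpha.
  - exact: (log_ratio_ae 0 (fun x => x ^+ 2)).
apply: eq_integral => w _.
transitivity (((log_ratio (alpha 0 w) - 0) * (log_ratio (alpha 0 w) - 0))%:E); last by [].
by rewrite subr0.
Qed.

Lemma mean_cl2 i : mean Q (fun w => cl i w ^+ 2) = variance_cl.
Proof.
have m2 : measurable_fun setT (fun x => clipped eta x ^+ 2).
  by apply: measurable_funM; exact: measurable_clipped.
have b2 j : bounded_rv (fun w => clipped eta (alpha j w) ^+ 2).
  by apply: bounded_rvM; exact: bounded_cl.
exact: (mean_identically_distributed iid_alpha m2 (b2 i) (b2 0)).
Qed.

Section Steps.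
Variables (e : nat -> int) (c : nat -> R).
Hypothesis inj_e : injective e.
Hypothesis c1 : forall j, `|c j| = 1.

Definition step (j : nat) (w : T) : R := c j * cl (e j) w.

Lemma measurable_step j : measurable_fun setT (step j).
Proof. by apply: measurable_funM => //; exact: measurable_cl. Qed.

Lemma independent_step n (B : nat -> set R) : (forall i, measurable (B i)) ->
  Q (\bigcap_(i in `I_n) step i @^-1` B i) = (\prod_(i < n) Q (step i @^-1` B i))%E.
Proof. exact: (independent_steps iid_alpha (@measurable_clipped _ eta) c inj_e). Qed.

Lemma step_bound j w : `|step j w| <= C.
Proof. by rewrite normrM c1 mul1r; exact: clipped_bound. Qed.

Lemma mean_step j : mean Q (step j) = 0.
Proof. by rewrite meanZ ?mean_cl ?mulr0//; exact: bounded_cl. Qed.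

Lemma mean_step2 j : mean Q (fun w => step j w ^+ 2) = variance_cl.
Proof.
rewrite -(mean_cl2 (e j)); congr mean; apply/funext => w.
by rewrite /step exprMn -[c j ^+ 2]real_normK ?num_real// c1 expr1n mul1r.
Qed.

End Steps.

Section Paths.
Variables (N : nat) (w : T).

Hypothesis ellw : forall i, elliptic eta (alpha i w).
Let S := potential (environment_at alpha w).

Lemma potential_right k : S k%:Z = \sum_(0 <= j < k) cl j.+1%:Z w.
Proof.
rewrite /S /= big_add1/=; apply: eq_bigr => j _.
by rewrite /cl clipped_log_ratio.
Qed.

Lemma potential_left k : S (- k%:Z) = - \sum_(0 <= j < k) cl (- j%:Z) w.
Proof.
case: k => [|k]; first by rewrite oppr0 /S /= !big_geq// oppr0.
rewrite (_ : - k.+1%:Z = Negz k)// /S /=; congr (- _); apply: eq_bigr => j _.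
by rewrite /cl clipped_log_ratio.
Qed.

Let ZL := step (order_left N) (sign_left N).
Let ZR := step (order_right N) (sign_right N).

Lemma pathV_left k : pathV ZL N w k = S k%:Z.
Proof.
rewrite potential_right /pathV /increment -{1}[N]add0n [(N + k)%N]addnC big_addn addnK.
apply: eq_bigr => j _; rewrite /ZL /step /sign_left /order_left.
by rewrite ltnNge leq_addl/= mul1r addnK.
Qed.

Lemma pathV_right k : pathV ZR N w k = S (- k%:Z).
Proof.
rewrite potential_left /pathV /increment -{1}[N]add0n [(N + k)%N]addnC big_addn addnK.
rewrite (big_morph _ (@opprD R) (@oppr0 R)).
apply: eq_bigr => j _; rewrite /ZR /step /sign_right /order_right.
by rewrite ltnNge leq_addl/= mulN1r addnK.
Qed.

Lemma pathU_left k : (k <= N)%N -> pathU ZL w k = S (- k%:Z).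
Proof.
move=> kN; rewrite potential_left /pathU /increment.
rewrite (big_morph _ (@opprD R) (@oppr0 R)).
apply: eq_big_nat => j /andP[_ jk]; rewrite /ZL /step /sign_left /order_left.
by rewrite (leq_trans jk kN) mulN1r.
Qed.

Lemma pathU_right k : (k <= N)%N -> pathU ZR w k = S k%:Z.
Proof.
move=> kN; rewrite potential_right /pathU /increment.
apply: eq_big_nat => j /andP[_ jk]; rewrite /ZR /step /sign_right /order_right.
by rewrite (leq_trans jk kN) mul1r.
Qed.

End Paths.

End GoodEnvironment.

Lemma first_rise_eq {R : realType} (f f' : nat -> R) D m r :
  (forall k, (k <= r)%N -> f k = f' k) -> first_rise f D m r -> first_rise f' D m r.
Proof.
move=> ff' [mr h1 h2 h3 h4]; split=> //.
- move=> j jm; rewrite -!ff'//; last exact: leq_trans (ltnW jm) mr.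
  exact: h1.
- by move=> j jr; rewrite -!ff'//; exact: h2.
- by rewrite -!ff'.
- move=> i j ij jr; rewrite -!ff'; [exact: h4|exact: leq_trans ij (ltnW jr)|exact: ltnW].
Qed.

Lemma max_exists {R : realType} (f : nat -> R) m :
  exists a, (exists2 i, (i <= m)%N & f i = a) /\ forall i, (i <= m)%N -> f i <= a.
Proof.
elim: m => [|m [a [[i im ei] ha]]].
  by exists (f 0%N); split; [exists 0%N|move=> i; rewrite leqn0 => /eqP ->].
have [le|lt] := lerP (f m.+1) a.
  exists a; split; first by exists i => //; exact: leqW.
  by move=> j; rewrite leq_eqVlt => /orP[/eqP -> //|]; rewrite ltnS; exact: ha.
exists (f m.+1); split; first by exists m.+1.
move=> j; rewrite leq_eqVlt => /orP[/eqP -> //|]; rewrite ltnS => /ha le.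
exact: le_trans le (ltW lt).
Qed.

(** * The good event, its probability, and its window *)

Section GoodEvent.
Context {R : realType} d (T : measurableType d) (Q : probability T R).
Variable alpha : int -> {RV Q >-> R}.
Hypothesis alpha01 : forall i w, 0 < alpha i w < 1.
Hypothesis iid_alpha : iid alpha.
Variable eta : R.
Hypothesis eta01 : 0 < eta < 1 / 2.
Hypothesis ell : forall i, Q [set w | elliptic eta (alpha i w)] = 1%E.
Hypothesis mean0 : ('E_Q[fun w => log_ratio (alpha 0%R w)] = 0)%E.
Hypothesis var0 : (0 < 'V_Q[fun w => log_ratio (alpha 0%R w)])%E.

Let C : R := - 2 * ln eta.
Let s2 : R := variance_cl alpha eta.

Variables (L D D' g b0 : R) (N : nat).
Hypotheses (g0 : 0 < g) (L0 : 0 < L) (D'gD : D' + g <= D) (LD' : L / 2 <= D')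
  (DD' : D - D' + L / 2 <= D') (gD : 3 * g < D) (D2 : 2 < D) (Db : D <= b0).

Let ZL := step alpha eta (order_left N) (sign_left N).
Let ZR := step alpha eta (order_right N) (sign_right N).

Definition all_elliptic : set T := [set w | forall i, elliptic eta (alpha i w)].

Definition good_event : set T :=
  (~` bad ZL N L D D' g b0 `&` ~` bad ZR N L D D' g b0) `&` all_elliptic.

Lemma all_elliptic_measurable : measurable all_elliptic /\ Q (~` all_elliptic) = 0%E.
Proof.
pose F (k : nat) := ~` [set w | elliptic eta (alpha k%:Z w)] `|`
  ~` [set w | elliptic eta (alpha (- k%:Z) w)].
have mel i : measurable [set w | elliptic eta (alpha i w)] by exact: measurable_elliptic.
have mF k : measurable (F k) by apply: measurableU; exact: measurableC.
have e : ~` all_elliptic = \bigcup_k F k.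
  apply/seteqP; split=> w.
    move=> /= /existsNP[i hi]; have [[k ek]|[k [ek _]]] := int_split i.
      by exists k => //; left; rewrite -ek.
    by exists k => //; right; rewrite -ek.
  by move=> [k _ [h|h]] hw; apply: h; exact: hw.
have me : measurable (~` all_elliptic) by rewrite e; exact: bigcupT_measurable.
split; first by rewrite -(setCK all_elliptic); exact: measurableC.
have n i : Q (~` [set w | elliptic eta (alpha i w)]) = 0%E.
  by rewrite probability_setC// ell subee.
have : Q.-negligible (\bigcup_k F k).
  by apply: negligible_bigcup => k; apply: negligibleU;
    (apply/negligibleP; [exact: measurableC|exact: n]).
by rewrite -e => /negligibleP; apply.
Qed.

Lemma D'_lt_D : D' < D. Proof. by have := g0; have := D'gD; lra. Qed.
Lemma D'_gt0 : 0 < D'. Proof. by have := L0; have := LD'; lra. Qed.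

Lemma good_event_measurable : measurable good_event.
Proof.
have [mE _] := all_elliptic_measurable; have DD := D'_lt_D.
have mb e c : measurable (bad (step alpha eta e c) N L D D' g b0).
  by apply: measurable_bad => // i; exact: measurable_step.
by apply: measurableI => //; apply: measurableI; exact/measurableC/mb.
Qed.

Lemma good_event_probability :
  ((1 - 2 * ((D - D' + C) / (L / 2) + (2 * g + C) / (D - 3 * g) + (D - D' + C) / D'
    + (2 + C) / (D - 1) + (D + C) / b0 + (b0 + C) ^+ 2 / (s2 * N.+1%:R)))%:E
   <= Q good_event)%E.
Proof.
set p := (X in 2 * X).
have [mE nE] := all_elliptic_measurable; have DD := D'_lt_D.
have mb e c : measurable (bad (step alpha eta e c) N L D D' g b0).
  by apply: measurable_bad => // i; exact: measurable_step.
have pb e c : injective e -> (forall j, `|c j| = 1) ->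
    (Q (bad (step alpha eta e c) N L D D' g b0) <= p%:E)%E.
  move=> inj_e c1; apply: bad_probability => //.
  - by move=> i; exact: measurable_step.
  - by move=> n B mB; exact: independent_step.
  - by move=> i w; exact: step_bound.
  - by move=> i; exact: mean_step.
  - exact: variance_cl_gt0.
  - by move=> i; exact: mean_step2.
have pL := pb _ _ (@order_left_inj N) (sign_left1 N).
have pR := pb _ _ (@order_right_inj N) (sign_right1 N).
have : (Q (~` good_event) <= (2 * p)%:E)%E.
  rewrite /good_event setCI setCI !setCK.
  have mU := measurableU _ _ (mb (order_left N) (sign_left N)) (mb (order_right N) (sign_right N)).
  apply: (@le_trans _ _ (Q (bad ZL N L D D' g b0 `|` bad ZR N L D D' g b0) + Q (~` all_elliptic))%E).
    by apply: measureU2 => //; exact: measurableC.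
  rewrite nE adde0.
  apply: (@le_trans _ _ (Q (bad ZL N L D D' g b0) + Q (bad ZR N L D D' g b0))%E).
    by apply: measureU2; exact: mb.
  by rewrite mulr_natl mulr2n EFinD; exact: leeD pL pR.
have mG := good_event_measurable.
have fG : Q good_event \is a fin_num by exact: fin_num_measure.
rewrite probability_setC// -(fineK fG); set q := fine _.
by rewrite -[(1 - _)%E]/((1 - q)%:E) !lee_fin; lra.
Qed.

(** Either order of exploration provides the profile of the half-line revealed last. The half-line
    with the lower barrier then plays V, and the corresponding order excludes the ties. *)
Lemma good_event_window w : good_event w ->
  clean_window D D' g (potential (environment_at alpha w)) N.
Proof.
move=> [[gL gR] ew]; have DD := D'_lt_D; have D'0 := D'_gt0.
set S := potential _.
have [mR [rR [rRN pR cR]]] := exists_profile L0 DD LD' DD' D2 Db gL.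
have [mL [rL [rLN pL cL]]] := exists_profile L0 DD LD' DD' D2 Db gR.
have VL k : pathV ZL N w k = S k%:Z by exact: pathV_left.
have VR k : pathV ZR N w k = S (- k%:Z) by exact: pathV_right.
have UL k : (k <= N)%N -> pathV ZR N w k = pathU ZL w k.
  by move=> kN; rewrite VR /ZL pathU_left.
have UR k : (k <= N)%N -> pathV ZL N w k = pathU ZR w k.
  by move=> kN; rewrite VL /ZR pathU_right.
have pUL : first_rise (pathU ZL w) D mL rL.
  by apply: first_rise_eq pL => k kr; apply: UL; exact: leq_trans rLN.
have pUR : first_rise (pathU ZR w) D mR rR.
  by apply: first_rise_eq pR => k kr; apply: UR; exact: leq_trans rRN.
have [mrR _ _ _ _] := pR; have [mrL _ _ _ _] := pL.
have mRN := leq_trans mrR rRN; have mLN := leq_trans mrL rLN.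
have [a [aR aM]] := max_exists (pathV ZL N w) mR.
have [b [bR bM]] := max_exists (pathV ZR N w) mL.
have bU : exists2 i, (i <= mL)%N & pathU ZL w i = b.
  by have [i im ei] := bR; exists i => //; rewrite -UL//; exact: leq_trans mLN.
have bMU i : (i <= mL)%N -> pathU ZL w i <= b.
  by move=> im; rewrite -UL; [exact: bM|exact: leq_trans mLN].
have aU : exists2 i, (i <= mR)%N & pathU ZR w i = a.
  by have [i im ei] := aR; exists i => //; rewrite -UR//; exact: leq_trans mRN.
have aMU i : (i <= mR)%N -> pathU ZR w i <= a.
  by move=> im; rewrite -UR; [exact: aM|exact: leq_trans mRN].
have VLS k : S k%:Z = pathV ZL N w k by rewrite VL.
have VRS k : S (- k%:Z) = pathV ZR N w k by rewrite VR.
have [ab|/ltW ba] := leP a b.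
  apply: (path_window g0 D'0 D'gD VLS VRS pR cR pL cL aR aM bR bM rRN rLN _ _ _ ab).
  - exact: (no_tie_max g0 D2 gL rRN rLN pR pUL aR aM bU bMU).
  - exact: (no_tie_level g0 DD D2 gL rRN rLN pR pUL bU bMU).
  - by rewrite UL//; apply: (no_tie_min D2 gL _ _ pR pUL).
apply: (clean_window_reflect g0 D'0 D'gD).
have VLS' k : S (- - k%:Z) = pathV ZL N w k by rewrite opprK VLS.
apply: (path_window (S := fun t => S (- t)) g0 D'0 D'gD VRS VLS' pL cL pR cR bR bM aR aM rLN rRN _ _ _ ba).
- exact: (no_tie_max g0 D2 gR rLN rRN pL pUR bR bM aU aMU).
- exact: (no_tie_level g0 DD D2 gR rLN rRN pL pUR aU aMU).
- by rewrite UR//; apply: (no_tie_min D2 gR _ _ pL pUR).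
Qed.

End GoodEvent.

(** * The basic valley of a good environment *)

Section QuenchedError.
Context {R : realType} (K u y z : R).
Hypotheses (K1 : 1 <= K) (u0 : 0 < u) (y1 : 1 <= y) (z0 : 0 < z).
Hypotheses (yz : 3000 * K ^+ 2 * (y * z) <= 1) (uz : 1 <= u * z ^+ 10).

(** Read u = n, z = 1 / log n, y = log_2 n and K = exp C: [b] bounds the mean hitting time, [kappa]
    the chance to escape per visit to the bottom, and [e] is the tolerance. *)
Let b := 8 * K * u * z ^+ 10.
Let kappa := 2 * z ^+ 11 / u.
Let e := (y ^+ 2)^-1.

Lemma quenched_error :
  [/\ 0 <= (b + 1) * kappa <= 1 / 2, 4 * ((b + 1) * kappa) <= e &
   2 * z ^+ 6 + u * kappa + (6 * (b + 1) ^+ 2 + u * (4 * b)) / (u * (e / 2)) ^+ 2 <= e].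
Proof.
have K1' := K1; have u0' := u0; have y1' := y1; have z0' := z0; have yz' := yz; have uz' := uz.
(* Every power of y below comes with at least the same power of z, so each error term is at most a
   multiple of K^2 t. *)
pose t := y * z.
have t0 : 0 < t by rewrite mulr_gt0//; lra.
have KK : K <= K ^+ 2 by rewrite expr2 ler_peMl//; lra.
have K2 : 1 <= K ^+ 2 by lra.
have Kt : K ^+ 2 * t <= 1 / 3000 by rewrite /t; lra.
have t1 : t <= 1 by apply: le_trans (_ : K ^+ 2 * t <= _); [rewrite ler_peMl// ltW|lra].
have zt : z <= t by rewrite ler_peMl// ltW.
have z1 : z <= 1 by exact: le_trans t1.
have zk k : z ^+ k <= 1 by rewrite exprn_ile1// ltW.
have zk0 k : 0 <= z ^+ k by rewrite exprn_ge0// ltW.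
have tk k : t ^+ k.+1 <= t by rewrite exprS ler_piMr// ?exprn_ile1// ltW.
have K0 : 0 <= K by lra.
have b0 : 0 <= b by rewrite /b !mulr_ge0// ltW.
have b1 : b + 1 <= 9 * K * u * z ^+ 10.
  have : u * z ^+ 10 <= K * (u * z ^+ 10) by rewrite ler_peMl// mulr_ge0// ltW.
  rewrite /b; lra.
have k0 : 0 <= kappa by rewrite /kappa divr_ge0 ?mulr_ge0// ltW.
have bk : (b + 1) * kappa <= 18 * K * z ^+ 21.
  apply: le_trans (ler_wpM2r k0 b1) _.
  rewrite le_eqVlt; apply/orP; left; apply/eqP; rewrite /kappa; field; lra.
have y0 : 0 < y by lra.
have y2 : 0 < y ^+ 2 by rewrite exprn_gt0.
have bke : 4 * ((b + 1) * kappa) <= e.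
  rewrite /e -[leRHS]mul1r ler_pdivlMr//.
  apply: (@le_trans _ _ (72 * K * z ^+ 21 * y ^+ 2)).
    by rewrite ler_wpM2r// ?(ltW y2)//; lra.
  have -> : 72 * K * z ^+ 21 * y ^+ 2 = 72 * (K * (t ^+ 2 * z ^+ 19)) by rewrite /t; ring.
  have : K * (t ^+ 2 * z ^+ 19) <= K ^+ 2 * t.
    apply: ler_pM => //.
      by rewrite mulr_ge0// exprn_ge0// ltW.
    by apply: le_trans (tk 1%N); rewrite ler_piMr// exprn_ge0// ltW.
  lra.
have e1 : e <= 1 by rewrite /e invf_le1// expr_ge1//; lra.
split => //.
  apply/andP; split; first by rewrite mulr_ge0//; lra.
  apply: le_trans bk _.
  have : K * z ^+ 21 <= K ^+ 2 * t.
    by apply: ler_pM => //; apply: le_trans (tk 20%N); rewrite lerXn2r ?nnegrE ?(ltW z0) ?(ltW t0).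
  lra.
rewrite {2}/e -[leRHS]mul1r ler_pdivlMr//.
have -> : (u * (e / 2)) ^+ 2 = u ^+ 2 / (4 * y ^+ 4) by rewrite /e; field; lra.
have u2 : 0 < u ^+ 2 by rewrite exprn_gt0.
have h1 : (6 * (b + 1) ^+ 2 + u * (4 * b)) / (u ^+ 2 / (4 * y ^+ 4)) <=
    (486 * K ^+ 2 * z ^+ 20 + 32 * K * z ^+ 10) * (4 * y ^+ 4).
  rewrite invf_div [leLHS]mulrA ler_pdivrMr// mulrAC ler_wpM2r ?mulr_ge0 ?exprn_ge0 ?(ltW y0)//.
  have : (b + 1) ^+ 2 <= (9 * K * u * z ^+ 10) ^+ 2.
    by rewrite lerXn2r ?nnegrE ?(le_trans _ b1) ?addr_ge0.
  have -> : u * (4 * b) = 32 * K * z ^+ 10 * u ^+ 2 by rewrite /b; ring.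
  have -> : (9 * K * u * z ^+ 10) ^+ 2 = 81 * (K ^+ 2 * z ^+ 20 * u ^+ 2) by ring.
  lra.
have -> : u * kappa = 2 * z ^+ 11 by rewrite /kappa; field; lra.
apply: (@le_trans _ _ ((2 * z ^+ 6 + 2 * z ^+ 11 +
    (486 * K ^+ 2 * z ^+ 20 + 32 * K * z ^+ 10) * (4 * y ^+ 4)) * y ^+ 2)).
  by rewrite ler_wpM2r ?(ltW y2)// lerD2l.
(* The coefficients add up to 2 + 2 + 1944 + 128 = 2076, which the factor 3000 in the hypothesis on
   y z absorbs. *)
have -> : (2 * z ^+ 6 + 2 * z ^+ 11 +
    (486 * K ^+ 2 * z ^+ 20 + 32 * K * z ^+ 10) * (4 * y ^+ 4)) * y ^+ 2 =
  2 * (t ^+ 2 * z ^+ 4) + 2 * (t ^+ 2 * z ^+ 9) + 1944 * (K ^+ 2 * (t ^+ 6 * z ^+ 14))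
    + 128 * (K * (t ^+ 6 * z ^+ 4)) by rewrite /t; ring.
have T i j : 0 <= t ^+ i.+1 * z ^+ j <= t.
  apply/andP; split; first by rewrite mulr_ge0 ?exprn_ge0// ltW.
  by apply: le_trans (tk i); rewrite ler_piMr// exprn_ge0// ltW.
have tKt : t <= K ^+ 2 * t by rewrite ler_peMl// ltW.
have /andP[_ a1] := T 1%N 4%N; have /andP[_ a2] := T 1%N 9%N.
have /andP[c3 a3] := T 5%N 14%N; have /andP[c4 a4] := T 5%N 4%N.
have a3' : K ^+ 2 * (t ^+ 6 * z ^+ 14) <= K ^+ 2 * t by rewrite ler_wpM2l//; lra.
have a4' : K * (t ^+ 6 * z ^+ 4) <= K ^+ 2 * t by apply: ler_pM => //; lra.
lra.
Qed.

End QuenchedError.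

(** A cube is what lets a large constant times y^2 be bounded by exp y. The factor 27 comes from exp
    (x / 3) >= x / 3. *)
Lemma expR_ge_cube {R : realType} (x : R) : 0 <= x -> x ^+ 3 <= 27 * expR x.
Proof.
move=> x0; have -> : expR x = expR (x / 3) ^+ 3.
  by rewrite -expRM_natl; congr expR; field.
have -> : x ^+ 3 = 27 * (x / 3) ^+ 3 by field.
rewrite ler_wpM2l// lerXn2r ?nnegrE ?expR_ge0 ?divr_ge0//.
by apply: le_trans (expR_ge1Dx _); lra.
Qed.

Section FailureBound.
Context {R : realType} (gamma C s2 L y N1 : R).
Hypotheses (gamma11 : 11 <= gamma) (C0 : 0 <= C) (s20 : 0 < s2) (y1 : 1 <= y).
Hypothesis large : (32 * (gamma + C) + 8 / s2) * y ^+ 2 <= L.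
Hypothesis LN : L ^+ 5 <= N1.

Let D := L + gamma * y.
Let D' := L - 20 * y.

Lemma large_linear : 32 * gamma * y <= L /\ 32 * C <= L.
Proof.
have y1' := y1; have C0' := C0; have g11 := gamma11.
have y0 : 0 <= y by lra.
have i0 : 0 <= 8 / s2 by rewrite divr_ge0// ltW.
have a0 : 0 <= 32 * (gamma + C) + 8 / s2 by lra.
have h : (32 * (gamma + C) + 8 / s2) * y <= L.
  by apply: le_trans large; rewrite ler_wpM2l// expr2 ler_peMl.
have gy : 32 * gamma * y <= (32 * (gamma + C) + 8 / s2) * y by rewrite ler_wpM2r//; lra.
have Cy : 32 * C * y <= (32 * (gamma + C) + 8 / s2) * y by rewrite ler_wpM2r//; lra.
have : C <= C * y by rewrite ler_peMr.
lra.
Qed.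

(** All six terms are O(y / L), and the hypothesis that L dominates y^2 turns y / L into 1 / y. *)
Lemma failure_bound :
  2 * ((D - D' + C) / (L / 2) + (2 * (gamma * y) + C) / (D - 3 * (gamma * y))
    + (D - D' + C) / D' + (2 + C) / (D - 1) + (D + C) / L ^+ 2
    + (L ^+ 2 + C) ^+ 2 / (s2 * N1)) <= y^-1.
Proof.
have y1' := y1; have C0' := C0; have g11 := gamma11; have s20' := s20.
have [gyL CL] := large_linear.
have y0 : 0 < y by lra.
have Cy : C <= C * y by rewrite ler_peMr// ltW.
have y_gy : 11 * y <= gamma * y by rewrite ler_wpM2r// ltW.
have L0 : 0 < L by lra.
have q0 : 0 <= y / L by rewrite divr_ge0 ?ltW.
have ratio num den c : 0 <= c -> num <= c * y -> L / 2 <= den -> num / den <= 2 * c * (y / L).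
  move=> c0 nc Ld; have d0 : 0 < den by lra.
  rewrite ler_pdivrMr//; apply: le_trans nc _.
  have -> : c * y = 2 * c * (y / L) * (L / 2) by field; lra.
  by rewrite ler_wpM2l// mulr_ge0// mulr_ge0.
have h1 : (D - D' + C) / (L / 2) <= 2 * (gamma + 20 + C) * (y / L).
  by apply: ratio => //; rewrite /D /D'; lra.
have h2 : (2 * (gamma * y) + C) / (D - 3 * (gamma * y)) <= 2 * (2 * gamma + C) * (y / L).
  by apply: ratio; rewrite /D; lra.
have h3 : (D - D' + C) / D' <= 2 * (gamma + 20 + C) * (y / L).
  by apply: ratio => //; rewrite /D /D'; lra.
have h4 : (2 + C) / (D - 1) <= 2 * (2 + C) * (y / L).
  by apply: ratio => //; rewrite /D; lra.
have h5 : (D + C) / L ^+ 2 <= 2 * (y / L).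
  rewrite ler_pdivrMr ?exprn_gt0//.
  have -> : 2 * (y / L) * L ^+ 2 = 2 * (y * L) by field; lra.
  have : L <= y * L by rewrite ler_peMl// ltW.
  by rewrite /D; lra.
have h6 : (L ^+ 2 + C) ^+ 2 / (s2 * N1) <= 4 / s2 * (y / L).
  have L5 : 0 < L ^+ 5 by rewrite exprn_gt0.
  rewrite ler_pdivrMr ?mulr_gt0//; last exact: lt_le_trans LN.
  apply: (@le_trans _ _ ((2 * L ^+ 2) ^+ 2)).
    have L2 : L <= L ^+ 2 by rewrite expr2 ler_peMl// ?ltW//; lra.
    by rewrite lerXn2r ?nnegrE; lra.
  have -> : (2 * L ^+ 2) ^+ 2 = 4 * (1 / L * L ^+ 5) by field; lra.
  have -> : 4 / s2 * (y / L) * (s2 * N1) = 4 * (y / L * N1) by field; lra.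
  rewrite ler_pM2l//; apply: ler_pM; rewrite ?exprn_ge0 ?divr_ge0 ?(ltW L0)//.
  by rewrite ler_pM2r ?invr_gt0.
(* Twice the sum of the six bounds is (16 gamma + 16 C + 172 + 8 / s2) y / L, and 172 <= 16 gamma
   since gamma is at least 11. *)
apply: (@le_trans _ _ ((32 * (gamma + C) + 8 / s2) * (y / L))).
  have Cq : 0 <= C * (y / L) by rewrite mulr_ge0.
  have gq : 11 * (y / L) <= gamma * (y / L) by rewrite ler_wpM2r.
  lra.
rewrite -[leRHS]mul1r ler_pdivlMr// mulrA mulrAC ler_pdivrMr// mul1r -mulrA -expr2.
exact: large.
Qed.

End FailureBound.

(** * The deviation bound in an environment with a clean window *)

Section CleanWindowDeviation.
Context {R : realType} (a : int -> R) (gamma C : R) (n N : nat).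
Let L : R := ilog 1 n.
Let y : R := ilog 2 n.
Hypothesis a01 : forall i, 0 < a i < 1.
Hypothesis aC : forall i, `|log_ratio (a i)| <= C.
Hypotheses (gamma11 : 11 <= gamma) (n0 : (0 < n)%N) (y1 : 1 <= y).
Hypotheses (NL : N%:R <= L ^+ 5) (Ln : L ^+ 10 <= n%:R) (yL : 20 * y <= L).
Hypothesis CyL : 3000 * expR C ^+ 2 * (y / L) <= 1.
Hypothesis cw : clean_window (Gamma gamma n) (L - 20 * y) (gamma * y) (potential a) N.

Lemma clean_window_deviation d (T : measurableType d) (X : nat -> T -> int)
    (P0 Pm : probability T R) (M' m M : int) :
  basic_valley (potential a) gamma n (Triplet M' m M) ->
  walk_law X a 0 P0 -> walk_law X a m Pm ->
  (P0 (deviation_event X m n (fine (mean_excursion_time X Pm (zint M' M) m)))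
    <= (1 / y ^+ 2)%:E)%E.
Proof.
have y1' := y1; have g11 := gamma11; have yL' := yL.
have L0 : 0 < L by lra.
have y0 : 0 < y by lra.
have nR : 0 < n%:R :> R by rewrite ltr0n.
have eL : expR L = n%:R by rewrite /L /ilog /= lnK ?posrE.
have ey : expR y = L by rewrite /y /ilog /= lnK ?posrE.
have gy0 : 0 < gamma * y by rewrite mulr_gt0//; lra.
have G0 : 0 < Gamma gamma n by rewrite /Gamma -/L -/y; lra.
have C0 : 0 <= C by apply: le_trans (aC 0).
have [l [m0 [r [w rise drop [Nl rN]]]]] := cw.
move=> /(basic_valley_window G0 gy0 w)[-> -> ->] XP0 XPm.
set z := L^-1.
have z0 : 0 < z by rewrite invr_gt0.
have ez k : expR (- (k%:R * y)) = z ^+ k.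
  by rewrite expRN expRM_natl ey exprVn.
have eg : expR (- (gamma * y)) <= z ^+ 11.
  by rewrite -ez ler_expR lerN2 ler_wpM2r// ltW.
have lm := window_lm w; have mr := window_mr w.
have width : (`|r - l|%N)%:R <= 2 * L ^+ 5.
  apply: (@le_trans _ _ (2 * N%:R)); last by rewrite ler_pM2l.
  by rewrite -natrM ler_nat; clear -Nl rN lm mr; lia.
set K := expR C.
have K1 : 1 <= K by rewrite /K -(expR0 R) ler_expR.
have hit x : hit_time a l m0 r x <= 8 * K * n%:R * z ^+ 10.
  have D'0 : 0 <= L - 20 * y by lra.
  apply: le_trans (hit_time_le (C := C) (D := L - 20 * y) lm mr x _ _ _ C0 D'0) _.
  - by move=> i j mi ij jr; exact/ltW/drop.
  - by move=> i j mi ij jr; exact/ltW/rise.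
  - by rewrite potential_step; exact: le_trans (ler_norm _) (aC l).
  (* As exp y = L, the factor exp (L - 20 y) is n L^-20, of which the squared width takes back
     L^10. *)
  rewrite -addrA [- _ + C]addrC addrA 2!expRD eL ez -/K.
  have -> : 8 * K * n%:R * z ^+ 10 = (2 * L ^+ 5) ^+ 2 * (2 * (n%:R * K * z ^+ 20)).
    by rewrite /z; field; lra.
  apply: ler_wpM2r.
    by rewrite !mulr_ge0 ?exprn_ge0 ?(ltW z0)//; lra.
  by rewrite lerXn2r ?nnegrE ?mulr_ge0 ?exprn_ge0// ltW.
have esc : step_mean a (escape a l m0 r) m0 <= 2 * z ^+ 11 / n%:R.
  apply: le_trans (escape_step_le (h := Gamma gamma n) a01 lm mr _ _) _.
  - by have := window_Sl w; lra.
  - by have := window_Sr w; lra.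
  rewrite -mulrA ler_pM2l// /Gamma opprD expRD expRN -/L eL mulrC.
  by rewrite ler_pM2r ?invr_gt0.
have out : escape a l m0 r 0 <= 2 * z ^+ 6.
  apply: le_trans (escape0_le (B := gamma * y) lm mr _ _ (window_l0 w) (window_0r w)) _.
  - exact: window_left_margin w.
  - exact: window_right_margin w.
  (* The width 2 L^5 times exp (- gamma y) <= L^-11. *)
  have -> : 2 * z ^+ 6 = (2 * L ^+ 5) * z ^+ 11 by rewrite /z; field; lra.
  by apply: ler_pM; rewrite ?expR_ge0.
have uz : 1 <= n%:R * z ^+ 10.
  by rewrite /z exprVn ler_pdivlMr ?exprn_gt0// mul1r.
have [k1 k2 k3] := quenched_error K1 nR y1 z0 CyL uz.
have e0 : 0 < (y ^+ 2)^-1 by rewrite invr_gt0 exprn_gt0.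
have W0 : l <= 0 <= r by rewrite (window_l0 w) (window_0r w).
apply: le_trans (deviation_probability a01 XP0 XPm lm mr hit esc out k1 erefl k2 e0 n0 W0) _.
by rewrite lee_fin div1r.
Qed.

End CleanWindowDeviation.

Lemma Rrate2_ge {R : realType} n : 1 <= ilog 3 n :> R -> 1 <= ilog 2 n :> R ->
  (ilog 2 n)^-1 <= Rrate 2 n :> R.
Proof.
move=> l1 y1; rewrite /Rrate -[leLHS]mul1r; apply: ler_pM => //.
- by rewrite invr_ge0 (le_trans ler01).
- by rewrite -[leLHS](powRr0 (ilog 3 n)) ler_powR.
- rewrite -powR_inv1 ?(le_trans ler01)// ler_powR//; lra.
Qed.

Lemma ilog_large {R : realType} (x : R) : exists n0 : nat, forall n, (n0 < n)%N ->
  x <= ilog 2 n :> R /\ expR (ilog 2 n) = ilog 1 n :> R /\ expR (ilog 1 n) = n%:R :> R.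
Proof.
exists (Num.truncn (expR (expR x))) => n hn.
have nx : expR (expR x) < n%:R.
  by apply: lt_le_trans (truncnS_gt _) _; rewrite ler_nat.
have n0 : 0 < n%:R :> R by exact: lt_trans (expR_gt0 _) nx.
have e1 : expR (ilog 1 n) = n%:R :> R by rewrite /ilog /= lnK ?posrE.
have L0 : expR x < ilog 1 n by rewrite -ltr_expR e1.
have e2 : expR (ilog 2 n) = ilog 1 n :> R.
  by rewrite /ilog /= lnK ?posrE//; exact: lt_trans (expR_gt0 _) L0.
by split=> //; rewrite -ler_expR e2 ltW.
Qed.

Theorem theorem3p8 (R : realType) :
  exists c : R, 0 < c /\
  forall (d1 : measure_display) (Omega1 : measurableType d1)
    (Q : probability Omega1 R) (alpha : int -> {RV Q >-> R}),
  (forall i w, 0 < alpha i w < 1) ->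
  iid alpha ->
  ('E_Q[fun w => log_ratio (alpha 0%R w)] = 0)%E ->
  (0 < 'V_Q[fun w => log_ratio (alpha 0%R w)])%E ->
  (exists eta0 : R, [/\ 0 < eta0 < 1 / 2,
     sup [set x : R | Q [set w | x <= alpha 0 w] = 1%E] =
     sup [set x : R | Q [set w | alpha 0 w <= 1 - x] = 1%E]
   & eta0 <= sup [set x : R | Q [set w | x <= alpha 0 w] = 1%E]]) ->
  forall gamma : R, 11 <= gamma ->
  exists (c1 : R) (n0 : nat), forall n : nat, (n0 < n)%N ->
  exists G : set Omega1,
    [/\ measurable G,
        ((1 - c * Rrate 2 n)%:E <= Q G)%E,
        forall w, G w -> exists V,
          basic_valley (potential (environment_at alpha w)) gamma n V
      & forall (d2 : measure_display) (Omega2 : measurableType d2)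
          (X : nat -> Omega2 -> int)
          (P : (int -> R) -> int -> probability Omega2 R),
        (forall (a : int -> R) (x : int), (forall i, 0 < a i < 1) ->
           walk_law X a x (P a x)) ->
        (ereal_sup
           [set p | exists (w : Omega1) (M' m M : int),
              [/\ G w,
                  basic_valley (potential (environment_at alpha w)) gamma n
                    (Triplet M' m M)
                & p = P (environment_at alpha w) 0%R
                    (deviation_event X m n
                      (fine (mean_excursion_time X
                        (P (environment_at alpha w) m) (zint M' M) m)))]]
         <= (c1 / (ilog 2 n) ^+ 2)%:E)%E].
Proof.
(* The constant can be 1 because the failure probability is O(log_2 n / log n), hence below 1 /
   log_2 n <= R_2(n) for large n; the dependence on Q and gamma goes into the threshold [n0]. *)
exists 1; split=> // d1 Omega1 Q alpha alpha01 iid_alpha mean0 var0 [eta0 [eta01 eqs les]].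
move=> gamma gamma11.
pose eta := eta0 / 2.
have ell := elliptic_as iid_alpha eta01 eqs les.
have eta01' : 0 < eta < 1 / 2 by rewrite /eta; move: eta01 => /andP[]; lra.
have s20 := variance_cl_gt0 alpha01 eta01' ell mean0 var0.
set s2 := variance_cl alpha eta in s20.
pose C : R := - 2 * ln eta.
have C0 : 0 <= C by apply: le_trans (clipped_bound eta01' 0).
pose K := expR C.
pose B := 3000 * K ^+ 2.
pose A := 32 * (gamma + C) + 8 / s2 + B.
have s20' : 0 < 8 / s2 by rewrite divr_gt0.
have K20 : 0 < K ^+ 2 by rewrite exprn_gt0 ?expR_gt0.
have B0 : 0 < B by rewrite /B; lra.
have A1 : 352 <= A by rewrite /A; lra.
(* The term 27 A gives 27 A y^2 <= y^3 <= 27 exp y, that is A y^2 <= L, from which all largeness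
   conditions follow; the term exp 1 ensures log_3 n >= 1. *)
have [n0 hn0] := @ilog_large R (27 * A + expR 1).
exists 1, n0 => n /hn0[]; set y := ilog 2 n; set L := ilog 1 n => ylarge [ey eL].
have e1 := expR_gt0 (1 : R).
have y1 : 1 <= y by lra.
have y0 : 0 < y by lra.
have L0 : 0 < L by rewrite -ey expR_gt0.
have y2 : 0 <= y ^+ 2 by rewrite exprn_ge0// ltW.
have AyL : A * y ^+ 2 <= L.
  have := expR_ge_cube (ltW y0); rewrite ey => h.
  have : 27 * A * y ^+ 2 <= y ^+ 3.
    by rewrite [leRHS]exprS ler_wpM2r//; lra.
  lra.
have By : 0 <= B * y ^+ 2 by rewrite mulr_ge0// ltW.
have large : (32 * (gamma + C) + 8 / s2) * y ^+ 2 <= L by move: AyL; rewrite /A; lra.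
have yy : y <= y ^+ 2 by rewrite expr2 ler_peMl// ltW.
have CyL : B * (y / L) <= 1.
  rewrite mulrA ler_pdivrMr// mul1r; apply: le_trans AyL.
  apply: ler_pM => //; [exact: ltW|exact: ltW|rewrite /A; lra].
have A20 : 20 * y <= L.
  by apply: le_trans AyL; apply: ler_pM => //; [exact: ltW|lra].
have n_gt0 : (0 < n)%N by rewrite -(ltr_nat R) -eL expR_gt0.
have [gyL CL] := large_linear gamma11 C0 s20 y1 large.
have ygy : 11 * y <= gamma * y by rewrite ler_wpM2r// ltW.
have LL : 2 * L <= L ^+ 2 by rewrite expr2 ler_pM2r//; lra.
have l3 : 1 <= ilog 3 n :> R.
  by rewrite -ler_expR -[ilog 3 n]/(ln y) lnK ?posrE//; lra.
have DE : Gamma gamma n = L + gamma * y by [].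
have g0 : 0 < gamma * y by lra.
have D'gD : L - 20 * y + gamma * y <= Gamma gamma n by rewrite DE; lra.
have LD' : L / 2 <= L - 20 * y by lra.
have DD' : Gamma gamma n - (L - 20 * y) + L / 2 <= L - 20 * y by rewrite DE; lra.
have gD : 3 * (gamma * y) < Gamma gamma n by rewrite DE; lra.
have D2 : 2 < Gamma gamma n by rewrite DE; lra.
have Db : Gamma gamma n <= L ^+ 2 by rewrite DE; lra.
have G0 : 0 < Gamma gamma n by lra.
have L10 : L ^+ 10 <= n%:R by rewrite -eL -{1}ey -expRM_natl ler_expR; lra.
(* Both sides of the truncation are used: [NL] bounds the width of the window, [LN] the probability
   of staying confined. *)
pose N := Num.truncn (L ^+ 5).
have NL : N%:R <= L ^+ 5 by rewrite truncn_le exprn_ge0// ltW.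
have LN : L ^+ 5 <= N.+1%:R by exact/ltW/truncnS_gt.
pose G := good_event alpha eta L (Gamma gamma n) (L - 20 * y) (gamma * y) (L ^+ 2) N.
have bound w : G w -> forall i, `|log_ratio (environment_at alpha w i)| <= C.
  by move=> [_ ew] i; rewrite -(clipped_log_ratio eta01' (ew i)) clipped_bound.
have cw w (Gw : G w) := good_event_window eta01' g0 L0 D'gD LD' DD' D2 Db Gw.
exists G; split.
- exact: good_event_measurable.
- apply: le_trans (good_event_probability alpha01 iid_alpha eta01' ell mean0 var0 N
    g0 L0 D'gD LD' gD D2 Db).
  rewrite lee_fin lerD2l lerN2 mul1r.
  apply: le_trans (Rrate2_ge l3 y1).
  exact: (failure_bound gamma11 C0 s20 y1 large LN).
- move=> w /cw[l [m [r [win _ _ _]]]].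
  by exists (Triplet l m r); exact: window_basic_valley.
- move=> d2 Omega2 X P XP; apply: ge_ereal_sup => p [w [M' [m [M [Gw bv ->]]]]].
  have a01 i : 0 < environment_at alpha w i < 1 by exact: alpha01.
  exact: (clean_window_deviation a01 (bound _ Gw) gamma11 n_gt0 y1 NL L10 A20 CyL
    (cw _ Gw) bv (XP _ _ a01) (XP _ _ a01)).
Qed.
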